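(* Let $d\ge 1$ be an integer, $b$ a prime and $v\ge 0$ an integer. Let $1\leq p,q\leq\infty$ (with $q>1$ if $p=\infty$) and $0\leq r<1/p$. There exists a constant $C_{p,q,r,d,b,v}>0$ such that for every positive integer $n$ and every order $2$ digital $(v,n,d)$-net $\mathcal{P}_n^b$ over $\mathbb{F}_b$ we have \[ \left\|D_{\mathcal{P}_n^b}\,|\,S_{p,q}^rB([0,1)^d)\right\|\leq C_{p,q,r,d,b,v}\,b^{n(r-1)}\,n^{(d-1)/q}. \]
   Context: Convention: $1/p=0$ if $p=\infty$, and $1/q=0$ if $q=\infty$. Discrepancy function: for a finite family $\mathcal{P}$ of $N$ points in $[0,1)^d$ (points counted with multiplicity), $D_{\mathcal{P}}(x)=\frac1N\sum_{z\in\mathcal{P}}\chi_{[0,x)}(z)-x_1\cdots x_d$ for $x=(x_1,\ldots,x_d)\in[0,1)^d$, where $\chi_{[0,x)}$ is the characteristic function of $[0,x)=[0,x_1)\times\cdots\times[0,x_d)$. Digital nets: let $b$ be prime and let $\mathbb{F}_b$ be the field with $b$ elements, identified with $\{0,1,\ldots,b-1\}$ with arithmetic modulo $b$. For $s,n\in\mathbb{N}$ with $s\ge n$ let $C_1,\ldots,C_d$ be $s\times n$ matrices over $\mathbb{F}_b$. For $\nu\in\{0,\ldots,b^n-1\}$ with $b$-adic expansion $\nu=\nu_0+\nu_1b+\cdots+\nu_{n-1}b^{n-1}$ put $\bar\nu=(\nu_0,\ldots,\nu_{n-1})^\top\in\mathbb{F}_b^n$, $C_i\bar\nu=(x_{i,\nu,1},\ldots,x_{i,\nu,s})^\top\in\mathbb{F}_b^s$,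 $x_{i,\nu}=x_{i,\nu,1}b^{-1}+\cdots+x_{i,\nu,s}b^{-s}\in[0,1)$ and $x_\nu=(x_{1,\nu},\ldots,x_{d,\nu})$. The family $\mathcal{P}_n^b=\{x_0,\ldots,x_{b^n-1}\}$ of $N=b^n$ points (with multiplicity) is called a digital net over $\mathbb{F}_b$. Order $\sigma$ digital $(v,n,d)$-net: let $\sigma\in\mathbb{N}$, $s\ge\sigma n$, and let $0\le v\le\sigma n$ be an integer. Let $c_{i,1},\ldots,c_{i,s}\in\mathbb{F}_b^n$ be the rows of $C_i$. If for all choices of $0\le\eta_i\le s$ and indices $1\le\lambda_{i,\eta_i}<\cdots<\lambda_{i,1}\le s$ ($1\le i\le d$) with \[\sum_{i=1}^d\left(\lambda_{i,1}+\cdots+\lambda_{i,\min(\eta_i,\sigma)}\right)\le\sigma n-v\] the vectors $c_{1,\lambda_{1,1}},\ldots,c_{1,\lambda_{1,\eta_1}},\ldots,c_{d,\lambda_{d,1}},\ldots,c_{d,\lambda_{d,\eta_d}}$ are linearly independent over $\mathbb{F}_b$, then $\mathcal{P}_n^b$ is called an order $\sigma$ digital $(v,n,d)$-net over $\mathbb{F}_b$. Besov spaces with dominating mixed smoothness: let $\mathcal{F}$ be the Fourier transform on tempered distributions $\mathcal{S}'(\mathbb{R}^d)$. Fix $\varphi_0\in\mathcal{S}(\mathbb{R})$ with $\varphi_0(x)=1$ for $|x|\le1$ and $\varphi_0(x)=0$ for $|x|>\frac32$; put $\varphi_k(x)=\varphi_0(2^{-k}x)-\varphi_0(2^{-k+1}x)$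 for $k\in\mathbb{N}$ and $\varphi_{\bar k}(x)=\varphi_{k_1}(x_1)\cdots\varphi_{k_d}(x_d)$ for $\bar k=(k_1,\ldots,k_d)\in\mathbb{N}_0^d$. For $0<p,q\le\infty$, $r\in\mathbb{R}$, $S_{p,q}^rB(\mathbb{R}^d)$ consists of all $f\in\mathcal{S}'(\mathbb{R}^d)$ with finite quasi-norm \[\|f|S_{p,q}^rB(\mathbb{R}^d)\|=\Big(\sum_{\bar k\in\mathbb{N}_0^d}2^{r(k_1+\cdots+k_d)q}\,\|\mathcal{F}^{-1}(\varphi_{\bar k}\mathcal{F}f)|L_p(\mathbb{R}^d)\|^q\Big)^{1/q}\] (supremum if $q=\infty$). Let $\mathcal{D}'([0,1)^d)$ be the space of distributions dual to the smooth complex-valued functions on $\mathbb{R}^d$ with compact support in the interior of $[0,1)^d$. $S_{p,q}^rB([0,1)^d)$ consists of all $f\in\mathcal{D}'([0,1)^d)$ with finite quasi-norm $\|f|S_{p,q}^rB([0,1)^d)\|=\inf\{\|g|S_{p,q}^rB(\mathbb{R}^d)\|:\ g\in S_{p,q}^rB(\mathbb{R}^d),\ g|_{[0,1)^d}=f\}$. *)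

(* Defs.v *)
From HB Require Import structures.
From mathcomp Require Import all_boot all_order all_algebra.
From mathcomp Require Import complex.
From mathcomp Require Import all_classical all_reals all_analysis.

Set Implicit Arguments.
Unset Strict Implicit.
Unset Printing Implicit Defensive.

Import Order.TTheory GRing.Theory Num.Theory.
Import numFieldNormedType.Exports.

Local Open Scope classical_set_scope.
Local Open Scope ring_scope.
Local Open Scope complex_scope.

(** ** Lebesgue measure on R^d

    Points of R^d are row vectors ['rV[R]_d] (this type carries the normed-space
    structure); the measurable structure used is the product sigma-algebra of
    [d.-tuple R], and [rv] identifies the two. *)

Section lebesgue_Rd.
Context {R : realType}.

Definition tcons n (x : measurableTypeR R * n.-tuple (measurableTypeR R)) :
    n.+1.-tuple (measurableTypeR R) :=
  [tuple of x.1 :: x.2].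

Lemma measurable_tcons n : measurable_fun [set: _] (@tcons n).
Proof. exact: measurable_cons. Qed.

Definition lebesgue_cons n
    (mu : {measure set (n.-tuple (measurableTypeR R)) -> \bar R}) :
    {measure set (n.+1.-tuple (measurableTypeR R)) -> \bar R} :=
  measure_function_pushforward__canonical__measure_function_Measure
    (product_measure2 (@lebesgue_measure R) mu) (measurable_tcons (n := n)).

Fixpoint lebesgue_Rd (d : nat) :
    {measure set (d.-tuple (measurableTypeR R)) -> \bar R} :=
  match d with
  | 0 => \d_ [tuple]
  | n.+1 => lebesgue_cons (lebesgue_Rd n)
  end.

Definition rv d (t : d.-tuple (measurableTypeR R)) : 'rV[R]_d :=
  \row_i tnth t i.

End lebesgue_Rd.

Local Notation normc := ComplexField.Normc.normc.

Section functions_on_Rd.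
Context {R : realType} {d : nat}.
Local Notation Rd := 'rV[R]_d.

Definition integralC (D : set Rd) (f : Rd -> R[i]) : R[i] :=
  (\int[lebesgue_Rd d]_(t in @rv R d @^-1` D) complex.Re (f (rv t)))
  +i* (\int[lebesgue_Rd d]_(t in @rv R d @^-1` D) complex.Im (f (rv t))).

Definition integrableC (D : set Rd) (f : Rd -> R[i]) : Prop :=
  (lebesgue_Rd d).-integrable (@rv R d @^-1` D)
    (fun t => (complex.Re (f (rv t)))%:E) /\
  (lebesgue_Rd d).-integrable (@rv R d @^-1` D)
    (fun t => (complex.Im (f (rv t)))%:E).

Definition measurable_funC (f : Rd -> R[i]) : Prop :=
  measurable_fun [set: d.-tuple (measurableTypeR R)]
    (fun t => complex.Re (f (rv t))) /\
  measurable_fun [set: d.-tuple (measurableTypeR R)]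
    (fun t => complex.Im (f (rv t))).

Definition normLp (p : \bar R) (f : Rd -> R[i]) : \bar R :=
  Lnorm (lebesgue_Rd d) p (fun t => (normc (f (rv t)))%:E).

(** Multi-indices of derivatives are lists of directions: [partials [:: i; j]]
    is d_i d_j. *)
Definition partials (s : seq 'I_d) (f : Rd -> R) : Rd -> R :=
  foldr (fun i g x => 'D_(delta_mx 0 i) g x) f s.

Definition smooth (f : Rd -> R) : Prop :=
  forall s : seq 'I_d, continuous (partials s f) /\
    forall (i : 'I_d) (x : Rd), derivable (partials s f) x (delta_mx 0 i).

Definition smoothC (f : Rd -> R[i]) : Prop :=
  smooth (fun x => complex.Re (f x)) /\ smooth (fun x => complex.Im (f x)).

Definition partialsC (s : seq 'I_d) (f : Rd -> R[i]) (x : Rd) : R[i] :=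
  partials s (fun y => complex.Re (f y)) x
  +i* partials s (fun y => complex.Im (f y)) x.

(** The weight |x^a D^s f (x)| of the seminorms of the Schwartz space. *)
Definition schwartz_weight (a : 'I_d -> nat) (s : seq 'I_d) (f : Rd -> R[i])
    (x : Rd) : R :=
  (\prod_i `|x 0 i| ^+ a i) * normc (partialsC s f x).

Definition schwartz (f : Rd -> R[i]) : Prop :=
  smoothC f /\
  forall (a : 'I_d -> nat) (s : seq 'I_d),
    exists M : R, forall x, schwartz_weight a s f x <= M.

Definition schwartz_cvg0 (f : nat -> Rd -> R[i]) : Prop :=
  forall (a : 'I_d -> nat) (s : seq 'I_d) (e : R), 0 < e ->
    \forall j \near \oo, forall x, schwartz_weight a s (f j) x <= e.

(** Functionals on test functions are represented by total functions; only their
    values on the relevant test functions are ever used. *)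
Definition functional := (Rd -> R[i]) -> R[i].

(** S'(R^d).  As S(R^d) is metrizable, continuity is sequential continuity. *)
Definition tempered (T : functional) : Prop :=
  (forall (c : R[i]) (f g : Rd -> R[i]), schwartz f -> schwartz g ->
     T (fun x => c * f x + g x) = c * T f + T g) /\
  (forall f : nat -> Rd -> R[i], (forall j, schwartz (f j)) ->
     schwartz_cvg0 f -> normc (T (f j)) @[j --> \oo] --> (0 : R)).

Definition dot (x y : Rd) : R := \sum_i x 0 i * y 0 i.

Definition expi (t : R) : R[i] := cos t +i* sin t.

Definition fourier (f : Rd -> R[i]) (xi : Rd) : R[i] :=
  ((2 * pi) `^ (- (d%:R / 2)))%:C *
  integralC setT (fun x => f x * expi (- dot x xi)).

Definition inv_fourier (f : Rd -> R[i]) (x : Rd) : R[i] :=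
  ((2 * pi) `^ (- (d%:R / 2)))%:C *
  integralC setT (fun xi => f xi * expi (dot x xi)).

(** Extension to tempered distributions by duality. *)
Definition fourier_distr (T : functional) : functional :=
  fun f => T (fourier f).

Definition inv_fourier_distr (T : functional) : functional :=
  fun f => T (inv_fourier f).

Definition mul_distr (g : Rd -> R[i]) (T : functional) : functional :=
  fun f => T (fun x => g x * f x).

Definition represents (g : Rd -> R[i]) (T : functional) : Prop :=
  measurable_funC g /\
  forall f, schwartz f ->
    integrableC setT (fun x => g x * f x) /\
    T f = integralC setT (fun x => g x * f x).

(** The L_p-(quasi-)norm of a tempered distribution: that of the function, unique
    almost everywhere, representing it; +oo if the distribution is not regular. *)
Definition normLp_distr (p : \bar R) (T : functional) : \bar R :=
  ereal_inf [set normLp p g | g in [set g | represents g T]].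

End functions_on_Rd.

Section besov.
Context {R : realType}.

Definition schwartz1 (f : R -> R[i]) : Prop :=
  schwartz (fun x : 'rV[R]_1 => f (x 0 0)).

Definition dyadic_cutoff (phi0 : R -> R[i]) : Prop :=
  [/\ schwartz1 phi0,
      forall x, `|x| <= 1 -> phi0 x = 1 &
      forall x, 3 / 2 < `|x| -> phi0 x = 0].

Definition phi1 (phi0 : R -> R[i]) (k : nat) (x : R) : R[i] :=
  if k is k'.+1 then phi0 (x / 2 ^+ k) - phi0 (x / 2 ^+ k') else phi0 x.

Context {d : nat}.

Definition phi (phi0 : R -> R[i]) (k : {ffun 'I_d -> nat}) (x : 'rV[R]_d) :
    R[i] :=
  \prod_i phi1 phi0 (k i) (x 0 i).

Definition block (phi0 : R -> R[i]) (k : {ffun 'I_d -> nat})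
    (f : @functional R d) : @functional R d :=
  inv_fourier_distr (mul_distr (phi phi0 k) (fourier_distr f)).

Definition besov_norm_Rd (p q : \bar R) (r : R) (phi0 : R -> R[i])
    (f : @functional R d) : \bar R :=
  if q is q'%:E then
    ((\esum_(k in [set: {ffun 'I_d -> nat}])
        ((2 `^ (r * (\sum_i k i)%N%:R * q'))%:E *
         normLp_distr p (block phi0 k f) `^ q')) `^ q'^-1)%E
  else
    ereal_sup [set ((2 `^ (r * (\sum_i k i)%N%:R))%:E *
                    normLp_distr p (block phi0 k f))%E
              | k in [set: {ffun 'I_d -> nat}]].

Definition besov_Rd (p q : \bar R) (r : R) (phi0 : R -> R[i]) :
    set (@functional R d) :=
  [set f | tempered f /\ (besov_norm_Rd p q r phi0 f < +oo)%E].

Definition cube : set 'rV[R]_d := [set x | forall i, 0 <= x 0 i < 1].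

Definition open_cube : set 'rV[R]_d := [set x | forall i, 0 < x 0 i < 1].

Definition cube_test (f : 'rV[R]_d -> R[i]) : Prop :=
  [/\ smoothC f, compact (closure [set x | f x != 0]) &
      closure [set x | f x != 0] `<=` open_cube].

(** The value is +oo exactly when [f] does not belong to S^r_{p,q}B([0,1)^d).
    An [f] which is the restriction of a tempered distribution is automatically
    in D'([0,1)^d). *)
Definition besov_norm_cube (p q : \bar R) (r : R) (phi0 : R -> R[i])
    (f : @functional R d) : \bar R :=
  ereal_inf [set besov_norm_Rd p q r phi0 g | g in
    [set g | besov_Rd p q r phi0 g /\ forall h, cube_test h -> g h = f h]].

Definition distr_of_cube (D : 'rV[R]_d -> R) : @functional R d :=
  fun h => integralC cube (fun x => (D x)%:C * h x).

Definition discrepancy N (P : 'I_N -> 'rV[R]_d) (x : 'rV[R]_d) : R :=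
  N%:R^-1 * \sum_(k < N) [forall i, 0 <= P k 0 i < x 0 i]%:R - \prod_i x 0 i.

End besov.

Section digital_nets.
Variables (b d s n : nat).

Definition digit_vector (nu : nat) : 'cV['F_b]_n :=
  \col_(j < n) ((nu %/ b ^ j) %% b)%N%:R.

Definition digital_net (R : realType) (C : 'I_d -> 'M['F_b]_(s, n))
    (nu : 'I_(b ^ n)) : 'rV[R]_d :=
  \row_i \sum_(j < s)
    (nat_of_ord ((C i *m digit_vector nu) j 0))%:R / b%:R ^+ j.+1.

(** [lam i] lists lambda_{i,1} > lambda_{i,2} > ... (so eta_i is its size);
    the ordinal [l : 'I_s] stands for the row index [l.+1] of the mathematical
    text. *)
Definition order_digital_net (sigma v : nat) (C : 'I_d -> 'M['F_b]_(s, n)) :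
    Prop :=
  [/\ (sigma * n <= s)%N, (v <= sigma * n)%N &
      forall lam : 'I_d -> seq 'I_s,
        (forall i, sorted (fun l l' : 'I_s => l' < l)%N (lam i)) ->
        (\sum_(i < d) \sum_(l <- take sigma (lam i)) l.+1
           <= sigma * n - v)%N ->
        free (flatten [seq [seq row l (C i) | l <- lam i] | i <- enum 'I_d])].

End digital_nets.

(* Main.v *)
(** The discrepancy function D is extended by zero to R^d.  Its dyadic block of
    index k is represented by the convolution of this extension with a tensor
    product of one-dimensional kernels K_{k_i} (the inverse Fourier transforms of
    the phi_{k_i}).  As D is built from tensor products, the value of the block at
    y is the quadrature error of the net for the tensor product of the functions
    f_i(z) = int_z^1 K_{k_i}(y_i - t) dt.

    Each f_i is expanded in the b-adic Faber system of hierarchical piecewise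
    linear functions.  For a multi-level a with |a| = a_1 + ... + a_d <= n, linear
    functions are expanded further along the base-b digits of their argument; a
    tensor product of parts depending on the first a_i digits and the digit m_i is
    integrated exactly when the sum of the m_i + a_i is at most 2n - v, by the
    order 2 property, and what remains carries a factor b^(-3(n - |a|)/2).  Levels
    |a| > n are estimated trivially.  The decay 1/(1 + u^2) of the kernels then
    bounds each level in L_1 and in L_infinity, hence in L_p, and the contribution
    of level a to 2^(r|k|) times the L_p-norm of the block is at most

      C b^(n(r-1)) rho^(||a| - n|) prod_i min(x_i, 1/x_i)^(1/p - r)

    with x_i = 2^(k_i) / b^(a_i) and rho < 1.  The sum over k converges
    geometrically for fixed a, and the sum over a of the remaining factor is of
    order n^(d-1). *)

Require Import Defs.
From HB Require Import structures.
From mathcomp Require Import all_boot all_order all_algebra.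
From mathcomp Require Import complex.
From mathcomp Require Import all_classical all_reals all_analysis.
From mathcomp Require Import measurable_realfun ring lra zify.

Set Implicit Arguments.
Unset Strict Implicit.
Unset Printing Implicit Defensive.

Import Order.TTheory GRing.Theory Num.Theory.
Import numFieldNormedType.Exports.

Local Open Scope classical_set_scope.
Local Open Scope ring_scope.
Local Open Scope complex_scope.

Local Notation normc := ComplexField.Normc.normc.

(** * Complex-valued integrals *)

Section normc_theory.
Context {R : rcfType}.
Implicit Types x y : R[i].

(** The norm is Fourier-analytic, so the blocks are estimated directly, without a characterisation
    of the space by Haar or Faber coefficients: the b-adic expansion acts on the responses f_i, and
    the dyadic scale 2^(k_i) meets the b-adic scale b^(a_i) only through their ratio x_i. The decay
    of the kernels is first recorded in nonnegative weights; the net then enters twice, through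
    exactness for products of digits (cancellation, |a| <= n) and through the number of points in
    b-adic boxes (the bound in L_infinity). Levels |a| < n are summable for every r >= 0 only if the
    cancellation beats b^(-(n - |a|)); the exponent 3/2 leaves a surplus of 1/2. Levels |a| > n are
    summable because r < 1/p. The bound for a block, summed over its levels, is uniform in k. Hence
    the l_q-sum over the blocks is controlled by the l_1-sum, which yields the power (d-1)/q of n.
    All expansions stop at a level J that depends on the blocks at hand. The rest is treated as one
    additional level, and the constants do not depend on J. *)

Lemma normc_ge0 x : 0 <= normc x.
Proof. by case: x => a b; rewrite /normc sqrtr_ge0. Qed.

Lemma normcD x y : normc (x + y) <= normc x + normc y.
Proof. exact: le_normcD. Qed.

Lemma normcM x y : normc (x * y) = normc x * normc y.
Proof. exact: ComplexField.Normc.normcM. Qed.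

Lemma normcB x y : normc (x - y) <= normc x + normc y.
Proof. by rewrite (le_trans (normcD _ _))// lerD2l (@normcN R y). Qed.

Lemma normc_real (a : R) : normc a%:C = `|a|.
Proof. by rewrite /normc /= expr0n /= addr0 sqrtr_sqr. Qed.

Lemma Re_le_normc x : `|complex.Re x| <= normc x.
Proof.
by case: x => a b; rewrite /normc/= -sqrtr_sqr ler_wsqrtr// lerDl sqr_ge0.
Qed.

Lemma Im_le_normc x : `|complex.Im x| <= normc x.
Proof.
by case: x => a b; rewrite /normc/= -sqrtr_sqr ler_wsqrtr// lerDr sqr_ge0.
Qed.

Lemma normc_le_ReIm x : normc x <= `|complex.Re x| + `|complex.Im x|.
Proof.
have -> : x = (complex.Re x)%:C + 'i * (complex.Im x)%:C by exact: complexE.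
rewrite (le_trans (normcD _ _))// normcM !normc_real.
have -> : normc ('i : R[i]) = 1.
  by rewrite /normc/= expr0n /= add0r expr1n sqrtr1.
by rewrite mul1r; case: x => a b /=; simpc.
Qed.

Lemma ReM x y :
  complex.Re (x * y) =
  complex.Re x * complex.Re y - complex.Im x * complex.Im y.
Proof. by case: x y => a b [c e]. Qed.

Lemma ImM x y :
  complex.Im (x * y) =
  complex.Re x * complex.Im y + complex.Im x * complex.Re y.
Proof. by case: x y => a b [c e] /=; rewrite addrC. Qed.

Lemma normc_sum I (r : seq I) (P : pred I) (F : I -> R[i]) :
  normc (\sum_(i <- r | P i) F i) <= \sum_(i <- r | P i) normc (F i).
Proof.
elim/big_ind2: _ => [|x a y c xa yc|//]; last exact: le_trans (normcD _ _) (lerD xa yc).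
by rewrite ComplexField.Normc.normc0.
Qed.

Lemma normc_prod I (r : seq I) (P : pred I) (F : I -> R[i]) :
  normc (\prod_(i <- r | P i) F i) = \prod_(i <- r | P i) normc (F i).
Proof.
elim/big_ind2: _ => [|x a y c <- <-|//]; last exact: normcM.
by rewrite ComplexField.Normc.normc1.
Qed.

Lemma complex_eq x y :
  complex.Re x = complex.Re y -> complex.Im x = complex.Im y -> x = y.
Proof. by case: x y => a b [c e] /= -> ->. Qed.

End normc_theory.

Section complex_integral.
Context d (T : measurableType d) (R : realType).
Implicit Types (f g : T -> R[i]) (mu : {measure set T -> \bar R}).

Definition cmeas f := measurable_fun setT (fun x => complex.Re (f x)) /\
  measurable_fun setT (fun x => complex.Im (f x)).

Definition cintegrable mu f :=
  mu.-integrable setT (fun x => (complex.Re (f x))%:E) /\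
  mu.-integrable setT (fun x => (complex.Im (f x))%:E).

Definition cint mu f : R[i] :=
  (\int[mu]_x complex.Re (f x)) +i* (\int[mu]_x complex.Im (f x)).

Lemma cmeas_cst c : cmeas (cst c).
Proof. by split; exact: measurable_cst. Qed.

Lemma cmeas_real (f : T -> R) :
  measurable_fun setT f -> cmeas (fun x => (f x)%:C).
Proof. by move=> mf; split => //=; exact: measurable_cst. Qed.

Lemma cmeasM f g : cmeas f -> cmeas g -> cmeas (fun x => f x * g x).
Proof.
move=> [f1 f2] [g1 g2]; split => /=.
  under eq_fun do rewrite ReM.
  by apply: measurable_funB; exact: measurable_funM.
under eq_fun do rewrite ImM.
by apply: measurable_funD; exact: measurable_funM.
Qed.

Lemma cmeas_prod I (r : seq I) (P : pred I) (F : I -> T -> R[i]) :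
  (forall i, P i -> cmeas (F i)) -> cmeas (fun x => \prod_(i <- r | P i) F i x).
Proof.
move=> mF; elim: r => [|i r IH].
  rewrite (_ : (fun x => _) = cst 1); first exact: cmeas_cst.
  by apply/funext => x; rewrite big_nil.
rewrite (_ : (fun x => _) = if P i then
    (fun x => F i x * \prod_(i <- r | P i) F i x)
  else fun x => \prod_(i <- r | P i) F i x).
  by case: ifP => // Pi; apply: cmeasM => //; exact: mF.
by apply/funext => x; rewrite big_cons; case: ifP.
Qed.

Lemma cmeas_normc f : cmeas f -> measurable_fun setT (fun x => normc (f x)).
Proof.
move=> [f1 f2].
apply: (eq_measurable_fun (fun x =>
  Num.sqrt (complex.Re (f x) ^+ 2 + complex.Im (f x) ^+ 2))).
  by move=> x _; case: (f x).
have ms : measurable_fun setT (@Num.sqrt R).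
  by apply: continuous_measurable_fun; exact: sqrt_continuous.
apply: (measurableT_comp ms).
by apply: measurable_funD; apply: measurable_funX.
Qed.

Lemma cintegrable_cmeas mu f : cintegrable mu f -> cmeas f.
Proof.
by move=> [/measurable_int/measurable_EFinP ? /measurable_int/measurable_EFinP].
Qed.

Lemma cintegrable_dom mu f (g : T -> R) : cmeas f ->
  (forall x, normc (f x) <= g x) -> mu.-integrable setT (EFin \o g) ->
  cintegrable mu f.
Proof.
move=> [mf1 mf2] fg ig; split.
  apply: (le_integrable measurableT _ _ ig).
    by apply/measurable_EFinP.
  move=> x _ /=; rewrite lee_fin (le_trans (Re_le_normc _))//.
  by rewrite (le_trans (fg x))// ler_norm.
apply: (le_integrable measurableT _ _ ig).
  by apply/measurable_EFinP.
move=> x _ /=; rewrite lee_fin (le_trans (Im_le_normc _))//.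
by rewrite (le_trans (fg x))// ler_norm.
Qed.

Lemma cintegrable_normc mu f : cintegrable mu f ->
  mu.-integrable setT (fun x => (normc (f x))%:E).
Proof.
move=> fi; have mf := cintegrable_cmeas fi; move: fi => [f1 f2].
have := integrableD measurableT (integrable_abse f1) (integrable_abse f2).
apply: (le_integrable measurableT).
  by apply/measurable_EFinP; exact: cmeas_normc.
move=> x _ /=; rewrite lee_fin ger0_norm ?normc_ge0//.
by rewrite (le_trans (normc_le_ReIm _))// ler_norm.
Qed.

Lemma cintegrable_real mu (f : T -> R) :
  mu.-integrable setT (EFin \o f) -> cintegrable mu (fun x => (f x)%:C).
Proof. by move=> fi; split => //=; exact: integrable0. Qed.

Lemma cint_real mu (f : T -> R) :
  cint mu (fun x => (f x)%:C) = (\int[mu]_x f x)%:C.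
Proof. by rewrite /cint /= Rintegral_cst// mul0r. Qed.

Lemma cintegrableD mu f g : cintegrable mu f -> cintegrable mu g ->
  cintegrable mu (fun x => f x + g x).
Proof.
move=> [f1 f2] [g1 g2]; split.
  have := integrableD measurableT f1 g1; apply: eq_integrable => // x _.
  by case: (f x) (g x) => ? ? [].
have := integrableD measurableT f2 g2; apply: eq_integrable => // x _.
by case: (f x) (g x) => ? ? [].
Qed.

Lemma cintD mu f g : cintegrable mu f -> cintegrable mu g ->
  cint mu (fun x => f x + g x) = cint mu f + cint mu g.
Proof.
move=> [f1 f2] [g1 g2]; apply: complex_eq => /=.
  rewrite -RintegralD//; congr (fine _); apply: eq_integral => x _.
  by case: (f x) (g x) => ? ? [].
rewrite -RintegralD//; congr (fine _); apply: eq_integral => x _.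
by case: (f x) (g x) => ? ? [].
Qed.

Lemma cintegrableZ mu c f : cintegrable mu f -> cintegrable mu (fun x => c * f x).
Proof.
move=> [f1 f2]; split.
  have := integrableB measurableT (integrableZl measurableT (complex.Re c) f1)
    (integrableZl measurableT (complex.Im c) f2).
  by apply: eq_integrable => // x _ /=; rewrite ReM EFinB !EFinM.
have := integrableD measurableT (integrableZl measurableT (complex.Re c) f2)
  (integrableZl measurableT (complex.Im c) f1).
by apply: eq_integrable => // x _ /=; rewrite ImM EFinD !EFinM.
Qed.

Lemma cintZ mu c f : cintegrable mu f ->
  cint mu (fun x => c * f x) = c * cint mu f.
Proof.
move=> [f1 f2]; apply: complex_eq; rewrite ?ReM ?ImM /=.
  under eq_Rintegral do rewrite ReM.
  rewrite RintegralB// ?RintegralZl//.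
    by have := integrableZl measurableT (complex.Re c) f1.
  by have := integrableZl measurableT (complex.Im c) f2.
under eq_Rintegral do rewrite ImM.
rewrite RintegralD// ?RintegralZl//.
  by have := integrableZl measurableT (complex.Re c) f2.
by have := integrableZl measurableT (complex.Im c) f1.
Qed.

Lemma cintegrable_sum mu I (r : seq I) (F : I -> T -> R[i]) :
  (forall i, cintegrable mu (F i)) ->
  cintegrable mu (fun x => \sum_(i <- r) F i x).
Proof.
move=> Fi; elim: r => [|i r IH].
  under eq_fun do rewrite big_nil.
  by split => /=; exact: integrable0.
by under eq_fun do rewrite big_cons; exact: cintegrableD.
Qed.

Lemma cint_sum mu I (r : seq I) (F : I -> T -> R[i]) :
  (forall i, cintegrable mu (F i)) ->
  cint mu (fun x => \sum_(i <- r) F i x) = \sum_(i <- r) cint mu (F i).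
Proof.
move=> Fi; elim: r => [|i r IH].
  under eq_fun do rewrite big_nil.
  by rewrite big_nil /cint/= Rintegral_cst// mul0r.
under eq_fun do rewrite big_cons.
by rewrite big_cons cintD ?IH//; exact: cintegrable_sum.
Qed.

Lemma eq_cint mu f g : f =1 g -> cint mu f = cint mu g.
Proof. by move=> /funext ->. Qed.

(** The factor 2 arises from estimating the real and the imaginary part separately; it only affects
    constants. *)
Lemma normc_cint mu f (g : T -> R) : cintegrable mu f ->
  (forall x, normc (f x) <= g x) -> mu.-integrable setT (EFin \o g) ->
  normc (cint mu f) <= 2 * \int[mu]_x g x.
Proof.
move=> [f1 f2] fg ig; rewrite (le_trans (normc_le_ReIm _))//= mulr2n mulrDl mul1r.
apply: lerD.
  rewrite (le_trans (le_normr_Rintegral _ f1))//; apply: le_Rintegral => //.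
    exact: integrable_norm.
  by move=> x _; exact: le_trans (Re_le_normc _) (fg x).
rewrite (le_trans (le_normr_Rintegral _ f2))//; apply: le_Rintegral => //.
  exact: integrable_norm.
by move=> x _; exact: le_trans (Im_le_normc _) (fg x).
Qed.

End complex_integral.

(** * Fubini for functions dominated by tensor products *)

Section fubini_dominated.
Context d1 d2 (T1 : measurableType d1) (T2 : measurableType d2) (R : realType).
Variables (m1 : {sigma_finite_measure set T1 -> \bar R}).
Variables (m2 : {sigma_finite_measure set T2 -> \bar R}).

Lemma integrable_prod_dom (f : T1 * T2 -> R) (g : T1 -> R) (h : T2 -> R) :
  measurable_fun setT f ->
  m1.-integrable setT (EFin \o g) -> m2.-integrable setT (EFin \o h) ->
  (forall x y, `|f (x, y)| <= g x * h y) ->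
  (m1 \x m2)%E.-integrable setT (EFin \o f).
Proof.
move=> mf ig ih fgh; apply/integrable12ltyP; first exact/measurable_EFinP.
apply: (@le_lt_trans _ _ (\int[m1]_x \int[m2]_y (`|g x| * `|h y|)%:E)%E).
  apply: ge0_le_integral => //.
  - by move=> x _; exact: integral_ge0.
  - apply: (@measurable_fun_fubini_tonelli_F _ _ _ _ _ m2 (fun z => `|(f z)%:E|%E)) => //=.
    by apply/measurable_EFinP; exact: measurableT_comp.
  - have -> : (fun x => \int[m2]_y (`|g x| * `|h y|)%:E)%E =
       fun x => (`|g x|%:E * \int[m2]_y (`|h y|)%:E)%E.
      apply/funext => x; rewrite -ge0_integralZl//.
      - by apply/measurable_EFinP; apply: measurableT_comp => //; move/measurable_int/measurable_EFinP: ih.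
    apply: emeasurable_funM => //; apply/measurable_EFinP.
    by apply: measurableT_comp => //; move/measurable_int/measurable_EFinP: ig.
  - move=> x _; apply: ge0_le_integral => //.
    + by apply/measurable_EFinP; apply: measurableT_comp => //; exact: measurable_fun_pair2.
    + apply/measurable_EFinP; apply: measurable_funM => //.
      by apply: measurableT_comp => //; move/measurable_int/measurable_EFinP: ih.
    + move=> y _; rewrite lee_fin (le_trans (fgh x y))// -normrM.
      exact: ler_norm.
have -> : (\int[m1]_x \int[m2]_y (`|g x| * `|h y|)%:E =
    \int[m1]_x (`|g x|%:E * \int[m2]_y (`|h y|)%:E))%E.
  apply: eq_integral => x _; rewrite -ge0_integralZl//.
  by apply/measurable_EFinP; apply: measurableT_comp => //; move/measurable_int/measurable_EFinP: ih.
rewrite ge0_integralZr//.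
- apply: lte_mul_pinfty => //.
  + by apply: integral_ge0 => x _; rewrite lee_fin.
  + by rewrite ge0_fin_numE; [move/integrableP: ig => []|exact: integral_ge0].
  + by move/integrableP: ih => [].
- by apply/measurable_EFinP; apply: measurableT_comp => //; move/measurable_int/measurable_EFinP: ig.
- by apply: integral_ge0 => x _; rewrite lee_fin.
Qed.

Section dom.
Variables (f : T1 * T2 -> R[i]) (g : T1 -> R) (h : T2 -> R).
Hypothesis mf : cmeas f.
Hypothesis ig : m1.-integrable setT (EFin \o g).
Hypothesis ih : m2.-integrable setT (EFin \o h).
Hypothesis fgh : forall x y, normc (f (x, y)) <= g x * h y.

Lemma integrable_prod_domRe :
  (m1 \x m2)%E.-integrable setT (fun x => (complex.Re (f x))%:E).
Proof.
apply: (integrable_prod_dom _ ig ih); first exact: mf.1.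
by move=> x y; exact: le_trans (Re_le_normc _) (fgh x y).
Qed.

Lemma integrable_prod_domIm :
  (m1 \x m2)%E.-integrable setT (fun x => (complex.Im (f x))%:E).
Proof.
apply: (integrable_prod_dom _ ig ih); first exact: mf.2.
by move=> x y; exact: le_trans (Im_le_normc _) (fgh x y).
Qed.

Lemma cmeas_pair2 x : cmeas (fun y => f (x, y)).
Proof. by split; apply: (measurable_fun_pair2 (f := fun z => _ (f z))); [exact: mf.1|exact: mf.2]. Qed.

Lemma cmeas_pair1 y : cmeas (fun x => f (x, y)).
Proof. by split; apply: (measurable_fun_pair1 (f := fun z => _ (f z))); [exact: mf.1|exact: mf.2]. Qed.

(** As [g x * h y] is finite for every [x], every slice is integrable, without an exceptional null
    set. Partial integrals written with [cint] are therefore genuine integrals at each point, and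
    passing to finite values loses nothing. *)
Lemma cintegrable_pair2 x : cintegrable m2 (fun y => f (x, y)).
Proof.
apply: (@cintegrable_dom _ _ _ _ _ (fun y => g x * h y)); first exact: cmeas_pair2.
  by move=> y; exact: fgh.
by have := integrableZl measurableT (g x) ih.
Qed.

Lemma cintegrable_pair1 y : cintegrable m1 (fun x => f (x, y)).
Proof.
apply: (@cintegrable_dom _ _ _ _ _ (fun x => g x * h y)); first exact: cmeas_pair1.
  by move=> x; exact: fgh.
by have := integrableZr measurableT (h y) ig.
Qed.

Lemma cint_pair2_EFin x :
  ((complex.Re (cint m2 (fun y => f (x, y))))%:E =
     \int[m2]_y (complex.Re (f (x, y)))%:E)%E /\
  ((complex.Im (cint m2 (fun y => f (x, y))))%:E =
     \int[m2]_y (complex.Im (f (x, y)))%:E)%E.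
Proof.
have [i1 i2] := cintegrable_pair2 x.
by split; rewrite /= /Rintegral fineK//; exact: integrable_fin_num.
Qed.

Lemma cint_pair1_EFin y :
  ((complex.Re (cint m1 (fun x => f (x, y))))%:E =
     \int[m1]_x (complex.Re (f (x, y)))%:E)%E /\
  ((complex.Im (cint m1 (fun x => f (x, y))))%:E =
     \int[m1]_x (complex.Im (f (x, y)))%:E)%E.
Proof.
have [i1 i2] := cintegrable_pair1 y.
by split; rewrite /= /Rintegral fineK//; exact: integrable_fin_num.
Qed.

Lemma cmeas_cint2 : cmeas (fun x => cint m2 (fun y => f (x, y))).
Proof.
split; apply/measurable_EFinP.
  rewrite (_ : _ \o _ = fun x => \int[m2]_y (complex.Re (f (x, y)))%:E)%E.
    exact: measurable_fubini_F integrable_prod_domRe.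
  by apply/funext => x; exact: (cint_pair2_EFin x).1.
rewrite (_ : _ \o _ = fun x => \int[m2]_y (complex.Im (f (x, y)))%:E)%E.
  exact: measurable_fubini_F integrable_prod_domIm.
by apply/funext => x; exact: (cint_pair2_EFin x).2.
Qed.

Lemma cmeas_cint1 : cmeas (fun y => cint m1 (fun x => f (x, y))).
Proof.
split; apply/measurable_EFinP.
  rewrite (_ : _ \o _ = fun y => \int[m1]_x (complex.Re (f (x, y)))%:E)%E.
    exact: measurable_fubini_G integrable_prod_domRe.
  by apply/funext => y; exact: (cint_pair1_EFin y).1.
rewrite (_ : _ \o _ = fun y => \int[m1]_x (complex.Im (f (x, y)))%:E)%E.
  exact: measurable_fubini_G integrable_prod_domIm.
by apply/funext => y; exact: (cint_pair1_EFin y).2.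
Qed.

Lemma cintegrable_cint2 : cintegrable m1 (fun x => cint m2 (fun y => f (x, y))).
Proof.
apply: (@cintegrable_dom _ _ _ _ _ (fun x => (2 * \int[m2]_y h y) * g x)).
- exact: cmeas_cint2.
- move=> x; rewrite -mulrA [_ * g x]mulrC -RintegralZl//; apply: normc_cint.
  + exact: cintegrable_pair2.
  + by move=> y; exact: fgh.
  + by have := integrableZl measurableT (g x) ih.
- by have := integrableZl measurableT (2 * \int[m2]_y h y) ig.
Qed.

Lemma cintegrable_cint1 : cintegrable m2 (fun y => cint m1 (fun x => f (x, y))).
Proof.
apply: (@cintegrable_dom _ _ _ _ _ (fun y => (2 * \int[m1]_x g x) * h y)).
- exact: cmeas_cint1.
- move=> y; rewrite -mulrA [_ * h y]mulrC -RintegralZl//; apply: normc_cint.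
  + exact: cintegrable_pair1.
  + by move=> x; rewrite mulrC; exact: fgh.
  + by have := integrableZl measurableT (h y) ig.
- by have := integrableZl measurableT (2 * \int[m1]_x g x) ih.
Qed.

Lemma cFubini :
  cint m1 (fun x => cint m2 (fun y => f (x, y))) =
  cint m2 (fun y => cint m1 (fun x => f (x, y))).
Proof.
apply: complex_eq; rewrite /= {1 3}/Rintegral; congr fine.
  under eq_integral do rewrite (cint_pair2_EFin _).1.
  under [RHS]eq_integral do rewrite (cint_pair1_EFin _).1.
  exact: Fubini integrable_prod_domRe.
under eq_integral do rewrite (cint_pair2_EFin _).2.
under [RHS]eq_integral do rewrite (cint_pair1_EFin _).2.
exact: Fubini integrable_prod_domIm.
Qed.

Lemma cint_prod : cint (m1 \x^ m2)%E f = cint m1 (fun x => cint m2 (fun y => f (x, y))).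
Proof.
apply: complex_eq; rewrite /= {1 2}/Rintegral; congr fine.
  rewrite -(integral12_prod_meas2 integrable_prod_domRe).
  by apply: eq_integral => x _; rewrite (cint_pair2_EFin _).1.
rewrite -(integral12_prod_meas2 integrable_prod_domIm).
by apply: eq_integral => x _; rewrite (cint_pair2_EFin _).2.
Qed.

End dom.
End fubini_dominated.

(** * Lebesgue measure on tuples and tensor products *)

Section lebesgue_Rd_theory.
Context {R : realType}.
Local Notation Rt d := (d.-tuple (measurableTypeR R)).
Local Notation mu1 := (@lebesgue_measure R).

Definition tuple_box d (n : nat) : set (Rt d) :=
  [set t | forall i, `|tnth t i| <= n%:R].

Lemma measurable_tuple_box d n : measurable (@tuple_box d n).
Proof.
rewrite (_ : tuple_box n =
    \bigcap_(i in [set: 'I_d]) ((fun t => tnth t i) @^-1` `[- n%:R, n%:R])).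
  apply: fin_bigcap_measurable => // i _; rewrite -[X in measurable X]setTI.
  by apply: measurable_tnth => //; exact: measurable_itv.
apply/seteqP; split => t tn i /=.
  by move=> _; rewrite in_itv/= -ler_norml; exact: tn.
by have := tn i Logic.I; rewrite /= in_itv/= -ler_norml.
Qed.

Lemma lebesgue_Rd_box d n : (lebesgue_Rd d (@tuple_box d n) < +oo)%E.
Proof.
elim: d => [|d IH]; first by rewrite /= diracE ltry.
rewrite /= /pushforward.
rewrite (_ : tcons (n:=d) @^-1` tuple_box n = (`[- n%:R, n%:R] `*` tuple_box n)); last first.
  apply/seteqP; split => [[x t] /= tn|[x t] [/= xn tn]].
    split => [/=|i /=].
      by rewrite in_itv/= -ler_norml; have := tn ord0; rewrite tnth0.
    by have := tn (lift ord0 i); rewrite tnthS.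
  move=> i /=; have [j ->|->] := unliftP ord0 i; first by rewrite tnthS; exact: tn.
  by rewrite tnth0/=; move: xn; rewrite in_itv/= -ler_norml.
rewrite product_measure2E//; last exact: measurable_tuple_box.
apply: lte_mul_pinfty => //.
have fin : (mu1 [set` `[- (n%:R : R), n%:R]%R] < +oo)%E.
  by rewrite lebesgue_measure_itv/=; case: ifP => // _; rewrite -EFinB ltry.
by rewrite ge0_fin_numE ?measure_ge0//; exact: fin.
Qed.

Lemma lebesgue_Rd_sigma_finite d : sigma_finite setT (lebesgue_Rd (R := R) d).
Proof.
exists (@tuple_box d); last first.
  by move=> n; split; [exact: measurable_tuple_box|exact: lebesgue_Rd_box].
apply/seteqP; split => // t _.
exists (Num.truncn (\sum_i `|tnth t i|)).+1 => // i.
apply: (@le_trans _ _ (\sum_i `|tnth t i|)).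
  by rewrite (bigD1 i)//= lerDl sumr_ge0.
by rewrite ltW// truncnS_gt.
Qed.

(* [lebesgue_Rd d] is packaged as a mere measure, but Fubini needs sigma-finiteness. *)
Definition lebRd d : set (Rt d) -> \bar R := lebesgue_Rd d.

HB.instance Definition _ d := Measure.on (@lebRd d).

HB.instance Definition _ d :=
  Measure_isSigmaFinite.Build _ _ _ (@lebRd d) (@lebesgue_Rd_sigma_finite d).

Definition sfleb d : {sigma_finite_measure set (Rt d) -> \bar R} := @lebRd d.
Definition sfleb1 : {sigma_finite_measure set (measurableTypeR R) -> \bar R} := mu1.

Lemma cint_pushforward d1 d2 (X : measurableType d1) (Y : measurableType d2)
    (h : X -> Y) (mh : measurable_fun setT h)
    (mu : {measure set X -> \bar R}) (f : Y -> R[i]) :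
  cmeas f -> cintegrable mu (f \o h) ->
  cintegrable (measure_function_pushforward__canonical__measure_function_Measure
      mu mh) f /\
  cint (measure_function_pushforward__canonical__measure_function_Measure
      mu mh) f = cint mu (f \o h).
Proof.
move=> [mf1 mf2] [if1 if2].
move/measurable_EFinP : mf1 => mf1; move/measurable_EFinP : mf2 => mf2.
split.
  by split; apply: integrable_pushforward; rewrite ?preimage_setT.
apply: complex_eq; rewrite /= /Rintegral; congr fine.
  by rewrite (integral_pushforward mh mf1)// preimage_setT.
by rewrite (integral_pushforward mh mf2)// preimage_setT.
Qed.

Lemma cmeas_tnth d (f : R -> R[i]) (i : 'I_d) :
  cmeas (f : measurableTypeR R -> R[i]) -> cmeas (fun t : Rt d => f (tnth t i)).
Proof.
move=> [mf1 mf2]; split.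
  exact: (measurableT_comp mf1 (@measurable_tnth _ _ _ i)).
exact: (measurableT_comp mf2 (@measurable_tnth _ _ _ i)).
Qed.

(** Induction on [d]: the measure on [d.+1]-tuples is the image of a product measure under [tcons].
    The integral is pulled back along [tcons] and the first coordinate is split off by Fubini, the
    product of the moduli being the tensor bound. *)
Lemma cint_tensor d (f : 'I_d -> R -> R[i]) :
  (forall i, cintegrable mu1 (f i)) ->
  cintegrable (lebesgue_Rd d) (fun t => \prod_i f i (tnth t i)) /\
  cint (lebesgue_Rd d) (fun t => \prod_i f i (tnth t i)) =
    \prod_i cint mu1 (f i).
Proof.
elim: d f => [|d IH] f fi.
  rewrite (_ : (fun t => _) = cst 1); last first.
    by apply/funext => t; rewrite big_ord0.
  rewrite big_ord0; split.
    apply: cintegrable_real; exact: (finite_measure_integrable_cst (\d_ [tuple])).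
  have -> : cst (1 : R[i]) = fun _ : Rt 0 => (1 : R)%:C by [].
  by rewrite cint_real Rintegral_cst//= indicT mulr1.
have [i1 i2] := IH (fun i => f (lift ord0 i)) (fun i => fi (lift ord0 i)).
set g := fun t : Rt d.+1 => \prod_i f i (tnth t i).
set gd := (fun t : Rt d => _) in i1 i2.
have gE (z : measurableTypeR R * Rt d) : g (tcons z) = f ord0 z.1 * gd z.2.
  rewrite /g big_ord_recl tnth0; congr (_ * _).
  by apply: eq_bigr => i _; rewrite tnthS.
have mg : cmeas g.
  by apply: cmeas_prod => i _; apply: cmeas_tnth; exact: cintegrable_cmeas (fi i).
have mgt : cmeas (g \o tcons (n := d)).
  by split; [apply: (measurableT_comp mg.1)|apply: (measurableT_comp mg.2)];
     exact: measurable_tcons.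
have nf0 := cintegrable_normc (fi ord0).
have ngd := cintegrable_normc i1.
have bnd x y : normc ((g \o tcons (n := d)) (x, y)) <= normc (f ord0 x) * normc (gd y).
  by rewrite /= gE normcM.
have ig : cintegrable (mu1 \x^ lebesgue_Rd d)%E (g \o tcons (n := d)).
  have iRe := @integrable_prod_domRe _ _ _ _ _ sfleb1 (sfleb d) _ _ _ mgt nf0 ngd bnd.
  have iIm := @integrable_prod_domIm _ _ _ _ _ sfleb1 (sfleb d) _ _ _ mgt nf0 ngd bnd.
  (* Integrability is known for [\x], whereas [lebesgue_Rd] is built on [\x^]; the two measures
     agree on rectangles, hence on all measurable sets. *)
  have eqm (A : set (measurableTypeR R * Rt d)) : measurable A ->
    (sfleb1 \x sfleb d)%E A = (mu1 \x^ lebesgue_Rd d)%E A.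
    move=> mA; apply: product_measure_unique => // B C mB mC.
    exact: (@product_measure2E _ _ _ _ _ sfleb1 (sfleb d)).
  have eqi (h : measurableTypeR R * Rt d -> R) :
      (sfleb1 \x sfleb d)%E.-integrable setT (EFin \o h) ->
      (mu1 \x^ lebesgue_Rd d)%E.-integrable setT (EFin \o h).
    move=> /integrableP [mh ih]; apply/integrableP; split => //.
    rewrite (eq_measure_integral (sfleb1 \x sfleb d)%E)// => A mA _.
    by symmetry; exact: eqm.
  by split; apply: eqi.
have [ipg ->] := cint_pushforward (measurable_tcons (n := d)) mg ig.
split; first exact: ipg.
have -> : cint (mu1 \x^ lebesgue_Rd d)%E (g \o tcons (n:=d)) =
    cint sfleb1 (fun x => cint (sfleb d) (fun y => (g \o tcons (n:=d)) (x, y))).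
  exact: (@cint_prod _ _ _ _ _ sfleb1 (sfleb d) _ _ _ mgt nf0 ngd bnd).
rewrite big_ord_recl -i2.
transitivity (cint sfleb1 (fun x => cint (lebesgue_Rd d) gd * f ord0 x)).
  apply: eq_cint => x; rewrite mulrC -cintZ//.
  by apply: eq_cint => y; exact: gE.
by rewrite cintZ// mulrC.
Qed.

End lebesgue_Rd_theory.

(** * Measurability, domination and duality with Schwartz functions *)

Section continuous_measurable_rv.
Context {R : realType} (d : nat).
Local Notation Rt := (d.-tuple (measurableTypeR R)).

(** The topology of ['rV[R]_d] and the product sigma-algebra of tuples are not related by
    construction. Rounding to the dyadic grid is measurable with countably many values, so every
    function of the rounded point is measurable, and a continuous function is a pointwise limit of
    such functions. *)
Definition dyadic_floor (m : nat) (t : Rt) : {ffun 'I_d -> int} :=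
  [ffun i => Num.floor (2 ^+ m * tnth t i)].

Lemma measurable_dyadic_floor m (A : set {ffun 'I_d -> int}) :
  measurable (dyadic_floor m @^-1` A).
Proof.
rewrite (_ : _ @^-1` A = \bigcup_(u : {ffun 'I_d -> int})
    if `[< A u >] then dyadic_floor m @^-1` [set u] else set0); last first.
  apply/seteqP; split => [t At|t [u _]] /=.
    exists (dyadic_floor m t) => //; case: asboolP => //= nA.
  by case: asboolP => //= Au ->.
apply: countable_bigcupT_measurable => // u; case: ifP => // _.
rewrite (_ : _ @^-1` [set u] = \bigcap_(i in [set: 'I_d])
   ((fun t : Rt => tnth t i) @^-1` `[(u i)%:~R / 2 ^+ m, (u i + 1)%:~R / 2 ^+ m[)).
  apply: fin_bigcap_measurable => // i _; rewrite -[X in measurable X]setTI.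
  by apply: measurable_tnth => //; exact: measurable_itv.
have p2 : (0 : R) < 2 ^+ m by rewrite exprn_gt0.
have fE t i : (Num.floor (2 ^+ m * tnth t i) == u i) =
    ((u i)%:~R / 2 ^+ m <= (tnth t i : R) < (u i + 1)%:~R / 2 ^+ m).
  by rewrite ler_pdivrMr// ltr_pdivlMr// mulrC floor_eq.
apply/seteqP; split => t /=.
  move=> tu i _ /=; rewrite in_itv/=.
  suff : Num.floor (2 ^+ m * tnth t i) == u i by rewrite fE.
  by rewrite -tu ffunE.
move=> tu; apply/ffunP => i; rewrite ffunE; apply/eqP; rewrite fE.
by have := tu i Logic.I; rewrite /= in_itv.
Qed.

Lemma dyadic_floor_cvg (t : Rt) :
  (\row_i ((dyadic_floor m t i)%:~R / 2 ^+ m : R)) @[m --> \oo] --> rv t.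
Proof.
apply/cvg_ballP => e e0; near=> m.
split=> // j i; rewrite !mxE ffunE /ball/=.
have p2 : (0 : R) < 2 ^+ m by rewrite exprn_gt0.
rewrite -(ltr_pM2l p2) -{1}(gtr0_norm p2) -normrM mulrBr mulrCA divff ?gt_eqF// mulr1.
have /andP[f1 f2] := floor_itv (2 ^+ m * tnth t i).
rewrite ger0_norm ?subr_ge0//; apply: (@lt_trans _ _ 1).
  by rewrite ltrBlDr; move: f2; rewrite intrD addrC.
rewrite mulrC -ltr_pdivrMl// mulrC.
near: m; apply: filterS (near_infty_natSinv_expn_lt (PosNum e0)) => x /=.
by rewrite !ltr_pdivrMr ?exprn_gt0// mulrC.
Unshelve. all: by end_near. Qed.

Lemma measurable_continuous_rv (h : 'rV[R]_d -> R) : continuous h ->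
  measurable_fun setT (fun t : Rt => h (rv t)).
Proof.
move=> ch.
apply: (@measurable_fun_cvg _ _ _ _ (fun m (t : Rt) =>
  h (\row_i ((dyadic_floor m t i)%:~R / 2 ^+ m : R)))).
  move=> m _ Y mY; rewrite setTI.
  exact: (measurable_dyadic_floor m [set u | Y (h (\row_i ((u i)%:~R / 2 ^+ m : R)))]).
by move=> t _; exact: (@cvg_comp _ _ _ _ h _ _ _ (@dyadic_floor_cvg t) (ch (rv t))).
Qed.

End continuous_measurable_rv.

(** * The Cauchy profile *)

Section lorentz.
Context {R : realType}.
Implicit Types x y s c : R.
Local Notation mu := (@lebesgue_measure R).

(** The common majorant of kernels and Schwartz functions. Its primitive is the arctangent, so its
    integrals and its sums over grids are bounded by explicit multiples of pi. *)
Definition lorentz x : R := (1 + x ^+ 2)^-1.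

Lemma lorentz_den_gt0 x : 0 < 1 + x ^+ 2.
Proof. by rewrite (lt_le_trans ltr01)// lerDl sqr_ge0. Qed.

Lemma lorentz_gt0 x : 0 < lorentz x.
Proof. by rewrite invr_gt0 lorentz_den_gt0. Qed.

Lemma lorentz_le1 x : lorentz x <= 1.
Proof. by rewrite invf_le1 ?lorentz_den_gt0// lerDl sqr_ge0. Qed.

Lemma continuous_lorentz : continuous lorentz.
Proof. exact: continuous_oneDsqrV. Qed.

Lemma integral_lorentz : (\int[mu]_x (lorentz x)%:E = pi%:E)%E.
Proof.
rewrite (@ge0_symfun_integralT _ lorentz).
- have -> : [set x : R | 0 <= x] = `[0, +oo[%classic.
    by apply/seteqP; split => x /=; rewrite in_itv/= andbT.
  by rewrite integral0y_oneDsqr -EFinM mulrC divfK.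
- by move=> x; exact/ltW/lorentz_gt0.
- exact: continuous_lorentz.
- by move=> x /=; rewrite /lorentz sqrrN.
Qed.

Lemma integral_lorentz_scale s c : 0 < s ->
  (\int[mu]_x (lorentz (s * (x - c)))%:E = (pi / s)%:E)%E.
Proof.
move=> s0; pose F x := s * (x - c).
have dF x : is_derive x 1 F s.
  by rewrite /F; apply: is_derive_eq; rewrite ?scaler0 ?addr0 ?add0r ?subr0 /GRing.scale /= mulr1.
have dF1 : F^`()%classic = cst s.
  by apply/funext => x; rewrite derive1E; exact: derive_val.
have := @increasing_ge0_integration_by_substitutionT R F lorentz.
rewrite integral_lorentz dF1 => H; rewrite [pi / s]mulrC EFinM H//.
- rewrite [X in (_ * X)%E](_ : _ =
    (s%:E * \int[mu]_x (lorentz (s * (x - c)))%:E)%E); last first.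
    rewrite -ge0_integralZl//=.
    + by apply: eq_integral => x _; rewrite -EFinM mulrC.
    + apply/measurable_EFinP; 
      apply: (measurableT_comp (continuous_measurable_fun continuous_lorentz)).
      apply: (continuous_measurable_fun (f := F)) => x.
      by apply: differentiable_continuous; exact/derivable1_diffP.
    + by move=> x _; rewrite lee_fin ltW// lorentz_gt0.
    + by rewrite lee_fin ltW.
  by rewrite muleA -EFinM mulVf ?gt_eqF// mul1e.
- by move=> x y xy; rewrite /F ltr_pM2l// ltrD2r.
- exact: cst_continuous.
- exact: is_cvg_cst.
- exact: is_cvg_cst.
- exact: gt0_cvgMrNy s0 (cvg_addrr_Ny (- c)).
- exact: gt0_cvgMry s0 (cvg_addrr (- c)).
- exact: continuous_lorentz.
- by move=> x; exact/ltW/lorentz_gt0.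
Qed.

End lorentz.

Section real_tensor.
Context {R : realType}.
Local Notation Rt d := (d.-tuple (measurableTypeR R)).
Local Notation mu1 := (@lebesgue_measure R).

Lemma measurable_tensor d (w : 'I_d -> R -> R) :
  (forall i, measurable_fun setT (w i : measurableTypeR R -> R)) ->
  measurable_fun setT (fun t : Rt d => \prod_i w i (tnth t i)).
Proof.
move=> mw; apply: measurable_prod => i _.
exact: (measurableT_comp (mw i) (@measurable_tnth _ _ _ i)).
Qed.

Lemma integrable_tensor d (w : 'I_d -> R -> R) :
  (forall i, mu1.-integrable setT (EFin \o w i)) ->
  (lebesgue_Rd d).-integrable setT
    (EFin \o (fun t : Rt d => \prod_i w i (tnth t i))) /\
  \int[lebesgue_Rd d]_t (\prod_i w i (tnth t i)) = \prod_i \int[mu1]_x w i x.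
Proof.
move=> wi.
have [[H1 _] H2] := cint_tensor (fun i => cintegrable_real (wi i)).
split.
  apply: eq_integrable H1 => // t _.
  by rewrite -(rmorph_prod (real_complex R)).
have := cint_real (lebesgue_Rd d) (fun t => \prod_i w i (tnth t i)).
have -> : (fun t : Rt d => (\prod_i w i (tnth t i))%:C) =
    fun t => \prod_i (w i (tnth t i))%:C.
  by apply/funext => t; rewrite (rmorph_prod (real_complex R)).
rewrite H2; under eq_bigr do rewrite cint_real.
by rewrite -(rmorph_prod (real_complex R)) => /complexI.
Qed.

Lemma integrable_lorentz_scale (s c : R) : 0 < s ->
  mu1.-integrable setT (EFin \o (fun x => lorentz (s * (x - c)))).
Proof.
move=> s0; apply/integrableP; split.
  apply/measurable_EFinP.
  apply: (measurableT_comp (continuous_measurable_fun continuous_lorentz)).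
  by apply: measurable_funM => //; apply: measurable_funB.
under eq_integral do rewrite /= ger0_norm ?(ltW (lorentz_gt0 _))//.
by rewrite integral_lorentz_scale// ltry.
Qed.

Lemma Rintegral_lorentz_scale (s c : R) : 0 < s ->
  \int[mu1]_x lorentz (s * (x - c)) = pi / s.
Proof. by move=> s0; rewrite /Rintegral integral_lorentz_scale. Qed.

Lemma integrable_lorentz : mu1.-integrable setT (EFin \o @lorentz R).
Proof.
have := @integrable_lorentz_scale 1 0 ltr01; apply: eq_integrable => // x _ /=.
by rewrite mul1r subr0.
Qed.

Definition ind01 (x : R) : R := if 0 <= x < 1 then 1 else 0.

Lemma ind01E : ind01 = \1_(`[0, 1[).
Proof.
apply/funext => x; rewrite /ind01 indicE mem_setE.
by rewrite in_itv/=; case: ifP.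
Qed.

Lemma measurable_ind01 : measurable_fun setT ind01.
Proof. by rewrite ind01E; exact: measurable_indic. Qed.

Lemma integrable_ind01 : mu1.-integrable setT (EFin \o ind01).
Proof. by rewrite ind01E; exact: integrable_indic_itv. Qed.

End real_tensor.

Section schwartz_theory.
Context {R : realType} (d : nat).
Local Notation Rt := (d.-tuple (measurableTypeR R)).
Local Notation Rd := 'rV[R]_d.
Implicit Types (h : Rd -> R[i]).

Lemma schwartz_cmeas h : schwartz h -> cmeas (fun t : Rt => h (rv t)).
Proof.
move=> [[s1 s2] _]; have [c1 _] := s1 [::]; have [c2 _] := s2 [::].
by split; [exact: measurable_continuous_rv c1|exact: measurable_continuous_rv c2].
Qed.

(** The product of the 1 + x_i^2 is expanded over the subsets [A] of coordinates; each term is a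
    Schwartz weight without derivatives, with exponents 0 on [A] and 2 off [A]. *)
Lemma schwartz_dominated h : schwartz h -> exists C : R,
  forall x, normc (h x) <= C * \prod_i lorentz (x 0 i).
Proof.
move=> [_ hw].
have [M HM] := fin_all_exists (fun A : {set 'I_d} =>
  hw (fun i => if i \in A then 0%N else 2%N) [::]).
exists (\sum_A M A) => x.
have p0 : 0 < \prod_(i < d) (1 + x 0 i ^+ 2) by apply: prodr_gt0 => i _; exact: lorentz_den_gt0.
rewrite prodfV ler_pdivlMr// mulrC bigA_distr /= mulr_suml.
apply: ler_sum => A _; apply: le_trans (HM A x).
rewrite /schwartz_weight le_eqVlt; apply/orP; left; apply/eqP.
congr (_ * _).
  apply: eq_bigr => i _; case: ifP => _; first by rewrite expr0.
  by rewrite real_normK ?num_real.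
by congr normc; rewrite /partialsC/=; case: (h x).
Qed.

Lemma schwartz_integrable h : schwartz h ->
  cintegrable (lebesgue_Rd d) (fun t => h (rv t)).
Proof.
move=> sh; have [C hC] := schwartz_dominated sh.
apply: (@cintegrable_dom _ _ _ _ _ (fun t : Rt => C * \prod_i lorentz (tnth t i))).
- exact: schwartz_cmeas.
- move=> t; rewrite (le_trans (hC _))//; under eq_bigr do rewrite mxE.
  exact: lexx.
- have := (integrable_tensor (fun _ : 'I_d => @integrable_lorentz R)).1.
  by move/(integrableZl measurableT C).
Qed.

End schwartz_theory.

Section expi_theory.
Context {R : realType}.

Lemma expiD (a c : R) : expi (a + c) = expi a * expi c.
Proof.
by apply: complex_eq; rewrite ?ReM ?ImM/= ?cosD ?sinD// addrC.
Qed.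

Lemma expi0 : expi (0 : R) = 1.
Proof. by rewrite /expi cos0 sin0. Qed.

Lemma normc_expi (a : R) : normc (expi a) = 1.
Proof. by rewrite /normc /= cos2Dsin2 sqrtr1. Qed.

Lemma expi_sum I (r : seq I) (F : I -> R) :
  expi (\sum_(i <- r) F i) = \prod_(i <- r) expi (F i).
Proof. by elim/big_rec2: _ => [|i x y _ <-]; rewrite ?expi0 ?expiD. Qed.

Lemma cmeas_expi d (T : measurableType d) (f : T -> R) :
  measurable_fun setT f -> cmeas (fun x => expi (f x)).
Proof.
move=> mf; split => /=.
  by apply: measurableT_comp mf; apply: continuous_measurable_fun; exact: continuous_cos.
by apply: measurableT_comp mf; apply: continuous_measurable_fun; exact: continuous_sin.
Qed.

End expi_theory.

(** * Functionals given by bounded functions on the cube *)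

Section block_representation.
Context {R : realType} (d : nat).
Local Notation Rt := (d.-tuple (measurableTypeR R)).
Local Notation Rd := 'rV[R]_d.
Local Notation mu := (@lebesgue_Rd R d).
Local Notation mu1 := (@lebesgue_measure R).
Implicit Types (h : Rd -> R[i]) (u : Rt -> R).

Definition tuple_functional u : @functional R d :=
  fun h => cint mu (fun t => (u t)%:C * h (rv t)).

Lemma integralC_setT (f : Rd -> R[i]) : integralC setT f = cint mu (fun t => f (rv t)).
Proof. by rewrite /integralC preimage_setT. Qed.

Lemma distr_of_cubeE (D : Rd -> R) : distr_of_cube D =
  tuple_functional (fun t => D (rv t) * \prod_i ind01 (tnth t i)).
Proof.
apply/funext => h; rewrite /distr_of_cube /integralC /tuple_functional.
have key (f : Rt -> R) : \int[mu]_(t in @rv R d @^-1` cube) f t =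
    \int[mu]_t (f t * \prod_i ind01 (tnth t i)).
  rewrite Rintegral_mkcond; apply: eq_Rintegral => t _.
  rewrite patchE; case: ifPn => [/set_mem ct|].
    rewrite big1 ?mulr1// => i _; have := ct i.
    by rewrite mxE /ind01 => ->.
  rewrite notin_setE => nct.
  suff [i ti] : exists i, ind01 (tnth t i) = 0 by rewrite (bigD1 i)//= ti mul0r mulr0.
  apply: contrapT => ne; apply: nct => i; rewrite mxE.
  apply: contrapT => /negP/negbTE ni; apply: ne; exists i.
  by rewrite /ind01 ni.
apply: complex_eq => /=; rewrite key; apply: eq_Rintegral => t _;
  by rewrite ?ReM ?ImM/= !mul0r ?subr0 ?addr0 mulrAC.
Qed.

Section bounded_functional.
Variables (u : Rt -> R) (B : R).
Hypothesis mu_u : measurable_fun setT u.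
Hypothesis uB : forall t, `|u t| <= B * \prod_i ind01 (tnth t i).

Lemma tuple_functional_bound_ge0 (t : Rt) : 0 <= B * \prod_i ind01 (tnth t i).
Proof. exact: le_trans (normr_ge0 _) (uB t). Qed.

Lemma integrable_bound :
  mu.-integrable setT (EFin \o (fun t : Rt => B * \prod_i ind01 (tnth t i))).
Proof.
have := (integrable_tensor (fun _ : 'I_d => @integrable_ind01 R)).1.
by move/(integrableZl measurableT B).
Qed.

Lemma cintegrable_tuple_functional h : schwartz h ->
  cintegrable mu (fun t => (u t)%:C * h (rv t)).
Proof.
move=> sh; have [C hC] := schwartz_dominated sh.
have := cintegrable_normc (schwartz_integrable sh).
have C0 : 0 <= C * (\prod_(i < d) lorentz 0).
  by have := hC 0; under eq_bigr do rewrite mxE; apply: le_trans; exact: normc_ge0.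
have Cnn : 0 <= C.
  move: C0; rewrite pmulr_lge0//; apply: prodr_gt0 => i _; exact: lorentz_gt0.
have bh t : normc (h (rv t)) <= C.
  rewrite (le_trans (hC _))// -[leRHS]mulr1 ler_wpM2l//.
  by apply: prodr_ile1 => i _; rewrite (ltW (lorentz_gt0 _)) lorentz_le1.
move=> _; apply: (@cintegrable_dom _ _ _ _ _ (fun t : Rt => C * (B * \prod_i ind01 (tnth t i)))).
- apply: cmeasM; first exact: cmeas_real.
  exact: schwartz_cmeas.
- move=> t; rewrite normcM normc_real mulrC; apply: ler_pM => //.
  exact: normc_ge0.
- by have := integrableZl measurableT C integrable_bound.
Qed.

Lemma tempered_tuple_functional : tempered (tuple_functional u).
Proof.
split => [c f g sf sg|f sf f0].
  rewrite /tuple_functional -cintZ; last exact: cintegrable_tuple_functional.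
  rewrite -cintD; first by apply: eq_cint => t; rewrite mulrDr mulrCA.
    by apply: cintegrableZ; exact: cintegrable_tuple_functional.
  exact: cintegrable_tuple_functional.
set I := \int[mu]_(t in [set: Rt]) (B * \prod_i ind01 (tnth t i)).
have I0 : 0 <= I by apply: Rintegral_ge0 => t _; exact: tuple_functional_bound_ge0.
apply/cvgr0Pnorm_le => e e0.
have e'0 : 0 < e / (2 * (I + 1)) by rewrite divr_gt0// mulr_gt0// ltr_wpDl.
(* As [u] is bounded and vanishes off the cube, the supremum of the test function alone controls the
   pairing. [I + 1] stands in the denominator because [I] may be 0. *)
apply: filterS (f0 (fun=> 0%N) [::] _ e'0) => j fj.
rewrite ger0_norm ?normc_ge0//.
apply: (@le_trans _ _ (2 * \int[mu]_t ((e / (2 * (I + 1))) * (B * \prod_i ind01 (tnth t i))))).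
  apply: normc_cint.
  - exact: cintegrable_tuple_functional.
  - move=> t; rewrite normcM normc_real mulrC; apply: ler_pM => //.
    + exact: normc_ge0.
    + have := fj (rv t); rewrite /schwartz_weight big1 ?mul1r//.
      by rewrite /partialsC/=; case: (f j (rv t)).
  - by have := integrableZl measurableT (e / (2 * (I + 1))) integrable_bound.
rewrite RintegralZl//; last exact: integrable_bound.
rewrite -/I mulrA.
rewrite -[leRHS](@divfK _ (2 * (I + 1)) _ e); last by rewrite gt_eqF// mulr_gt0// ltr_wpDl.
rewrite -mulrA mulrCA; apply: ler_wpM2l; first exact: ltW.
by rewrite ler_wpM2l// lerDl.
Qed.

End bounded_functional.

End block_representation.

(** * Fourier blocks as convolutions *)

Section kernel_representation.
Context {R : realType}.
Local Notation mu1 := (@lebesgue_measure R).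

(** The convolution kernel of the Fourier multiplier [f]. The two symmetric factors (2 pi)^(-d/2) of
    [fourier] and [inv_fourier] combine into one factor (2 pi)^-1 per coordinate. *)
Definition kern (f : R -> R[i]) (u : R) : R[i] :=
  ((2 * pi)^-1)%:C * cint mu1 (fun xi => f xi * expi (u * xi)).

Lemma cintegrable_modulated (f : R -> R[i]) u : cintegrable mu1 f ->
  cintegrable mu1 (fun xi => f xi * expi (u * xi)).
Proof.
move=> fi; apply: cintegrable_dom (cintegrable_normc fi).
  apply: cmeasM; first exact: cintegrable_cmeas fi.
  by apply: cmeas_expi; exact: mulrl_measurable.
by move=> x; rewrite normcM normc_expi mulr1.
Qed.

Lemma normc_kern (f : R -> R[i]) u : cintegrable mu1 f ->
  normc (kern f u) <= (2 * pi)^-1 * (2 * \int[mu1]_x normc (f x)).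
Proof.
move=> fi; have p0 : 0 <= (2 * pi)^-1 :> R by rewrite invr_ge0 mulr_ge0// pi_ge0.
rewrite normcM normc_real ger0_norm// ler_wpM2l//; apply: normc_cint.
- exact: cintegrable_modulated.
- by move=> x; rewrite normcM normc_expi mulr1.
- exact: cintegrable_normc.
Qed.

Context (d : nat).
Local Notation Rt := (d.-tuple (measurableTypeR R)).
Local Notation Rd := 'rV[R]_d.
Local Notation mu := (@lebesgue_Rd R d).

Lemma measurable_dot_rv (x : Rd) : measurable_fun setT (fun t : Rt => dot (rv t) x).
Proof.
apply: measurable_sum => i; under eq_fun do rewrite mxE.
by apply: measurable_funM => //; exact: measurable_tnth.
Qed.

Lemma fourier_constant :
  (2 * pi) `^ (- (d%:R / 2)) * (2 * pi) `^ (- (d%:R / 2)) = (2 * pi)^-1 ^+ d :> R.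
Proof.
have p0 : (0 : R) < 2 * pi by rewrite mulr_gt0// pi_gt0.
have <- := @powRD R (2 * pi) (- (d%:R / 2)) (- (d%:R / 2)).
  by rewrite -opprD -splitr powRN powR_mulrn ?exprVn// ltW.
by apply/implyP => _; rewrite gt_eqF.
Qed.

Section fourier_block.
Variables (f : 'I_d -> R -> R[i]) (h : Rd -> R[i]).
Hypothesis fi : forall i, cintegrable mu1 (f i).
Hypothesis sh : schwartz h.

Let F (z : Rt * Rt) : R[i] :=
  (\prod_i f i (tnth z.1 i)) * h (rv z.2) * expi (dot (rv z.1) (rv z.2)).

Lemma cmeas_fst (g : Rt -> R[i]) : cmeas g -> cmeas (fun z : Rt * Rt => g z.1).
Proof.
by move=> [g1 g2]; split; [exact: (measurableT_comp g1 measurable_fst)|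
  exact: (measurableT_comp g2 measurable_fst)].
Qed.

Lemma cmeas_snd (g : Rt -> R[i]) : cmeas g -> cmeas (fun z : Rt * Rt => g z.2).
Proof.
by move=> [g1 g2]; split; [exact: (measurableT_comp g1 measurable_snd)|
  exact: (measurableT_comp g2 measurable_snd)].
Qed.

(** By duality a block maps [h] to the value of the functional at F(phi_k F^-1 h), which is the
    function computed here. Its kernel is evaluated at the integration variable minus [x];
    exchanging the two integrals in [represents_conv_kern] turns this into a convolution. *)
Lemma fourier_block (x : Rd) :
  fourier (fun xi => (\prod_i f i (xi 0 i)) * inv_fourier h xi) x =
  cint mu (fun t => h (rv t) * \prod_i kern (f i) (tnth t i - x 0 i)).
Proof.
have if_ := (cint_tensor fi).1.
have ih := schwartz_integrable sh.
set c : R[i] := ((2 * pi) `^ (- (d%:R / 2)))%:C.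
rewrite /fourier integralC_setT -/c.
pose G (z : Rt * Rt) : R[i] := ((\prod_i f i (tnth z.1 i)) * h (rv z.2)) *
  (expi (dot (rv z.1) (rv z.2)) * expi (- dot (rv z.1) x)).
have mG : cmeas G.
  apply: cmeasM; first apply: cmeasM.
  - exact: (cmeas_fst (cintegrable_cmeas if_)).
  - exact: (cmeas_snd (schwartz_cmeas sh)).
  - apply: cmeasM; apply: cmeas_expi.
    + apply: measurable_sum => i; under eq_fun do rewrite !mxE.
      apply: measurable_funM.
      * exact: (measurableT_comp (@measurable_tnth _ _ _ i) measurable_fst).
      * exact: (measurableT_comp (@measurable_tnth _ _ _ i) measurable_snd).
    + apply: measurable_funN.
      exact: (measurableT_comp (measurable_dot_rv x) measurable_fst).
have bG t1 t2 : normc (G (t1, t2)) <=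
    normc (\prod_i f i (tnth t1 i)) * normc (h (rv t2)).
  by rewrite /G /= !normcM !normc_expi !mulr1.
have nf := cintegrable_normc if_; have nh := cintegrable_normc ih.
have inner2 (t : Rt) : (\prod_i f i (rv t 0 i)) * inv_fourier h (rv t) * expi (- dot (rv t) x) =
    c * cint (sfleb d) (fun t2 => G (t, t2)).
  rewrite /inv_fourier integralC_setT -/c.
  under eq_bigr do rewrite mxE.
  have i2 : cintegrable mu (fun t2 => h (rv t2) * expi (dot (rv t) (rv t2))).
    apply: cintegrable_dom nh.
      apply: cmeasM; first exact: schwartz_cmeas.
      apply: cmeas_expi; apply: measurable_sum => i; under eq_fun do rewrite !mxE.
      by apply: measurable_funM => //; exact: measurable_tnth.
    by move=> y; rewrite normcM normc_expi mulr1.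
  set X := cint _ _.
  transitivity (c * ((\prod_i f i (tnth t i)) * expi (- dot (rv t) x) * X)); first by ring.
  congr (c * _); rewrite -cintZ//; apply: eq_cint => y.
  by rewrite /G /=; ring.
under eq_cint do rewrite inner2.
rewrite cintZ; last exact: (@cintegrable_cint2 _ _ _ _ _ (sfleb d) (sfleb d) _ _ _ mG nf nh bG).
have FF : cint mu (fun x => cint (sfleb d) (fun y => G (x, y))) =
    cint mu (fun y => cint mu (fun x => G (x, y))).
  exact: (@cFubini _ _ _ _ _ (sfleb d) (sfleb d) _ _ _ mG nf nh bG).
rewrite FF.
have j1 : cintegrable mu (fun y => cint mu (fun x => G (x, y))).
  exact: (@cintegrable_cint1 _ _ _ _ _ (sfleb d) (sfleb d) _ _ _ mG nf nh bG).
rewrite -(cintZ c j1) -(cintZ c (cintegrableZ c j1)).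
apply: eq_cint => y.
transitivity (h (rv y) * ((c * c) * cint mu (fun t => \prod_i
   (f i (tnth t i) * expi ((tnth y i - x 0 i) * tnth t i))))).
  have [i3 _] := cint_tensor (fun i => cintegrable_modulated (tnth y i - x 0 i) (fi i)).
  rewrite [RHS]mulrCA -(cintZ (h (rv y)) i3) -[RHS]mulrA.
  do 2 congr (c * _); apply: eq_cint => t.
  rewrite /G /= big_split /= -expi_sum -expiD -mulrA mulrCA; congr (_ * (_ * _)).
  congr expi; rewrite /dot -sumrB; apply: eq_bigr => i _; rewrite !mxE; ring.
congr (_ * _).
rewrite (cint_tensor (fun i => cintegrable_modulated _ (fi i))).2.
rewrite big_split /=; congr (_ * _).
by rewrite prodr_const card_ord -rmorphXn /c -rmorphM /= fourier_constant.
Qed.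

End fourier_block.

Section convolution.
Variables (u : Rt -> R) (B : R) (K : 'I_d -> R -> R[i]) (Bk : 'I_d -> R).
Hypothesis mu_u : measurable_fun setT u.
Hypothesis uB : forall t, `|u t| <= B * \prod_i ind01 (tnth t i).
Hypothesis mK : forall i, cmeas (K i : measurableTypeR R -> R[i]).
Hypothesis KB : forall i x, normc (K i x) <= Bk i.

Definition conv_kern (y : Rd) : R[i] :=
  cint mu (fun t => (u t)%:C * \prod_i K i (y 0 i - tnth t i)).

Lemma Kprod_bound (y t : Rt) : normc (\prod_i K i (tnth y i - tnth t i)) <= \prod_i Bk i.
Proof.
by rewrite normc_prod; apply: ler_prod => i _; rewrite normc_ge0 KB.
Qed.

Lemma cmeas_Kprod : cmeas (fun z : Rt * Rt => \prod_i K i (tnth z.2 i - tnth z.1 i)).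
Proof.
apply: cmeas_prod => i _; have [m1 m2] := mK i.
have mB : measurable_fun setT (fun z : Rt * Rt => (tnth z.2 i : R) - tnth z.1 i).
  apply: measurable_funB.
    exact: (measurableT_comp (@measurable_tnth _ _ _ i) measurable_snd).
  exact: (measurableT_comp (@measurable_tnth _ _ _ i) measurable_fst).
by split; [exact: (measurableT_comp m1 mB)|exact: (measurableT_comp m2 mB)].
Qed.

Lemma represents_conv_kern (T : @functional R d) :
  (forall h, schwartz h -> T h = tuple_functional u
     (fun x => cint mu (fun t => h (rv t) * \prod_i K i (tnth t i - x 0 i)))) ->
  represents conv_kern T.
Proof.
move=> TE.
have mKK := cmeas_Kprod.
have mU : cmeas (fun z : Rt * Rt => (u z.1)%:C * \prod_i K i (tnth z.2 i - tnth z.1 i)).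
  by apply: cmeasM => //; exact: (cmeas_fst (cmeas_real mu_u)).
have pB : 0 <= \prod_i Bk i.
  by apply: prodr_ge0 => i _; exact: le_trans (normc_ge0 _) (KB i 0).
have iB := integrable_bound d B.
have convE y : conv_kern (rv y) = cint mu (fun t => (u t)%:C * \prod_i K i (tnth y i - tnth t i)).
  by apply: eq_cint => t; congr (_ * _); apply: eq_bigr => i _; rewrite mxE.
have step (h : Rt -> R[i]) (nh : Rt -> R) : cmeas h -> mu.-integrable setT (EFin \o nh) ->
    (forall t, normc (h t) <= nh t) ->
    let G := fun z : Rt * Rt => h z.2 * ((u z.1)%:C * \prod_i K i (tnth z.2 i - tnth z.1 i)) in
    [/\ cmeas G, mu.-integrable setT (EFin \o (fun t => (\prod_i Bk i) * (B * \prod_i ind01 (tnth t i)))) &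
     forall t1 t2, normc (G (t1, t2)) <= ((\prod_i Bk i) * (B * \prod_i ind01 (tnth t1 i))) * nh t2].
  move=> mh inh hnh G; split.
  - by apply: cmeasM => //; exact: cmeas_snd.
  - by have := integrableZl measurableT (\prod_i Bk i) iB.
  - move=> t1 t2; rewrite /G /= !normcM normc_real mulrC; apply: ler_pM => //.
    + by rewrite mulr_ge0 ?normc_ge0.
    + exact: normc_ge0.
    + rewrite mulrC; apply: ler_pM => //; [exact: normc_ge0|exact: Kprod_bound].
have ciu y : cintegrable mu (fun t => (u t)%:C * \prod_i K i (tnth y i - tnth t i)).
  apply: (@cintegrable_dom _ _ _ _ _ (fun t : Rt => (\prod_i Bk i) * (B * \prod_i ind01 (tnth t i)))).
  - exact: (cmeas_pair1 mU y).
  - move=> t; rewrite normcM normc_real mulrC; apply: ler_pM => //; [exact: normc_ge0|exact: Kprod_bound].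
  - by have := integrableZl measurableT (\prod_i Bk i) iB.
have inner1 (h : Rt -> R[i]) y : cint mu (fun t => h y * ((u t)%:C * \prod_i K i (tnth y i - tnth t i))) =
    conv_kern (rv y) * h y.
  by rewrite convE mulrC cintZ.
split.
  (* With [K] merely bounded, [conv_kern] need not be integrable, while Fubini yields measurability
     of partial integrals of integrable functions. The positive integrable factor [lor] is inserted
     for this purpose and divided out afterwards. *)
  pose lor (t : Rt) := \prod_i lorentz (tnth t i).
  have lor0 t : 0 < lor t by apply: prodr_gt0 => i _; exact: lorentz_gt0.
  have mlor : measurable_fun setT lor.
    apply: (measurable_tensor (w := fun=> @lorentz R)) => i.
    exact: continuous_measurable_fun continuous_lorentz.
  have ilor := (integrable_tensor (fun _ : 'I_d => @integrable_lorentz R)).1.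
  have [mG i1 bG] := step (fun t => (lor t)%:C) lor (cmeas_real mlor) ilor
    (fun t => eq_ind_r (fun z => z <= _) (lexx _) (etrans (normc_real _) (ger0_norm (ltW (lor0 t))))).
  have := @cmeas_cint1 _ _ _ _ _ (sfleb d) (sfleb d) _ _ _ mG i1 ilor bG.
  have mV : cmeas (fun t => ((lor t)^-1)%:C : R[i]).
    apply: cmeas_real.
    rewrite (_ : (fun t => (lor t)^-1) = fun t => \prod_i (lorentz (tnth t i))^-1).
      apply: (measurable_tensor (w := fun i x => (lorentz x)^-1)) => i.
      rewrite (_ : (fun x => _) = fun x => 1 + x ^+ 2); last by apply/funext => x; rewrite invrK.
      by apply: measurable_funD => //; exact: exprn_measurable.
    by apply/funext => t; rewrite prodfV.
  move=> /(cmeasM mV) H.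
  change (cmeas (fun t : Rt => conv_kern (rv t))).
  suff -> : (fun t : Rt => conv_kern (rv t)) = fun t => ((lor t)^-1)%:C * cint mu (fun x => (lor t)%:C *
      ((u x)%:C * \prod_i K i (tnth t i - tnth x i))) by exact: H.
  apply/funext => t; rewrite (inner1 (fun t => (lor t)%:C)) mulrCA -rmorphM mulVf ?mulr1//.
  by rewrite gt_eqF.
move=> h sh.
have mh := schwartz_cmeas sh.
have nh := cintegrable_normc (schwartz_integrable sh).
have [mG i1 bG] := step _ _ mh nh (fun t => lexx _).
have inner1' := inner1 (fun t => h (rv t)).
split.
  have := @cintegrable_cint1 _ _ _ _ _ (sfleb d) (sfleb d) _ _ _ mG i1 nh bG.
  move=> H; rewrite /integrableC preimage_setT.
  change (cintegrable mu (fun y => conv_kern (rv y) * h (rv y))).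
  suff -> : (fun y : Rt => conv_kern (rv y) * h (rv y)) = fun y => cint mu (fun x => h (rv y) *
      ((u x)%:C * \prod_i K i (tnth y i - tnth x i))) by exact: H.
  by apply/funext => y; rewrite inner1'.
rewrite TE// integralC_setT.
have FF := @cFubini _ _ _ _ _ (sfleb d) (sfleb d) _ _ _ mG i1 nh bG.
transitivity (cint mu (fun y => cint mu (fun x => h (rv y) *
      ((u x)%:C * \prod_i K i (tnth y i - tnth x i))))); last first.
  by apply: eq_cint => y; exact: inner1'.
rewrite -[RHS]FF; apply: eq_cint => t /=.
rewrite -cintZ.
  apply: eq_cint => y; rewrite mulrCA; congr (_ * (_ * _)).
  by apply: eq_bigr => i _; rewrite mxE.
apply: (@cintegrable_dom _ _ _ _ _ (fun y : Rt => (\prod_i Bk i) * normc (h (rv y)))).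
- apply: cmeasM; first exact: mh.
  suff -> : (fun y : Rt => \prod_i K i (tnth y i - rv t 0 i)) = fun y : Rt =>
    \prod_i K i (tnth y i - tnth t i) by exact: (cmeas_pair2 mKK t).
  by apply/funext => y; apply: eq_bigr => i _; rewrite mxE.
- move=> y; rewrite normcM mulrC.
  apply: ler_pM; [exact: normc_ge0|exact: normc_ge0| |exact: lexx].
  suff -> : \prod_i K i (tnth y i - rv t 0 i) = \prod_i K i (tnth y i - tnth t i)
    by exact: Kprod_bound.
  by apply: eq_bigr => i _; rewrite mxE.
- by have := integrableZl measurableT (\prod_i Bk i) nh.
Qed.

End convolution.
End kernel_representation.

(** * Digital nets *)

Section digit_values.
Variable b : nat.

(* [digit_value x a] is the integer with base-b digits x 0, ..., x (a-1), most
   significant first: the index of the b-adic interval of length b^-a that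
   contains the point with digits x *)
Fixpoint digit_value (x : nat -> nat) (a : nat) : nat :=
  if a is a'.+1 then (b * digit_value x a' + x a')%N else 0%N.

Hypothesis b_gt0 : (0 < b)%N.

Lemma digit_value_ltn x a : (forall l, x l < b)%N -> (digit_value x a < b ^ a)%N.
Proof.
move=> xb; elim: a => [|a IH] //=; rewrite expnS.
apply: leq_trans (leq_mul (leqnn b) IH).
by rewrite mulnS [(b + _)%N]addnC ltn_add2l; exact: xb.
Qed.

Lemma digit_value_divn x a k : (forall l, x l < b)%N ->
  (digit_value x (a + k) %/ b ^ k)%N = digit_value x a.
Proof.
move=> xb; elim: k => [|k IH]; first by rewrite addn0 expn0 divn1.
rewrite addnS /= expnS divnMA mulnC divnMDl// (divn_small (xb _)) addn0.
exact: IH.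
Qed.

Lemma eq_digit_value x y a : (forall l, (l < a)%N -> x l = y l) ->
  digit_value x a = digit_value y a.
Proof.
elim: a => //= a IH xy; rewrite IH ?xy// => l la; apply: xy; exact: ltnW.
Qed.

Lemma sum_nat_mul (K : nmodType) (F : nat -> K) m :
  \sum_(0 <= c < b * m) F c =
  \sum_(0 <= c < m) \sum_(0 <= k < b) F (b * c + k)%N.
Proof.
elim: m => [|m IH]; first by rewrite muln0 !big_geq.
rewrite big_nat_recr//= -IH mulnS addnC (@big_cat_nat _ _ _ (b * m)) ?leq_addr//=.
congr (_ + _); rewrite -{1}[(b * m)%N]add0n big_addn addnC addnK.
by apply: eq_bigr => k _; rewrite addnC.
Qed.

Lemma digits_inj n x y : (x < b ^ n)%N -> (y < b ^ n)%N ->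
  (forall j, (j < n)%N -> (x %/ b ^ j) %% b = (y %/ b ^ j) %% b)%N -> x = y.
Proof.
elim: n x y => [|n IH] x y; first by rewrite expn0 !ltnS !leqn0 => /eqP -> /eqP ->.
move=> xn yn H; rewrite (divn_eq x b) (divn_eq y b).
have := H 0%N isT; rewrite expn0 !divn1 => ->; congr (_ * _ + _)%N; apply: IH.
- by rewrite ltn_divLR// mulnC -expnS.
- by rewrite ltn_divLR// mulnC -expnS.
- by move=> j jn; rewrite -!divnMA -expnS; exact: H.
Qed.

End digit_values.

Section free_family.
Variables (F : fieldType) (n : nat).

Lemma free_solve (X : seq 'rV[F]_n) (t : nat -> F) : free X ->
  exists x : 'cV_n, forall k, (k < size X)%N -> (X`_k *m x) 0 0 = t k.
Proof.
move=> fX; pose A := \matrix_(k < size X) X`_k.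
have : row_free A.
  apply/inj_row_free => u uA.
  have := (elimT (@freeP _ _ _ (in_tuple X)) fX) (fun i => u 0 i).
  have -> : \sum_(i < size X) u 0 i *: (in_tuple X)`_i = 0.
    by rewrite -[RHS]uA mulmx_sum_row; apply: eq_bigr => i _; rewrite rowK.
  by move=> /(_ erefl) u0; apply/rowP => i; rewrite mxE u0.
move=> /row_freeP[B AB]; exists (B *m \col_k t k) => k kX.
have -> : X`_k = row (Ordinal kX) A by rewrite rowK.
by rewrite -row_mul mulmxA AB mul1mx !mxE.
Qed.

End free_family.

(** * Equidistribution of the digits of a net *)

Section uniform_digits.
Variables (b d s n : nat) (C : 'I_d -> 'M['F_b]_(s, n)).
Local Notation E1 := {ffun 'I_s -> 'F_b}.
Local Notation E := {ffun 'I_d -> E1}.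

Definition net_digits (x : 'cV['F_b]_n) : E :=
  [ffun i => [ffun l => (C i *m x) l 0]].

Lemma net_digitsD x y : net_digits (x + y) = net_digits x + net_digits y.
Proof. by apply/ffunP => i; apply/ffunP => l; rewrite !ffunE mulmxDr mxE. Qed.

(* Shifting x by a solution of the prescribed digits shows that the digits in S
   are equidistributed. *)
Lemma uniform_digits (K : comNzRingType) (S : 'I_d -> pred 'I_s) (G : E -> K) :
  (forall e : E, exists x : 'cV['F_b]_n, forall i l, S i l -> (C i *m x) l 0 = e i l) ->
  (forall e e' : E, (forall i l, S i l -> e i l = e' i l) -> G e = G e') ->
  #|{: E}|%:R * (\sum_x G (net_digits x)) =
  #|{: 'cV['F_b]_n}|%:R * \sum_e G e.
Proof.
move=> solve Gdep; have [xe xeP] := fin_all_exists solve.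
have -> : #|{: E}|%:R * (\sum_x G (net_digits x)) =
    \sum_e \sum_x G (net_digits (x + xe e)).
  rewrite mulr_natl -sumr_const; apply: eq_bigr => e _.
  by rewrite (reindex_inj (addIr (xe e))).
rewrite exchange_big /= mulr_natl -sumr_const; apply: eq_bigr => x _.
rewrite [RHS](reindex_inj (addrI (net_digits x))) /=; apply: eq_bigr => e _.
apply: Gdep => i l lS; rewrite net_digitsD !ffunE; congr (_ + _).
by rewrite xeP.
Qed.

(** Order 2 counts only the two largest row numbers of each coordinate. The rows 1, ..., a_i
    together with the row m_i >= a_i thus cost at most m_i + a_i, however many they are; they are
    independent, and any values of these digits are attained. *)
Lemma net_solve v (a m : 'I_d -> nat) : order_digital_net 2 v C ->
  (forall i, (a i <= m i)%N) -> (\sum_i (m i + a i) <= 2 * n - v)%N ->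
  forall e : E, exists x : 'cV['F_b]_n, forall i (l : 'I_s),
    (l < a i)%N || (l.+1 == m i) -> (C i *m x) l 0 = e i l.
Proof.
move=> [_ _ indep] am summ e.
pose S i := [pred l : 'I_s | (l < a i)%N || (l.+1 == m i)].
pose lam i := [seq l <- rev (enum 'I_s) | l \in S i].
have srt i : sorted (fun l l' : 'I_s => l' < l)%N (lam i).
  apply: sorted_filter; first by move=> x y z /= yx zy; exact: ltn_trans zy yx.
  rewrite rev_sorted; have := iota_ltn_sorted 0 s.
  by rewrite -val_enum_ord sorted_map.
have top2 i : (\sum_(l <- take 2 (lam i)) l.+1 <= m i + a i)%N.
  have : {subset lam i <= S i} by move=> l; rewrite mem_filter => /andP[].
  case: (lam i) (srt i) => [|l1 [|l2 r]] /=; first by rewrite big_nil.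
    move=> _ /(_ l1); rewrite !inE eqxx big_seq1 => /(_ isT) /orP[l1a|/eqP ->].
      by rewrite (leq_trans l1a)// leq_addl.
    by rewrite leq_addr.
  move=> /andP[l21 _] sub.
  have := sub l1; rewrite !inE eqxx => /(_ isT) h1.
  have := sub l2; rewrite !inE eqxx orbT => /(_ isT) h2.
  rewrite take0 !big_cons big_nil addn0.
  by have := am i; move: h1 h2 => /orP[h1|/eqP h1] /orP[h2|/eqP h2]; lia.
have := indep lam srt (leq_trans (leq_sum _ (fun i _ => top2 i)) summ).
pose P := [seq (i, l) | i <- enum 'I_d, l <- lam i].
have -> : flatten [seq [seq row l (C i) | l <- lam i] | i <- enum 'I_d] =
    [seq row p.2 (C p.1) | p <- P].
  rewrite /P map_flatten -map_comp; congr flatten; apply: eq_map => i /=.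
  by rewrite -map_comp.
(* The first element of [P] serves as default value for [nth]; if [P] is empty, no digit is
   prescribed and any vector will do. *)
move: (erefl P); case: {1}P => [P0 _|p0 P' _].
  exists 0 => i l lS; exfalso; have lSi : l \in S i by [].
  have : (i, l) \in P.
    by apply/allpairsPdep; exists i, l; rewrite mem_enum mem_filter lSi mem_rev mem_enum.
  by rewrite -P0.
move=> /(free_solve (fun k => e (nth p0 P k).1 (nth p0 P k).2)) [x Hx].
exists x => i l lS; have lSi : l \in S i by [].
have ilP : (i, l) \in P.
  by apply/allpairsPdep; exists i, l; rewrite mem_enum mem_filter lSi mem_rev mem_enum.
have kP : (index (i, l) P < size P)%N by rewrite index_mem.
have := Hx (index (i, l) P); rewrite size_map => /(_ kP).
by rewrite (nth_map p0)// nth_index//= -row_mul mxE.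
Qed.

End uniform_digits.

Section digit_averages.
Variables (b s : nat).
Hypothesis b_prime : prime b.
Local Notation E1 := {ffun 'I_s -> 'F_b}.

Definition digit (e : E1) (l : nat) : nat :=
  if insub l is Some j then nat_of_ord (e j) else 0%N.

Lemma digit_ord e (j : 'I_s) : digit e j = e j.
Proof. by rewrite /digit valK. Qed.

Lemma digit_lt e l : (digit e l < b)%N.
Proof.
rewrite /digit; case: insubP => [j _ _|_]; last exact: prime_gt0.
by have := ltn_ord (e j); rewrite [X in (_ < X)%N](Fp_cast b_prime).
Qed.

Lemma sum_Fp (K : nmodType) (F : nat -> K) :
  \sum_(c : 'F_b) F c = \sum_(0 <= k < b) F k.
Proof. by rewrite -[in RHS](Fp_cast b_prime) big_mkord. Qed.

Definition set_digit (e : E1) j c : E1 := [ffun l => if l == j then c else e l].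

Lemma sum_set_digit (K : comNzRingType) (j : 'I_s) (F : E1 -> K) :
  \sum_e \sum_(c : 'F_b) F (set_digit e j c) = b%:R * \sum_e F e.
Proof.
pose dl c : E1 := [ffun l => if l == j then c else 0].
transitivity (\sum_(e : E1) \sum_(c : 'F_b) F (e + dl c)).
  apply: eq_bigr => e _; rewrite (reindex_inj (addrI (e j))); apply: eq_bigr => c _.
  congr F; apply/ffunP => l; rewrite !ffunE; case: eqP => [->//|_].
  by rewrite addr0.
rewrite exchange_big /= mulr_natl.
have -> : (\sum_e F e) *+ b = \sum_(c : 'F_b) \sum_e F e.
  by rewrite sumr_const card_Fp.
apply: eq_bigr => c _.
by rewrite [RHS](reindex_inj (addIr (dl c))).
Qed.

Lemma digit_set_digit e (j : 'I_s) c l :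
  digit (set_digit e j c) l = if l == j then nat_of_ord c else digit e l.
Proof.
rewrite /digit; case: insubP => [i _ il|]; last first.
  by move=> ls; case: eqP => // lj; move: ls; rewrite lj ltn_ord.
by rewrite ffunE -il -val_eqE /=; case: eqP.
Qed.

Lemma digit_value_set_digit e (j : 'I_s) c a : (a <= j)%N ->
  digit_value b (digit (set_digit e j c)) a = digit_value b (digit e) a.
Proof.
move=> aj; apply: eq_digit_value => l la; rewrite digit_set_digit.
by case: eqP => // lj; move: (leq_trans la aj); rewrite lj ltnn.
Qed.

Lemma sum_digit_value (K : comNzRingType) a (g : nat -> K) : (a <= s)%N ->
  (b ^ a)%:R * (\sum_e g (digit_value b (digit e) a)) =
  #|{: E1}|%:R * \sum_(0 <= c < b ^ a) g c.
Proof.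
elim: a g => [|a IH] g as_.
  by rewrite expn0 big_nat1 /= sumr_const mul1r mulr_natl.
rewrite expnS sum_nat_mul -(IH (fun x => \sum_(0 <= k < b) g (b * x + k)%N)); last exact: ltnW.
rewrite mulnC natrM -mulrA; congr (_ * _).
rewrite -(sum_set_digit (Ordinal as_)); apply: eq_bigr => e _.
rewrite -sum_Fp; apply: eq_bigr => c _ /=.
by rewrite digit_value_set_digit// digit_set_digit eqxx.
Qed.

Lemma sum_digit_centered (K : numFieldType) a m (g : nat -> K) : (a <= m)%N -> (m < s)%N ->
  \sum_e g (digit_value b (digit e) a) * ((digit e m)%:R - (b%:R - 1) / 2) = 0.
Proof.
move=> am ms; have b0 : b%:R != 0 :> K by rewrite pnatr_eq0 -lt0n prime_gt0.
apply: (mulfI b0); rewrite mulr0 -(sum_set_digit (Ordinal ms)).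
apply: big1 => e _.
under eq_bigr do rewrite digit_value_set_digit// digit_set_digit eqxx.
rewrite -mulr_sumr (sum_Fp (fun k => k%:R - (b%:R - 1) / 2 : K)).
suff -> : \sum_(0 <= k < b) (k%:R - (b%:R - 1) / 2) = 0 :> K by rewrite mulr0.
have S (k : nat) : \sum_(0 <= i < k) i%:R = k%:R * (k%:R - 1) / 2 :> K.
  elim: k => [|k IH]; first by rewrite big_geq// !mul0r.
  by rewrite big_nat_recr//= IH -natr1; field.
by rewrite sumrB S sumr_const_nat subn0 -mulr_natr; field.
Qed.

End digit_averages.

Section digital_net_points.
Variables (R : realType) (b d s n v : nat) (C : 'I_d -> 'M['F_b]_(s, n)).
Hypothesis b_prime : prime b.
Let b_gt0 := prime_gt0 b_prime.

Lemma sum_digit_vector (K : nmodType) (G : 'cV['F_b]_n -> K) :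
  \sum_(nu < b ^ n) G (digit_vector b n nu) = \sum_x G x.
Proof.
have inj : injective (fun nu : 'I_(b ^ n) => digit_vector b n nu).
  move=> x y /colP xy; apply: ord_inj; apply: (digits_inj b_gt0 (ltn_ord x) (ltn_ord y)) => j jn.
  have := xy (Ordinal jn); rewrite !mxE /= => /(congr1 (@nat_of_ord _)).
  by rewrite !val_Fp_nat// !modn_mod.
have card : #|'I_(b ^ n)| = #|{: 'cV['F_b]_n}|.
  by rewrite card_ord card_mx card_Fp// muln1.
have [h hK Kh] := inj_card_bij inj (eq_leq (esym card)).
by rewrite [RHS](reindex (fun nu : 'I_(b ^ n) => digit_vector b n nu))//; exists h => x _.
Qed.

Definition cell (a : nat) (z : R) : nat := Num.truncn (b%:R ^+ a * z).

Lemma digital_netE nu i : digital_net R C nu 0 i =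
  \sum_(j < s) (digit (net_digits C (digit_vector b n nu) i) j)%:R / b%:R ^+ j.+1.
Proof. by rewrite mxE; apply: eq_bigr => j _; rewrite digit_ord !ffunE. Qed.

(** Only finitely many digits are non-zero, so no infinite tail of digits b - 1 can occur and the
    upper bound is strict. Hence the b-adic cell of a net point is read off from its digits without
    ambiguity. *)
Lemma digit_expansion (x : nat -> nat) (a t : nat) : (forall l, x l < b)%N ->
  let z := \sum_(j < t) (x j)%:R / b%:R ^+ j.+1 : R in
  (forall l, (t <= l)%N -> x l = 0%N) ->
  (digit_value b x a)%:R <= b%:R ^+ a * z < (digit_value b x a)%:R + 1.
Proof.
move=> xb z x0.
have bR : (0 : R) < b%:R by rewrite ltr0n.
have tail k : b%:R ^+ k * (\sum_(j < k) (x j)%:R / b%:R ^+ j.+1 : R) = (digit_value b x k)%:R.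
  elim: k => [|k IH]; first by rewrite big_ord0 mulr0.
  rewrite big_ord_recr /= mulrDr exprS -mulrA IH mulrCA -exprS divff ?mulr1 ?expf_neq0 ?gt_eqF//.
  by rewrite natrD natrM.
have far k : (t <= k)%N -> z = \sum_(j < k) (x j)%:R / b%:R ^+ j.+1.
  move=> tk; rewrite /z -(subnKC tk) big_split_ord /= [X in _ + X]big1 ?addr0// => j _.
  by rewrite x0 ?mul0r// leq_addr.
have -> : b%:R ^+ a * z = (digit_value b x (a + t))%:R / b%:R ^+ t.
  rewrite (far (a + t)%N (leq_addl _ _)) -tail exprD; field.
  by rewrite expf_neq0 ?gt_eqF.
have bt : (0 : R) < b%:R ^+ t by rewrite exprn_gt0.
rewrite ler_pdivlMr// ltr_pdivrMr// -(digit_value_divn b_gt0 a t xb).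
rewrite natr1 -!natrX -!natrM ler_nat ltr_nat leq_trunc_div /=.
by rewrite ltn_ceil// expn_gt0 b_gt0.
Qed.

Lemma cell_digital_net a nu i :
  cell a (digital_net R C nu 0 i) =
  digit_value b (digit (net_digits C (digit_vector b n nu) i)) a.
Proof.
apply/eqP; rewrite /cell; apply/eqP; apply: truncn_def.
rewrite digital_netE -natr1; apply: digit_expansion => l.
  exact: digit_lt.
by move=> sl; rewrite /digit insubF// ltnNge sl.
Qed.

End digital_net_points.

(** * Exact quadrature and box counting for order 2 nets *)

Section net_quadrature.
Variables (R : realType) (b d s n v : nat) (C : 'I_d -> 'M['F_b]_(s, n)).
Hypothesis b_prime : prime b.
Hypothesis netC : order_digital_net 2 v C.
Local Notation E1 := {ffun 'I_s -> 'F_b}.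
Local Notation pt nu i := (digital_net R C nu 0 i).
Local Notation dig nu i := (net_digits C (digit_vector b n nu) i).

Lemma b_neq0 (K : numFieldType) : b%:R != 0 :> K.
Proof. by rewrite pnatr_eq0 -lt0n prime_gt0. Qed.

(** The digits involved are jointly uniform on the net, so the net average equals the average over
    all digit strings, and the latter factorises. In a coordinate with m_i > a_i the digit number
    m_i is independent of the first a_i digits and has mean (b - 1)/2, whence the factor 0. The case
    m_i = a_i encodes the absence of an extra digit. *)
Lemma net_exact (K : numFieldType) (a m : 'I_d -> nat) (g : 'I_d -> nat -> K) :
  (forall i, (a i <= m i)%N) -> (\sum_i (m i + a i) <= 2 * n - v)%N ->
  (b ^ n)%:R^-1 * (\sum_(nu < b ^ n) \prod_i
     (g i (digit_value b (digit (dig nu i)) (a i)) *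
      (if m i == a i then 1
       else (digit (dig nu i) (m i).-1)%:R - (b%:R - 1) / 2))) =
  \prod_i (if m i == a i then (b ^ a i)%:R^-1 * \sum_(0 <= c < b ^ a i) g i c else 0).
Proof.
move=> am summ.
have [sn _ _] := netC.
have ms i : (m i <= s)%N.
  rewrite (leq_trans _ sn)// (leq_trans _ (leq_subr v _))// (leq_trans _ summ)//.
  by rewrite (bigD1 i)//= -addnA leq_addr.
pose ga i (e : E1) := g i (digit_value b (digit e) (a i)) *
   (if m i == a i then 1 else (digit e (m i).-1)%:R - (b%:R - 1) / 2).
pose Ga (e : {ffun 'I_d -> E1}) := \prod_i ga i (e i).
rewrite (sum_digit_vector b_prime (fun x => Ga (net_digits C x))).
have EN0 : #|{: {ffun 'I_d -> E1}}|%:R != 0 :> K.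
  by rewrite pnatr_eq0 -lt0n; apply/card_gt0P; exists 0.
have E10 : #|{: E1}|%:R != 0 :> K.
  by rewrite pnatr_eq0 -lt0n; apply/card_gt0P; exists 0.
have bn0 : (b ^ n)%:R != 0 :> K by rewrite natrX expf_neq0 ?b_neq0.
have := @uniform_digits b d s n C K
  (fun i l => (l < a i)%N || (l.+1 == m i)) Ga (net_solve netC am summ).
rewrite card_mx card_Fp// muln1 => H.
apply: (mulfI EN0); rewrite mulrCA H ?mulKf//; last first.
  move=> e e' ee'; apply: eq_bigr => i _; rewrite /ga.
  have lowE l : (l < a i)%N -> digit (e i) l = digit (e' i) l.
    move=> la; have ls : (l < s)%N by rewrite (leq_trans la)// (leq_trans (am i)).
    have := ee' i (Ordinal ls); rewrite /= la => /(_ isT) eE.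
    by rewrite -[l]/(nat_of_ord (Ordinal ls)) !digit_ord eE.
  rewrite (eq_digit_value _ lowE); congr (_ * _); case: eqP => // /eqP ma.
  have m0 : (0 < m i)%N.
    by rewrite lt0n; apply: contra ma => /eqP m0; move: (am i); rewrite m0 leqn0 eq_sym.
  have ls : ((m i).-1 < s)%N by rewrite prednK.
  have := ee' i (Ordinal ls); rewrite /= prednK// eqxx orbT => /(_ isT) eE.
  by rewrite -[(m i).-1]/(nat_of_ord (Ordinal ls)) !digit_ord eE.
rewrite -(bigA_distr_bigA (fun i e => ga i e)).
have -> : #|{: {ffun 'I_d -> E1}}|%:R = \prod_(i < d) #|{: E1}|%:R :> K.
  by rewrite card_ffun card_ord prodr_const card_ord natrX.
rewrite -big_split /=; apply: eq_bigr => i _.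
case: eqP => [mi|/eqP mi].
  rewrite mulrCA -sum_digit_value//; last by rewrite (leq_trans (am i)).
  rewrite mulKf; last by rewrite natrX expf_neq0 ?b_neq0.
  by apply: eq_bigr => e _; rewrite /ga mi eqxx mulr1.
rewrite mulr0 /ga (negbTE mi).
have am' : (a i < m i)%N by rewrite ltn_neqAle eq_sym mi am.
apply: sum_digit_centered => //; first by rewrite -ltnS prednK// (leq_trans _ am').
by rewrite prednK// (leq_trans _ am').
Qed.

Lemma sub_multiindex (a : 'I_d -> nat) (T k : nat) : (\sum_i a i = T + k)%N ->
  exists a' : 'I_d -> nat, (forall i, (a' i <= a i)%N) /\ (\sum_i a' i = T)%N.
Proof.
elim: k a => [|k IH] a; first by rewrite addn0 => aT; exists a.
move=> aT.
have [i ai] : exists i, (0 < a i)%N.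
  apply/existsP; apply: contraT => /existsPn H; move: aT.
  by rewrite big1 ?addnS// => i _; apply/eqP; have := H i; rewrite -leqNgt leqn0.
have [|a' [a'a sa']] := IH (fun j => (a j - (j == i))%N).
  move: aT; rewrite (bigD1 i)//= [in X in _ -> X](bigD1 i)//= eqxx => aT.
  rewrite (eq_bigr a); last by move=> j /negbTE ->; rewrite subn0.
  by move: aT ai; lia.
by exists a'; split => // j; rewrite (leq_trans (a'a j))// leq_subr.
Qed.

(** Exactness with m = a is available on boxes of level a' with 2|a'| <= 2n - v. A finer level a is
    coarsened to such an a', and by nonnegativity the weight of a cell may be replaced by the sum
    [W] over all cells of its coarse box; this loses at most b^(v+1). *)
Lemma net_box_sum (a : 'I_d -> nat) (w : 'I_d -> nat -> R) :
  (forall i c, 0 <= w i c) ->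
  (b ^ n)%:R^-1 * (\sum_(nu < b ^ n) \prod_i w i (cell b (a i) (pt nu i))) <=
  b%:R ^+ v.+1 / b%:R ^+ minn n (\sum_i a i) *
  \prod_i \sum_(0 <= c < b ^ a i) w i c.
Proof.
move=> w0; have b_gt0 := prime_gt0 b_prime.
have [_ v2n _] := netC.
have b1 : 1 <= b%:R :> R by rewrite ler1n.
have bR : (0 : R) < b%:R by rewrite ltr0n.
(* The largest |a'| with 2|a'| <= 2n - v. Here n - T <= (v + 1)/2, generously replaced by v + 1. *)
pose T := ((2 * n - v)./2)%N.
have [a' [a'a [sa' pw]]] : exists a' : 'I_d -> nat, (forall i, (a' i <= a i)%N) /\
   (\sum_i (a' i + a' i) <= 2 * n - v)%N /\ (minn n (\sum_i a i) <= v.+1 + \sum_i a' i)%N.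
  have [half half2] : (T + T <= 2 * n - v)%N /\ (2 * n - v <= (T + T).+1)%N.
    have := odd_double_half (2 * n - v); rewrite -/T -addnn.
    by case: (odd _) => /= <-; rewrite ?add1n ?add0n leqnn leqnSn.
  case: (leqP (\sum_i a i) T) => aT.
    exists a; split => //; split; last by rewrite (leq_trans (geq_minr _ _))// leq_addl.
    by rewrite big_split /= (leq_trans (leq_add aT aT)).
  have [a' [a'a sa']] := @sub_multiindex a T (\sum_i a i - T) (esym (subnKC (ltnW aT))).
  exists a'; split => //; split; first by rewrite big_split /= sa'.
  by rewrite sa'; lia.
pose W i c := \sum_(0 <= k < b ^ (a i - a' i)) w i (b ^ (a i - a' i) * c + k)%N.
have W0 i c : 0 <= W i c by apply: sumr_ge0.
have wW nu i : w i (cell b (a i) (pt nu i)) <= W i (cell b (a' i) (pt nu i)).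
  rewrite !(cell_digital_net _ C b_prime).
  set x := digit _; have xb l : (x l < b)%N by exact: digit_lt.
  have := digit_value_divn b_gt0 (a' i) (a i - a' i) xb.
  rewrite subnKC// => <-; set c := digit_value _ _ _.
  rewrite {1}(divn_eq c (b ^ (a i - a' i))) [(_ %/ _ * _)%N]mulnC /W.
  rewrite big_mkord (bigD1 (Ordinal (ltn_pmod c (_ : 0 < b ^ (a i - a' i))%N)))//=.
    by rewrite expn_gt0 b_gt0.
  by move=> h; rewrite lerDl sumr_ge0.
have exW := @net_exact R a' a' W (fun i => leqnn _) sa'.
have sumW i : \sum_(0 <= c < b ^ a' i) W i c = \sum_(0 <= c < b ^ a i) w i c.
  by rewrite -sum_nat_mul -expnD subnK.
apply: (@le_trans _ _ ((b ^ n)%:R^-1 * (\sum_(nu < b ^ n) \prod_i W i (cell b (a' i) (pt nu i))))).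
  rewrite ler_wpM2l ?invr_ge0//; apply: ler_sum => nu _; apply: ler_prod => i _.
  by rewrite w0 wW.
rewrite [leLHS](_ : _ = \prod_i ((b ^ a' i)%:R^-1 * \sum_(0 <= c < b ^ a' i) W i c)); last first.
  move: exW; rewrite [X in _ = X](eq_bigr (fun i => (b ^ a' i)%:R^-1 *
    \sum_(0 <= c < b ^ a' i) W i c)); last by move=> i _; rewrite eqxx.
  move=> <-; congr (_ * _); apply: eq_bigr => nu _; apply: eq_bigr => i _.
  by rewrite eqxx mulr1 (cell_digital_net _ C b_prime).
under eq_bigr do rewrite sumW.
rewrite big_split /= ler_wpM2r//; first by apply: prodr_ge0 => i _; apply: sumr_ge0.
rewrite prodfV -natr_prod -expn_sum natrX ler_pdivlMr ?exprn_gt0//.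
rewrite mulrC ler_pdivrMr ?exprn_gt0// -exprD.
by rewrite ler_weXn2l.
Qed.

End net_quadrature.

Section geometric.
Context {R : realFieldType}.

Lemma geometric_shift_le (y : R) (a T : nat) : 0 <= y -> y < 1 ->
  \sum_(0 <= m < T) (if (m < a)%N then 0 else y ^+ (m - a)) <= (1 - y)^-1.
Proof.
move=> y0 y1; have y1' : 0 < 1 - y by rewrite subr_gt0.
apply: (@le_trans _ _ ((1 - y ^+ (T - a)) / (1 - y))); last first.
  by rewrite ler_pdivrMr// mulVf ?gt_eqF// lerBlDr lerDl exprn_ge0.
elim: T => [|T IH]; first by rewrite big_geq// sub0n expr0 subrr mul0r.
rewrite big_nat_recr//=; case: ltnP => aT.
  rewrite addr0; move: IH; have /eqP -> : (T - a == 0)%N by rewrite subn_eq0 ltnW.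
  by have /eqP -> : (T.+1 - a == 0)%N by rewrite subn_eq0.
rewrite subSn// (le_trans (lerD IH (lexx _)))// le_eqVlt; apply/orP; left; apply/eqP.
by rewrite exprS; field; rewrite gt_eqF.
Qed.

End geometric.

(** * Quadrature error of piecewise linear tensor products *)

Section net_quadrature_bound.
Variables (R : realType) (b d s n v : nat) (C : 'I_d -> 'M['F_b]_(s, n)).
Hypothesis b_prime : prime b.
Hypothesis netC : order_digital_net 2 v C.
Local Notation pt nu i := (digital_net R C nu 0 i).
Local Notation dig nu i := (net_digits C (digit_vector b n nu) i).
Variables (a : 'I_d -> nat) (U V : 'I_d -> nat -> R[i]) (w : 'I_d -> nat -> R).
Hypothesis w0 : forall i c, 0 <= w i c.
Hypothesis Uw : forall i c, (c < b ^ a i)%N -> normc (U i c) <= w i c.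
Hypothesis UVw : forall i c, (c < b ^ a i)%N -> normc (U i c + V i c) <= w i c.

Definition piecewise_linear i (z : R) : R[i] :=
  U i (cell b (a i) z) +
  V i (cell b (a i) z) * (b%:R ^+ a i * z - (cell b (a i) z)%:R)%:C.

Definition mean_linear i : R[i] :=
  (b ^ a i)%:R^-1 * \sum_(0 <= c < b ^ a i) (U i c + V i c / 2).

(** Where no cancellation is available, net average and integral are bounded separately by those of
    the tensor majorant; this is the resulting quantity. *)
Definition weight_average : R :=
  (b ^ n)%:R^-1 * (\sum_(nu < b ^ n) \prod_i w i (cell b (a i) (pt nu i))) +
  \prod_i ((b ^ a i)%:R^-1 * \sum_(0 <= c < b ^ a i) w i c).

(* b^(-1/4): all rates below are integer powers of it. *)
Definition quarter_base : R := Num.sqrt (Num.sqrt (b%:R^-1)).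
Local Notation y := quarter_base.
Let b_gt0 := prime_gt0 b_prime.

Lemma quarter_base4 : y ^+ 4 = b%:R^-1.
Proof.
by rewrite /y (exprM _ 2 2) !sqr_sqrtr ?invr_ge0.
Qed.

Lemma quarter_base_gt0 : 0 < y.
Proof. by rewrite !sqrtr_gt0 invr_gt0 ltr0n. Qed.

Lemma quarter_base_lt1 : y < 1.
Proof.
rewrite -(@expr_lt1 _ 4)// ?sqrtr_ge0// quarter_base4 invf_lt1 ?ltr0n//.
by rewrite ltr1n prime_gt1.
Qed.

Lemma digit_centered_le (e : {ffun 'I_s -> 'F_b}) l :
  normc ((digit e l)%:R - (b%:R - 1) / 2 : R[i]) <= b%:R.
Proof.
have -> : (digit e l)%:R - (b%:R - 1) / 2 = ((digit e l)%:R - (b%:R - 1) / 2 : R)%:C.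
  by rewrite rmorphB rmorphM fmorphV rmorphB rmorph1 !rmorph_nat.
rewrite normc_real ler_norml.
have := digit_lt b_prime e l; rewrite -(ltr_nat R) => h1.
have h2 : 0 <= (digit e l)%:R :> R by [].
have h3 : 1 <= b%:R :> R by rewrite ler1n.
by apply/andP; split; lra.
Qed.

(* Expansion of [piecewise_linear i] along the base-b digits of its argument,
   cut off after 2n digits.  Centering the digits gives all parts but the one
   with m = a i mean zero. *)
Definition level_part i (m : nat) (nu : 'I_(b ^ n)) : R[i] :=
  let c := cell b (a i) (pt nu i) in
  if (m < a i)%N then 0 else
  if m == a i then U i c + V i c / 2 else
  if (m <= 2 * n)%N then
    V i c * (b%:R ^+ a i / b%:R ^+ m : R)%:C *
      ((digit (dig nu i) m.-1)%:R - (b%:R - 1) / 2)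
  else V i c * (b%:R ^+ a i / b%:R ^+ (2 * n) *
      (b%:R ^+ (2 * n) * pt nu i - (cell b (2 * n) (pt nu i))%:R - 2^-1))%:C.

Lemma sum_level_part i nu : (a i <= 2 * n)%N ->
  \sum_(m < (2 * n).+2) level_part i m nu = piecewise_linear i (pt nu i).
Proof.
move=> a2n; rewrite -(big_mkord xpredT (fun m => level_part i m nu)).
set c := cell b (a i) (pt nu i).
have b0 : b%:R != 0 :> R by rewrite pnatr_eq0 -lt0n.
(* What is missing after the first a_i + t digits is the fractional part at that level, scaled and
   centred at 1/2. With this centring, consecutive remainders differ by exactly the next digit minus
   (b - 1)/2. *)
suff H t : (a i + t <= 2 * n)%N ->
    \sum_(0 <= m < (a i + t).+1) level_part i m nu =
    piecewise_linear i (pt nu i) - V i c * (b%:R ^+ a i / b%:R ^+ (a i + t) *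
      (b%:R ^+ (a i + t) * pt nu i - (cell b (a i + t) (pt nu i))%:R - 2^-1))%:C.
  have := H (2 * n - a i)%N; rewrite subnKC// => /(_ (leqnn _)) E.
  rewrite big_nat_recr//= E [level_part i (2 * n).+1 nu]/level_part -/c ltnNge (leq_trans a2n)//= ltnn.
  by rewrite eqn_leq leqNgt ltnS a2n /= subrK.
elim: t => [|t IH] at2n.
  rewrite addn0 big_nat_recr//= big1_seq ?add0r; last first.
    by move=> m; rewrite mem_index_iota /= /level_part => ->.
  rewrite /level_part ltnn eqxx -/c /piecewise_linear -/c divff ?expf_neq0// mul1r.
  set X := (b%:R ^+ a i * _ - _); have -> : (X - 2^-1)%:C = X%:C - 2^-1 :> R[i].
    by rewrite rmorphB fmorphV rmorph_nat.
  by ring.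
rewrite addnS big_nat_recr//= IH; last by rewrite (leq_trans _ at2n)// addnS.
rewrite /level_part -/c.
have -> : ((a i + t).+1 < a i)%N = false by lia.
have -> : ((a i + t).+1 == a i) = false by lia.
rewrite -addnS at2n addnS /=.
set e := dig nu i.
have -> : (digit e (a i + t))%:R - (b%:R - 1) / 2 =
   ((digit e (a i + t))%:R - (b%:R - 1) / 2 : R)%:C.
  by rewrite rmorphB rmorphM fmorphV rmorphB rmorph1 !rmorph_nat.
rewrite -[V i c * _ * _]mulrA -(rmorphM (real_complex R)) -addrA -!mulrN -mulrDr.
rewrite -!(rmorphN (real_complex R)) -(rmorphD (real_complex R)).
congr (_ + _ * _%:C).
have -> : cell b (a i + t).+1 (pt nu i) =
    (b * cell b (a i + t) (pt nu i) + digit e (a i + t))%N.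
  by rewrite !(cell_digital_net _ C b_prime).
rewrite natrD natrM !exprS; field.
by rewrite b0 !expf_neq0.
Qed.

Definition level_decay i (m : nat) : R :=
  if (m < a i)%N then 0 else y ^+ (4 * (m - a i)).

Lemma ratio_quarter i m : (a i <= m)%N ->
  b%:R ^+ a i / b%:R ^+ m = y ^+ (4 * (m - a i)) :> R.
Proof.
move=> am; rewrite exprM quarter_base4 exprVn -{1}(subnK am) exprD invfM.
by rewrite mulrCA mulfV ?mulr1// expf_neq0// pnatr_eq0 -lt0n.
Qed.

Lemma cell_lt k nu i : (cell b k (pt nu i) < b ^ k)%N.
Proof.
rewrite (cell_digital_net _ C b_prime); apply: digit_value_ltn => // l.
exact: digit_lt.
Qed.

Lemma cell_frac k nu i :
  (cell b k (pt nu i))%:R <= b%:R ^+ k * pt nu i < (cell b k (pt nu i))%:R + 1.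
Proof.
rewrite (cell_digital_net _ C b_prime) digital_netE; apply: digit_expansion => // l.
  exact: digit_lt.
by move=> sl; rewrite /digit insubF// ltnNge sl.
Qed.

Lemma V_bound i c : (c < b ^ a i)%N -> normc (V i c) <= 2 * w i c.
Proof.
move=> cb; have -> : V i c = (U i c + V i c) - U i c by ring.
by rewrite (le_trans (normcB _ _))// mulr2n mulrDl mul1r lerD ?Uw ?UVw.
Qed.

Lemma UV2_bound i c : (c < b ^ a i)%N -> normc (U i c + V i c / 2) <= w i c.
Proof.
move=> cb; have -> : U i c + V i c / 2 = (2^-1 : R)%:C * (U i c + (U i c + V i c)).
  by rewrite fmorphV rmorph_nat; field.
rewrite normcM normc_real ger0_norm ?invr_ge0// mulrC ler_pdivrMr//.
by rewrite (le_trans (normcD _ _))// mulr2n mulrDr mulr1 lerD ?Uw ?UVw.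
Qed.

Lemma level_part_bound i m nu : (a i <= 2 * n)%N -> (m < (2 * n).+2)%N ->
  normc (level_part i m nu) <=
  2 * b%:R * level_decay i m * w i (cell b (a i) (pt nu i)).
Proof.
move=> a2n mn; rewrite /level_part /level_decay; set c := cell _ _ _.
have cb : (c < b ^ a i)%N by exact: cell_lt.
have b1 : 1 <= b%:R :> R by rewrite ler1n.
have y0 k : 0 <= y ^+ k by rewrite exprn_ge0// ltW// quarter_base_gt0.
case: ltnP => am; first by rewrite mulr0 mul0r ComplexField.Normc.normc0.
case: eqP => [->|_].
  rewrite subnn muln0 expr0 mulr1 (le_trans (UV2_bound cb))//.
  by rewrite ler_peMl//; nra.
case: leqP => m2n.
  rewrite !normcM normc_real ratio_quarter// ger0_norm//.
  rewrite [2 * _ * _]mulrAC [leRHS]mulrAC -[leRHS]mulrA [leRHS](_ : _ =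
    2 * w i c * y ^+ (4 * (m - a i)) * b%:R); last by ring.
  apply: ler_pM; rewrite ?mulr_ge0 ?normc_ge0//.
    by rewrite ler_wpM2r// V_bound.
  exact: digit_centered_le.
rewrite normcM normc_real.
have /andP[f1 f2] := cell_frac (2 * n) nu i.
have rest : `|b%:R ^+ (2 * n) * pt nu i - (cell b (2 * n) (pt nu i))%:R - 2^-1| <= 1.
  by rewrite ler_norml; apply/andP; split; lra.
have -> : m = (2 * n).+1 by apply/eqP; rewrite eqn_leq m2n -ltnS mn.
(* The remainder occupies the slot m = 2n + 1 but only decays as for m = 2n; the missing factor b^-1
   is paid for by [b%:R] in the constant. *)
rewrite subSn// mulnS exprD quarter_base4 normrM ratio_quarter//.
rewrite [leRHS](_ : _ = 2 * w i c * (y ^+ (4 * (2 * n - a i)) * 1)); last first.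
  by field; rewrite gt_eqF// ltr0n.
apply: ler_pM; rewrite ?mulr_ge0 ?normc_ge0//; first exact: V_bound.
by rewrite ger0_norm// ler_wpM2l.
Qed.

Definition level_mean i (m : nat) : R[i] := if m == a i then mean_linear i else 0.

Lemma mean_linear_bound i : normc (mean_linear i) <=
  (b ^ a i)%:R^-1 * \sum_(0 <= c < b ^ a i) w i c.
Proof.
rewrite /mean_linear normcM ComplexField.Normc.normcV.
have -> : (b ^ a i)%:R = ((b ^ a i)%:R : R)%:C :> R[i] by rewrite rmorph_nat.
rewrite normc_real ger0_norm// ler_wpM2l ?invr_ge0//.
rewrite (le_trans (normc_sum _ _ _))//; rewrite big_nat [leRHS]big_nat.
by apply: ler_sum => c /andP[_ cb]; exact: UV2_bound.
Qed.

Lemma weight_average_ge0 : 0 <= weight_average.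
Proof.
apply: addr_ge0.
  by rewrite mulr_ge0 ?invr_ge0//; apply: sumr_ge0 => nu _; apply: prodr_ge0.
by apply: prodr_ge0 => i _; rewrite mulr_ge0 ?invr_ge0// sumr_ge0.
Qed.

Lemma normc_invn k (x : R[i]) : normc (k%:R^-1 * x) = k%:R^-1 * normc x.
Proof.
rewrite normcM ComplexField.Normc.normcV.
have -> : k%:R = (k%:R : R)%:C :> R[i] by rewrite rmorph_nat.
by rewrite normc_real ger0_norm.
Qed.

Lemma tensor_error (G : 'I_d -> 'I_(b ^ n) -> R[i]) (mu : 'I_d -> R[i]) (B : 'I_d -> R) :
  (forall i, 0 <= B i) ->
  (forall i nu, normc (G i nu) <= B i * w i (cell b (a i) (pt nu i))) ->
  (forall i, normc (mu i) <= B i * ((b ^ a i)%:R^-1 * \sum_(0 <= c < b ^ a i) w i c)) ->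
  normc ((b ^ n)%:R^-1 * (\sum_nu \prod_i G i nu) - \prod_i mu i) <=
  \prod_i B i * weight_average.
Proof.
move=> B0 GB muB; rewrite (le_trans (normcB _ _))// mulrDr; apply: lerD.
  rewrite normc_invn mulrCA ler_wpM2l ?invr_ge0// mulr_sumr.
  rewrite (le_trans (normc_sum _ _ _))//; apply: ler_sum => nu _.
  rewrite normc_prod -big_split /=; apply: ler_prod => i _.
  by rewrite normc_ge0 GB.
by rewrite normc_prod -big_split /=; apply: ler_prod => i _; rewrite normc_ge0 muB.
Qed.

Definition shift_decay i (m : nat) : R := if (m < a i)%N then 0 else y ^+ (m - a i).

(** The error vanishes if some m_i < a_i or if [net_exact] applies. Otherwise L, the sum of the m_i
    - a_i, exceeds 2(n - |a|) - v. The parts decay like b^(-L) = y^(4L): three of the four factors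
    y^L yield the exponent 6(n - |a|) - 3v, and the fourth is kept to make the sum over m
    converge. *)
Lemma level_error (m : {ffun 'I_d -> 'I_(2 * n).+2}) : (\sum_i a i <= n)%N ->
  normc ((b ^ n)%:R^-1 * (\sum_nu \prod_i level_part i (m i) nu) -
    \prod_i level_mean i (m i)) <=
  (2 * b%:R) ^+ d * (y^-1 ^+ (3 * v) * y ^+ (6 * (n - \sum_i a i))) *
   weight_average * \prod_i shift_decay i (m i).
Proof.
move=> an; have y0 := quarter_base_gt0; have y1 := ltW quarter_base_lt1.
have b1 : 1 <= b%:R :> R by rewrite ler1n.
have ai_n i : (a i <= 2 * n)%N.
  by rewrite (leq_trans _ (leq_pmull n (isT : 0 < 2)%N))// (leq_trans _ an)// (bigD1 i)//= leq_addr.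
have wa0 := weight_average_ge0.
have sd0 i k : 0 <= shift_decay i k by rewrite /shift_decay; case: ifP => // _; rewrite exprn_ge0// ltW.
have rhs0 : 0 <= (2 * b%:R) ^+ d * (y^-1 ^+ (3 * v) * y ^+ (6 * (n - \sum_i a i))) *
   weight_average * \prod_i shift_decay i (m i).
  by rewrite !mulr_ge0 ?exprn_ge0 ?invr_ge0 ?prodr_ge0// ?mulr_ge0// ltW.
case: (boolP [exists i, (m i < a i)%N]) => [/existsP[i mi]|/existsPn am].
  rewrite big1; last by move=> nu _; rewrite (bigD1 i)//= /level_part mi mul0r.
  rewrite (bigD1 i)//= /level_mean ltn_eqF// mul0r mulr0 subrr.
  by rewrite ComplexField.Normc.normc0.
have {}am i : (a i <= m i)%N by rewrite leqNgt am.
case: (leqP (\sum_i (m i + a i)) (2 * n - v)) => msum.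
  have mi2n i : (m i <= 2 * n)%N.
    by rewrite (leq_trans _ (leq_subr v _))// (leq_trans _ msum)// (bigD1 i)//= -addnA leq_addr.
  pose g i c : R[i] := if m i == a i :> nat then U i c + V i c / 2
    else V i c * (b%:R ^+ a i / b%:R ^+ m i : R)%:C.
  have := net_exact b_prime netC g am msum.
  rewrite (eq_bigr (fun nu => \prod_i level_part i (m i) nu)); last first.
    move=> nu _; apply: eq_bigr => i _; rewrite /level_part ltnNge am /= mi2n.
    by rewrite /g !(cell_digital_net _ C b_prime); case: eqP => _; rewrite ?mulr1.
  move=> ->; rewrite [X in _ - X](eq_bigr (fun i => if m i == a i :> nat then
      (b ^ a i)%:R^-1 * (\sum_(0 <= c < b ^ a i) g i c) else 0)).
    by rewrite subrr ComplexField.Normc.normc0.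
  move=> i _; rewrite /level_mean /mean_linear; case: eqP => // mi.
  by congr (_ * _); apply: eq_bigr => c _; rewrite /g mi eqxx.
pose B i := 2 * b%:R * y ^+ (4 * (m i - a i)).
have B0 i : 0 <= B i by rewrite !mulr_ge0 ?exprn_ge0// ltW.
apply: (le_trans (tensor_error (B := B) B0 _ _)).
- move=> i nu; rewrite (le_trans (level_part_bound _ (ai_n i) (ltn_ord _)))//.
  by rewrite /level_decay ltnNge am.
- move=> i; rewrite /level_mean; case: eqP => mi.
    rewrite /B mi subnn muln0 expr0 mulr1 (le_trans (mean_linear_bound i))//.
    rewrite ler_peMl//; first by rewrite mulr_ge0 ?invr_ge0// sumr_ge0.
    by nra.
  by rewrite ComplexField.Normc.normc0 mulr_ge0// mulr_ge0 ?invr_ge0// sumr_ge0.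
rewrite /B big_split /= prodr_const card_ord.
set P := \prod_i shift_decay i (m i).
rewrite [leRHS](_ : _ = (2 * b%:R) ^+ d *
   (y^-1 ^+ (3 * v) * y ^+ (6 * (n - \sum_i a i)) * P) * weight_average); last by ring.
apply: ler_wpM2r => //; apply: ler_wpM2l; first by rewrite exprn_ge0// mulr_ge0.
rewrite {}/P.
have -> : \prod_i shift_decay i (m i) = y ^+ (\sum_i (m i - a i)).
  by rewrite expr_sum; apply: eq_bigr => i _; rewrite /shift_decay ltnNge am.
rewrite -expr_sum -big_distrr /=.
set L := (\sum_i (m i - a i))%N.
have LE : (\sum_i (m i + a i) = L + 2 * \sum_i a i)%N.
  rewrite /L big_distrr /= -big_split /=; apply: eq_bigr => i _.
  by have := am i; lia.
set P := (6 * _)%N.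
rewrite [leRHS](_ : _ = y ^+ (P + L) / y ^+ (3 * v)); last first.
  by rewrite exprVn exprD; ring.
rewrite ler_pdivlMr ?exprn_gt0// -exprD.
rewrite ler_wiXn2l ?(ltW y0)//; move: msum an; rewrite LE /P; set S := (\sum_i a i)%N; clearbody L S; clear; lia.
Qed.

Lemma net_quadrature_bound : (\sum_i a i <= n)%N ->
  normc ((b ^ n)%:R^-1 * (\sum_nu \prod_i piecewise_linear i (pt nu i)) -
    \prod_i mean_linear i) <=
  (2 * b%:R) ^+ d * y^-1 ^+ (3 * v) * ((1 - y)^-1) ^+ d *
   y ^+ (6 * (n - \sum_i a i)) * weight_average.
Proof.
move=> an.
have ai_n i : (a i <= 2 * n)%N.
  by rewrite (leq_trans _ (leq_pmull n (isT : 0 < 2)%N))// (leq_trans _ an)// (bigD1 i)//= leq_addr.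
have y0 := quarter_base_gt0; have y1 := quarter_base_lt1.
have -> : (\sum_nu \prod_i piecewise_linear i (pt nu i)) =
    \sum_(m : {ffun 'I_d -> 'I_(2 * n).+2}) \sum_nu \prod_i level_part i (m i) nu.
  rewrite exchange_big /=; apply: eq_bigr => nu _.
  rewrite -(bigA_distr_bigA (fun i (m : 'I_(2 * n).+2) => level_part i m nu)).
  by apply: eq_bigr => i _; rewrite sum_level_part.
have -> : \prod_i mean_linear i =
    \sum_(m : {ffun 'I_d -> 'I_(2 * n).+2}) \prod_i level_mean i (m i).
  rewrite -(bigA_distr_bigA (fun i (m : 'I_(2 * n).+2) => level_mean i m)).
  apply: eq_bigr => i _.
  have ai : (a i < (2 * n).+2)%N by rewrite ltnS (leq_trans (ai_n i)).
  rewrite (bigD1 (Ordinal ai))//= /level_mean eqxx big1 ?addr0// => m.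
  by rewrite -val_eqE /= => /negbTE ->.
rewrite mulr_sumr -sumrB (le_trans (normc_sum _ _ _))//.
apply: (le_trans (ler_sum _ (fun m _ => level_error m an))).
rewrite -mulr_sumr -(bigA_distr_bigA (fun i (m : 'I_(2 * n).+2) => shift_decay i m)).
rewrite [leRHS](_ : _ = (2 * b%:R) ^+ d * (y^-1 ^+ (3 * v) * y ^+ (6 * (n - \sum_i a i))) *
   weight_average * ((1 - y)^-1) ^+ d); last by ring.
rewrite ler_wpM2l//.
  by rewrite !mulr_ge0 ?exprn_ge0 ?invr_ge0 ?weight_average_ge0// ?mulr_ge0// ltW.
rewrite -[X in _ ^+ X]card_ord -prodr_const; apply: ler_prod => i _.
rewrite -(big_mkord xpredT (shift_decay i)) geometric_shift_le ?(ltW y0)// andbT.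
apply: sumr_ge0 => m _; rewrite /shift_decay; case: ifP => // _.
by rewrite exprn_ge0// ltW.
Qed.

End net_quadrature_bound.

(** * Decay of the kernels *)

Section real_calculus.
Context {R : realType}.
Implicit Types (f g : R -> R) (u x : R).
Local Notation mu := (@lebesgue_measure R).

Lemma is_derive_continuous g (g1 : R -> R) :
  (forall x, is_derive x 1 g (g1 x)) -> continuous g.
Proof.
move=> gd x; apply: differentiable_continuous; apply/derivable1_diffP.
by have := gd x => H; exact: ex_derive.
Qed.

Lemma is_derive_cosM u x : is_derive x 1 (fun x => cos (u * x)) (- u * sin (u * x)).
Proof.
have H1 : is_derive x 1 (fun x => u * x) u.
  by apply: is_derive_eq; rewrite ?scaler0 ?addr0 ?add0r /GRing.scale /= mulr1.
have := @is_derive1_comp R cos (fun x => u * x) x _ _ (is_derive_cos _) H1.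
by move/is_derive_eq; apply; ring.
Qed.

Lemma is_derive_sinM u x : is_derive x 1 (fun x => sin (u * x)) (u * cos (u * x)).
Proof.
have H1 : is_derive x 1 (fun x => u * x) u.
  by apply: is_derive_eq; rewrite ?scaler0 ?addr0 ?add0r /GRing.scale /= mulr1.
have := @is_derive1_comp R sin (fun x => u * x) x _ _ (is_derive_sin _) H1.
by move/is_derive_eq; apply; ring.
Qed.

Lemma is_deriveMf f g x (df dg : R) : is_derive x 1 f df -> is_derive x 1 g dg ->
  is_derive x 1 (fun x => f x * g x) (df * g x + f x * dg).
Proof.
move=> fd gd; have /is_derive_eq := @is_deriveM R R f g x 1 df dg fd gd.
by apply; rewrite /GRing.scale /=; ring.
Qed.

Lemma is_deriveDf f g x (df dg : R) : is_derive x 1 f df -> is_derive x 1 g dg ->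
  is_derive x 1 (fun x => f x + g x) (df + dg).
Proof. by move=> fd gd; exact: is_deriveD. Qed.

Lemma is_deriveBf f g x (df dg : R) : is_derive x 1 f df -> is_derive x 1 g dg ->
  is_derive x 1 (fun x => f x - g x) (df - dg).
Proof. by move=> fd gd; exact: is_deriveB. Qed.

Lemma is_deriveZf f x (c df : R) : is_derive x 1 f df ->
  is_derive x 1 (fun x => c * f x) (c * df).
Proof. by move=> fd; exact: is_deriveZ. Qed.

Lemma is_derive_scale f (f1 : R -> R) (c k : R) x :
  (forall x, is_derive x 1 f (f1 x)) ->
  is_derive x 1 (fun x => f (c * x + k)) (c * f1 (c * x + k)).
Proof.
move=> fd; have H1 : is_derive x 1 (fun x => c * x + k) c.
  by apply: is_derive_eq; rewrite ?scaler0 ?addr0 ?add0r /GRing.scale /= mulr1.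
have /is_derive_eq := @is_derive1_comp R f (fun x => c * x + k) x _ _ (fd _) H1.
by apply; ring.
Qed.

Lemma FTC2_total f F (a c : R) : a < c -> continuous f ->
  (forall x, is_derive x 1 F (f x)) ->
  \int[mu]_(x in `[a, c]) f x = F c - F a.
Proof.
move=> ac cf Fd; have cF := is_derive_continuous Fd.
rewrite /Rintegral (@continuous_FTC2 _ f F a c ac).
- by rewrite -EFinB.
- by apply: continuous_subspaceT.
- split; first by move=> x _; have := Fd x => H; exact: ex_derive.
    by apply: cvg_at_right_filter; exact: cF.
  by apply: cvg_at_left_filter; exact: cF.
- by move=> x _; rewrite derive1E; have := Fd x => H; exact: derive_val.
Qed.

Lemma continuous_itv_integrable f (a c : R) : continuous f ->
  mu.-integrable `[a, c] (EFin \o f).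
Proof.
move=> cf; apply: continuous_compact_integrable; first exact: segment_compact.
exact: continuous_subspaceT.
Qed.

Lemma MVT_total f (f1 : R -> R) (a c : R) : a <= c ->
  (forall x, is_derive x 1 f (f1 x)) ->
  exists2 xi, a <= xi <= c & f c - f a = f1 xi * (c - a).
Proof.
move=> ac fd; have [|xi xic E] := @MVT_segment R f f1 a c ac (fun x _ => fd x).
  by apply: continuous_subspaceT; exact: is_derive_continuous fd.
by exists xi => //; move: xic; rewrite in_itv.
Qed.

(** One formula has to serve on the whole line, so the base point -|x| - 1 moves with x and stays
    below both 0 and x. Near x it may be replaced by the fixed base [a], since |z| <= |x| + 1 there,
    and the fundamental theorem applies. *)
Lemma antiderivative f : continuous f ->
  exists F, forall x, is_derive x 1 F (f x).
Proof.
move=> cf.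
pose I (a x : R) := \int[mu]_(t in `[a, x]) f t.
have split_I (a c x : R) : a <= c -> c <= x -> I a x = I a c + I c x.
  move=> ac cx; have if_ := continuous_itv_integrable a x cf.
  have /(_ _ _)/(congr1 (fun z => z + I a c)) := @Rintegral_itvB R f (BLeft a) (BRight x) c if_.
  rewrite bnd_simp => /(_ ac); rewrite bnd_simp => /(_ cx).
  rewrite subrK => E; rewrite [LHS]E addrC; congr (_ + _).
  by rewrite Rintegral_itv_obnd_cbnd//; apply: integrableS if_ => //; apply: subset_itvr.
pose F x := I (- `|x| - 1) x - I (- `|x| - 1) 0.
exists F => x.
pose a : R := - `|x| - 3.
have FE z : `|z - x| < 1 -> F z = I a z - I a 0.
  move=> zx; have nz : `|z| <= `|x| + 1.
    by rewrite -[z](subrK x) (le_trans (ler_normD _ _))// addrC lerD2l ltW.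
  have z1 : - `|z| <= z by rewrite lerNl -normrN ler_norm.
  have z0 := normr_ge0 z.
  rewrite /F (split_I a (- `|z| - 1) z) ?(split_I a (- `|z| - 1) 0); rewrite /a; try lra.
have ax : a < x.
  have := ler_norm (- x); rewrite normrN /a; have := normr_ge0 x; lra.
have x1 : x < x + 1 by rewrite ltrDl ltr01.
have [d1 d2] := @continuous_FTC1 R f (BLeft a) x (x + 1) x1
  (continuous_itv_integrable a (x + 1) cf) ax (cf x).
apply: (@near_eq_is_derive _ _ _ (fun z => I a z - I a 0)).
  near=> z; apply/esym/FE; rewrite distrC; near: z.
  exact: (@nbhsx_ballx _ _ x 1 ltr01).
have dI : is_derive x 1 (I a) (f x).
  by split; [exact: d1|rewrite -derive1E; exact: d2].
by have := is_deriveBf dI (is_derive_cst (I a 0) x 1); move/is_derive_eq; apply; rewrite subr0.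
Unshelve. all: by end_near. Qed.

End real_calculus.

(** * Oscillatory integrals *)

Section oscillatory_integrals.
Context {R : realType}.
Implicit Types (f g : R -> R) (u x : R).
Local Notation mu := (@lebesgue_measure R).

(** The cutoff is supported in |x| <= 3/2, strictly inside [-2, 2], so all boundary terms of
    integrations by parts vanish at -2 and 2. *)
Definition cosI g u : R := \int[mu]_(x in `[-2, 2]) (g x * cos (u * x)).
Definition sinI g u : R := \int[mu]_(x in `[-2, 2]) (g x * sin (u * x)).
Definition absI g : R := \int[mu]_(x in `[-2, 2]) `|g x|.

Lemma continuous_cosM u : continuous (fun x => cos (u * x)).
Proof. exact: is_derive_continuous (is_derive_cosM u). Qed.

Lemma continuous_sinM u : continuous (fun x => sin (u * x)).
Proof. exact: is_derive_continuous (is_derive_sinM u). Qed.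

Lemma continuousMf f g : continuous f -> continuous g -> continuous (fun x => f x * g x).
Proof. by move=> cf cg x; exact: (@continuousM _ _ f g x (cf x) (cg x)). Qed.

Lemma continuousDf f g : continuous f -> continuous g -> continuous (fun x => f x + g x).
Proof. by move=> cf cg x; exact: (@continuousD _ _ _ f g x (cf x) (cg x)). Qed.

Lemma continuous_idf : continuous (fun x : R => x).
Proof. by move=> x; exact: cvg_id. Qed.

Lemma continuous_norm g : continuous g -> continuous (fun x => `|g x|).
Proof. by move=> cg x; apply: cvg_norm; exact: cg. Qed.

Lemma absI_ge0 g : 0 <= absI g.
Proof. by apply: Rintegral_ge0. Qed.

Lemma osc_le g (h : R -> R) : continuous g -> continuous h -> (forall x, `|h x| <= 1) ->
  `|\int[mu]_(x in `[-2, 2]) (g x * h x)| <= absI g.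
Proof.
move=> cg ch h1.
have ci := continuous_itv_integrable (-2) 2 (continuousMf cg ch).
apply: le_trans (le_normr_Rintegral _ ci) _ => //.
apply: le_Rintegral => //.
- exact: (continuous_itv_integrable (-2) 2 (continuous_norm (continuousMf cg ch))).
- exact: (continuous_itv_integrable (-2) 2 (continuous_norm cg)).
- by move=> x _; rewrite normrM ler_piMr.
Qed.

Lemma cosI_le g u : continuous g -> `|cosI g u| <= absI g.
Proof.
by move=> cg; apply: osc_le => //; [exact: continuous_cosM|move=> x; exact: cos_max].
Qed.

Lemma sinI_le g u : continuous g -> `|sinI g u| <= absI g.
Proof.
by move=> cg; apply: osc_le => //; [exact: continuous_sinM|move=> x; exact: sin_max].
Qed.

Lemma lt_N22 : (-2 : R) < 2. Proof. lra. Qed.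

(** Two integrations by parts at once: the sum of the two integrands is the derivative of g' cos(u
    x) + u g sin(u x), which vanishes at both ends. *)
Lemma cosI_ibp g g1 g2 u :
  (forall x, is_derive x 1 g (g1 x)) -> (forall x, is_derive x 1 g1 (g2 x)) ->
  continuous g2 -> g (-2) = 0 -> g 2 = 0 -> g1 (-2) = 0 -> g1 2 = 0 ->
  u ^+ 2 * cosI g u = - cosI g2 u.
Proof.
move=> gd g1d cg2 gm gp g1m g1p; apply/eqP; rewrite -addr_eq0; apply/eqP.
have cg := is_derive_continuous gd; have cc := @continuous_cosM u.
pose h x := g2 x * cos (u * x) + u ^+ 2 * (g x * cos (u * x)).
have cst_c : continuous (fun _ : R => u ^+ 2) by move=> x; exact: cvg_cst.
have ch : continuous h.
  by apply: continuousDf; [exact: continuousMf|apply: continuousMf => //; exact: continuousMf].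
have dH x : is_derive x 1 (fun x => g1 x * cos (u * x) + u * (g x * sin (u * x))) (h x).
  have := is_deriveDf (is_deriveMf (g1d x) (is_derive_cosM u x))
    (is_deriveZf u (is_deriveMf (gd x) (is_derive_sinM u x))).
  by move/is_derive_eq; apply; rewrite /h; ring.
have := FTC2_total lt_N22 ch dH; rewrite gm gp g1m g1p !mul0r !mulr0 !addr0 subrr.
have i1 := continuous_itv_integrable (-2) 2 (continuousMf cg2 cc).
have i2 := continuous_itv_integrable (-2) 2 (continuousMf cg cc).
have i3 := continuous_itv_integrable (-2) 2 (continuousMf cst_c (continuousMf cg cc)).
rewrite (RintegralD _ i1 i3)// (RintegralZl _ _ i2)// => H.
by rewrite addrC.
Qed.

Lemma sinI_ibp g g1 g2 u :
  (forall x, is_derive x 1 g (g1 x)) -> (forall x, is_derive x 1 g1 (g2 x)) ->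
  continuous g2 -> g (-2) = 0 -> g 2 = 0 -> g1 (-2) = 0 -> g1 2 = 0 ->
  u ^+ 2 * sinI g u = - sinI g2 u.
Proof.
move=> gd g1d cg2 gm gp g1m g1p; apply/eqP; rewrite -addr_eq0; apply/eqP.
have cg := is_derive_continuous gd; have cc := @continuous_sinM u.
pose h x := g2 x * sin (u * x) + u ^+ 2 * (g x * sin (u * x)).
have cst_c : continuous (fun _ : R => u ^+ 2) by move=> x; exact: cvg_cst.
have ch : continuous h.
  by apply: continuousDf; [exact: continuousMf|apply: continuousMf => //; exact: continuousMf].
have dH x : is_derive x 1 (fun x => g1 x * sin (u * x) + (- u) * (g x * cos (u * x))) (h x).
  have := is_deriveDf (is_deriveMf (g1d x) (is_derive_sinM u x))
    (is_deriveZf (- u) (is_deriveMf (gd x) (is_derive_cosM u x))).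
  by move/is_derive_eq; apply; rewrite /h; ring.
have := FTC2_total lt_N22 ch dH; rewrite gm gp g1m g1p !mul0r !mulr0 !addr0 subrr.
have i1 := continuous_itv_integrable (-2) 2 (continuousMf cg2 cc).
have i2 := continuous_itv_integrable (-2) 2 (continuousMf cg cc).
have i3 := continuous_itv_integrable (-2) 2 (continuousMf cst_c (continuousMf cg cc)).
rewrite (RintegralD _ i1 i3)// (RintegralZl _ _ i2)// => H.
by rewrite addrC.
Qed.

Section under_integral.
Variables (g : R -> R) (cg : continuous g) (h h1 : R -> R).
Hypothesis hd : forall x, is_derive x 1 h (h1 x).
Hypothesis h1_le : forall x, `|h1 x| <= 1.

Lemma is_derive_under u :
  is_derive u 1 (fun u => \int[mu]_(x in `[-2, 2]) (g x * h (u * x)))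
    (\int[mu]_(x in `[-2, 2]) (x * g x * h1 (u * x))).
Proof.
have hM (x w : R) : is_derive w 1 (fun w => g x * h (w * x)) (g x * (x * h1 (w * x))).
  have := is_deriveZf (g x) (is_derive_scale x 0 w hd).
  have -> : (fun w => g x * h (x * w + 0)) = (fun w => g x * h (w * x)).
    by apply/funext => z; rewrite addr0 mulrC [z * x]mulrC mulrC.
  by move/is_derive_eq; apply; rewrite addr0 [x * w]mulrC.
pose f (w x : R) := g x * h (w * x).
have d1E w x : partial1of2 f w x = x * g x * h1 (w * x).
  by rewrite partial1of2E; have := hM x w => H; rewrite [LHS]derive_val; ring.
have uI : `](u - 1), (u + 1)[%classic u by rewrite /= in_itv/=; apply/andP; split; lra.
have cf w : continuous (f w).
  apply: continuousMf => // x.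
  have := is_derive_scale w 0 x hd.
  have -> : (fun z => h (w * z + 0)) = fun z => h (w * z) by apply/funext => z; rewrite addr0.
  by move=> H; apply: differentiable_continuous; exact/derivable1_diffP.
have intf w : `](u - 1), (u + 1)[%classic w -> mu.-integrable `[-2, 2] (EFin \o f w).
  by move=> _; exact: continuous_itv_integrable.
have derf w x : `](u - 1), (u + 1)[%classic w -> `[-2, 2]%classic x -> derivable (f^~ x) w 1.
  by move=> _ _; have := hM x w => H; exact: ex_derive.
have cG : continuous (fun x => `|x * g x|).
  by apply: continuous_norm; apply: continuousMf => //; exact: continuous_idf.
have Gub w x : `](u - 1), (u + 1)[%classic w -> `[-2, 2]%classic x ->
    `|partial1of2 f w x| <= `|x * g x|.
  by move=> _ _; rewrite d1E normrM ler_piMr.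
have iG := continuous_itv_integrable (-2) 2 cG.
have G0 x : 0 <= `|x * g x| by [].
have mB : measurable (`[-2, 2]%classic : set (measurableTypeR R)) by exact: measurable_itv.
have D1 := @derivable_under_integral R _ _ mu f _ mB _ _ _ uI intf derf _ G0 iG Gub.
have D2 := @differentiation_under_integral R _ _ mu f _ mB _ _ _ uI intf derf _ G0 iG Gub.
split; first exact: D1.
rewrite -derive1E [LHS]D2; apply: eq_Rintegral => x _; exact: d1E.
Qed.

End under_integral.

Lemma is_derive_cosI g u : continuous g ->
  is_derive u 1 (cosI g) (- sinI (fun x => x * g x) u).
Proof.
move=> cg.
have H := @is_derive_under g cg cos (fun x => - sin x) _ _ u.
have/is_derive_eq := H (fun x => is_derive_cos x)
  (fun x => eq_ind_r (fun z => z <= _) (sin_max x) (normrN _)).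
apply; rewrite /sinI -[RHS]mulN1r -RintegralZl//.
  by apply: eq_Rintegral => x _; rewrite mulrN mulN1r.
apply: continuous_itv_integrable; apply: continuousMf (@continuous_sinM u).
by apply: continuousMf => //; exact: continuous_idf.
Qed.

Lemma is_derive_sinI g u : continuous g ->
  is_derive u 1 (sinI g) (cosI (fun x => x * g x) u).
Proof.
by move=> cg; exact: (@is_derive_under g cg sin cos (fun x => is_derive_sin x)
  (fun x => cos_max x) u).
Qed.

(** The kernel itself is asked to decay like u^-4, because the mean value estimate of its band-pass
    primitive in [band_profile] costs one factor u. For the derivative u^-2 is enough. *)
Definition good_kernel (k k1 : R -> R) (C : R) := [/\
  forall u, is_derive u 1 k (k1 u),
  forall u, `|k u| <= C * lorentz u ^+ 2 &
  forall u, `|k1 u| <= C * lorentz u].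

Definition smooth_bump f := (forall m x, derivable (derive1n m f) x 1) /\
  (forall x, 3 / 2 < `|x| -> f x = 0).

Lemma smooth_bump_derive f m x : smooth_bump f ->
  is_derive x 1 (derive1n m f) (derive1n m.+1 f x).
Proof. by move=> [fd _]; split; [exact: fd|rewrite derive1nS derive1E]. Qed.

Lemma smooth_bump_vanish f m x : smooth_bump f -> 3 / 2 < `|x| -> derive1n m f x = 0.
Proof.
move=> [_ f0]; elim: m x => [|m IH] x x32; first exact: f0.
rewrite derive1nS derive1E.
rewrite (@near_eq_derive _ _ _ _ (cst 0) x 1); first exact: derive_cst.
near=> z; apply: IH; near: z.
have e0 : 0 < `|x| - 3 / 2 by rewrite subr_gt0.
apply: filterS (@nbhsx_ballx _ _ x _ e0) => z; rewrite /ball /= => zx.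
have := lerB_dist x z; lra.
Unshelve. all: by end_near. Qed.

Lemma decay4 (u c0 c2 c4 a0 a2 a4 : R) : `|c0| <= a0 -> `|c2| <= a2 -> `|c4| <= a4 ->
  u ^+ 2 * c0 = - c2 -> u ^+ 2 * c2 = - c4 ->
  `|c0| <= (a0 + 2 * a2 + a4) * lorentz u ^+ 2.
Proof.
move=> h0 h2 h4 e1 e2; have p := lorentz_den_gt0 u.
rewrite /lorentz exprVn ler_pdivlMr ?exprn_gt0//.
rewrite -[X in `|c0| * X](ger0_norm (exprn_ge0 2 (ltW p))) -normrM.
have -> : c0 * (1 + u ^+ 2) ^+ 2 = c0 + 2 * - c2 + c4.
  have -> : c4 = - (u ^+ 2 * c2) by rewrite e2 opprK.
  have -> : c2 = - (u ^+ 2 * c0) by rewrite e1 opprK.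
  by ring.
have n1 := ler_normD (c0 + 2 * - c2) c4; have n2 := ler_normD c0 (2 * - c2).
have n3 : `|2 * - c2| = 2 * `|c2| by rewrite normrM normrN ger0_norm.
rewrite n3 in n2; lra.
Qed.

Lemma decay2 (u c0 c2 a0 a2 : R) : `|c0| <= a0 -> `|c2| <= a2 ->
  u ^+ 2 * c0 = - c2 -> `|c0| <= (a0 + a2) * lorentz u.
Proof.
move=> h0 h2 e1; have p := lorentz_den_gt0 u.
rewrite /lorentz ler_pdivlMr//.
rewrite -[X in `|c0| * X](ger0_norm (ltW p)) -normrM mulrDr mulr1 mulrC e1.
have n1 := ler_normD c0 (- c2); rewrite normrN in n1; lra.
Qed.

Lemma osc_good f : smooth_bump f ->
  (exists k1 C, good_kernel (cosI f) k1 C) /\ (exists k1 C, good_kernel (sinI f) k1 C).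
Proof.
move=> fb.
pose D m := derive1n m f.
have dD m x : is_derive x 1 (D m) (D m.+1 x) := smooth_bump_derive m x fb.
have cD m : continuous (D m) := is_derive_continuous (dD m).
have Dp m : D m 2 = 0 by apply: smooth_bump_vanish => //; rewrite ger0_norm//; lra.
have Dm m : D m (-2) = 0.
  by apply: smooth_bump_vanish => //; rewrite normrN ger0_norm//; lra.
have cI2 u : u ^+ 2 * cosI f u = - cosI (D 2%N) u.
  exact: (@cosI_ibp f (D 1%N) (D 2%N) u (dD 0%N) (dD 1%N) (cD 2%N) (Dm 0%N) (Dp 0%N)
    (Dm 1%N) (Dp 1%N)).
have cI4 u : u ^+ 2 * cosI (D 2%N) u = - cosI (D 4%N) u.
  exact: (@cosI_ibp (D 2%N) (D 3%N) (D 4%N) u (dD 2%N) (dD 3%N) (cD 4%N) (Dm 2%N) (Dp 2%N)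
    (Dm 3%N) (Dp 3%N)).
have sI2 u : u ^+ 2 * sinI f u = - sinI (D 2%N) u.
  exact: (@sinI_ibp f (D 1%N) (D 2%N) u (dD 0%N) (dD 1%N) (cD 2%N) (Dm 0%N) (Dp 0%N)
    (Dm 1%N) (Dp 1%N)).
have sI4 u : u ^+ 2 * sinI (D 2%N) u = - sinI (D 4%N) u.
  exact: (@sinI_ibp (D 2%N) (D 3%N) (D 4%N) u (dD 2%N) (dD 3%N) (cD 4%N) (Dm 2%N) (Dp 2%N)
    (Dm 3%N) (Dp 3%N)).
(* Differentiation in the frequency multiplies the integrand by x, so the derivative of the kernel
   is the transform of x f(x), again supported in |x| <= 3/2. *)
pose g x := x * f x; pose g1 x := f x + x * D 1%N x; pose g2 x := 2 * D 1%N x + x * D 2%N x.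
have cid := @continuous_idf.
have gd x : is_derive x 1 g (g1 x).
  have := is_deriveMf (is_derive_id x 1) (dD 0%N x).
  by move/is_derive_eq; apply; rewrite /g1 mul1r.
have g1d x : is_derive x 1 g1 (g2 x).
  have := is_deriveDf (dD 0%N x) (is_deriveMf (is_derive_id x 1) (dD 1%N x)).
  by move/is_derive_eq; apply; rewrite /g2; ring.
have cg := is_derive_continuous gd.
have cg2 : continuous g2.
  apply: continuousDf; apply: continuousMf => //.
  by move=> x; exact: cvg_cst.
have f2 : f 2 = 0 := Dp 0%N; have fm2 : f (-2) = 0 := Dm 0%N.
have cgI u : u ^+ 2 * cosI g u = - cosI g2 u.
  by apply: cosI_ibp gd g1d cg2 _ _ _ _; rewrite /g /g1 ?f2 ?fm2 ?Dp ?Dm ?mulr0 ?addr0.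
have sgI u : u ^+ 2 * sinI g u = - sinI g2 u.
  by apply: sinI_ibp gd g1d cg2 _ _ _ _; rewrite /g /g1 ?f2 ?fm2 ?Dp ?Dm ?mulr0 ?addr0.
pose B1 := absI f + 2 * absI (D 2%N) + absI (D 4%N); pose B2 := absI g + absI g2.
have B1p : 0 <= B1 by rewrite !addr_ge0 ?mulr_ge0 ?absI_ge0.
have B2p : 0 <= B2 by rewrite addr_ge0 ?absI_ge0.
have fin4 (u c0 c2 c4 : R) : `|c0| <= absI f -> `|c2| <= absI (D 2%N) -> `|c4| <= absI (D 4%N) ->
    u ^+ 2 * c0 = - c2 -> u ^+ 2 * c2 = - c4 -> `|c0| <= (B1 + B2) * lorentz u ^+ 2.
  move=> h0 h2 h4 e1 e2; apply: le_trans (decay4 h0 h2 h4 e1 e2) _.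
  apply: ler_wpM2r; first by rewrite exprn_ge0// ltW// lorentz_gt0.
  by rewrite -/B1 lerDl.
have fin2 (u c0 c2 : R) : `|c0| <= absI g -> `|c2| <= absI g2 ->
    u ^+ 2 * c0 = - c2 -> `|c0| <= (B1 + B2) * lorentz u.
  move=> h0 h2 e1; apply: le_trans (decay2 h0 h2 e1) _.
  apply: ler_wpM2r; first by rewrite ltW// lorentz_gt0.
  by rewrite -/B2 lerDr.
split.
  exists (fun u => - sinI g u), (B1 + B2); split => u.
  - exact: is_derive_cosI (cD 0%N).
  - exact: (fin4 u _ _ _ (cosI_le u (cD 0%N)) (cosI_le u (cD 2%N)) (cosI_le u (cD 4%N)) (cI2 u) (cI4 u)).
  - by rewrite normrN; exact: (fin2 u _ _ (sinI_le u cg) (sinI_le u cg2) (sgI u)).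
exists (cosI g), (B1 + B2); split => u.
- exact: is_derive_sinI (cD 0%N).
- exact: (fin4 u _ _ _ (sinI_le u (cD 0%N)) (sinI_le u (cD 2%N)) (sinI_le u (cD 4%N)) (sI2 u) (sI4 u)).
- exact: (fin2 u _ _ (cosI_le u cg) (cosI_le u cg2) (cgI u)).
Qed.

End oscillatory_integrals.

(** * Kernels of the dyadic cutoff *)

Section kernel_of_cutoff.
Context {R : realType}.
Implicit Types (f g : R -> R) (u x c : R).
Local Notation mu := (@lebesgue_measure R).

Lemma derive_mx11 (g : R -> R) (x : 'rV[R]_1) :
  (derivable (fun y : 'rV[R]_1 => g (y 0 0)) x (delta_mx 0 0) <-> derivable g (x 0 0) 1) /\
  'D_(delta_mx 0 0) (fun y : 'rV[R]_1 => g (y 0 0)) x = 'D_1 g (x 0 0).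
Proof.
rewrite /derivable /derive.
have -> : (fun h : R => h^-1 *: (((fun y : 'rV[R]_1 => g (y 0 0)) \o shift x) (h *: delta_mx 0 0) -
     g (x 0 0))) = (fun h : R => h^-1 *: ((g \o shift (x 0 0)) (h *: 1) - g (x 0 0))).
  by apply/funext => h /=; rewrite !mxE eqxx.
by [].
Qed.

Lemma smooth_mx11 f : smooth (fun y : 'rV[R]_1 => f (y 0 0)) ->
  forall m x, derivable (derive1n m f) x 1.
Proof.
move=> sf m x.
have pE k : partials (nseq k (ord0 : 'I_1)) (fun y : 'rV[R]_1 => f (y 0 0)) =
    fun y => derive1n k f (y 0 0).
  elim: k => [//|k IH]; rewrite derive1nS /=; apply/funext => y.
  have -> : 'D_(delta_mx 0 ord0) (partials (nseq k ord0) (fun y0 : 'rV[R]_1 => f (y0 0 0))) y =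
      'D_(delta_mx 0 0) (fun y0 : 'rV[R]_1 => derive1n k f (y0 0 0)) y by rewrite IH.
  by rewrite (derive_mx11 _ _).2 derive1E.
have [_ /(_ ord0 (const_mx x))] := sf (nseq m ord0).
by rewrite pE => /(derive_mx11 _ _).1; rewrite mxE.
Qed.

Lemma cutoff_bump phi0 : dyadic_cutoff phi0 ->
  smooth_bump (fun x => complex.Re (phi0 x)) /\ smooth_bump (fun x => complex.Im (phi0 x)).
Proof.
move=> [[[s1 s2] _] _ p0]; split; split.
- exact: smooth_mx11 s1.
- by move=> x /p0 ->.
- exact: smooth_mx11 s2.
- by move=> x /p0 ->.
Qed.

Lemma smooth_bump_continuous f : smooth_bump f -> continuous f.
Proof. by move=> fb; apply: is_derive_continuous (fun x => smooth_bump_derive 0 x fb). Qed.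

Lemma integrable_compact_support (G : R -> R) (a : R) : continuous G ->
  (forall x, a < `|x| -> G x = 0) ->
  mu.-integrable setT (EFin \o G) /\
  \int[mu]_x G x = \int[mu]_(x in `[- a, a]) G x.
Proof.
move=> cG G0.
have patchG : G \_ `[- a, a] = G.
  apply/funext => x; rewrite patchE; case: ifPn => //.
  rewrite notin_setE /= in_itv/= -ler_norml => /negP; rewrite -ltNge => ax.
  by rewrite G0.
split; last by rewrite [RHS]Rintegral_mkcond patchG.
have mB : measurable (`[- a, a]%classic : set (measurableTypeR R)) by exact: measurable_itv.
have := (@integrable_mkcond _ _ _ mu _ (EFin \o G) mB).1 (continuous_itv_integrable (- a) a cG).
apply: eq_integrable => // x _.
have := congr1 (fun h => h x) patchG; rewrite /= !patchE.
by case: ifP => // _ /= <-.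
Qed.

Section scaled.
Variables (f : R -> R) (fb : smooth_bump f) (c : R) (c0 : 0 < c).

Lemma continuous_scaled : continuous (fun x => f (x / c)).
Proof.
have H x := is_derive_scale c^-1 0 x (fun x => smooth_bump_derive 0 x fb).
have := is_derive_continuous H.
have -> : (fun x => derive1n 0 f (c^-1 * x + 0)) = fun x => f (x / c).
  by apply/funext => z; rewrite addr0 mulrC.
by [].
Qed.

Lemma scaled_osc (h : R -> R) : continuous h ->
  mu.-integrable setT (EFin \o (fun x => f (x / c) * h x)) /\
  \int[mu]_x (f (x / c) * h x) = c * \int[mu]_(x in `[-2, 2]) (f x * h (c * x)).
Proof.
move=> ch; have cG : continuous (fun x => f (x / c) * h x).
  by apply: continuousMf => //; exact: continuous_scaled.
have [|i1 ->] := @integrable_compact_support (fun x => f (x / c) * h x) (c * 2) cG.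
  move=> x cx; have [_ ->] := fb; first by rewrite mul0r.
  rewrite normrM normfV (ger0_norm (ltW c0)) ltr_pdivlMr//.
  by apply: le_lt_trans cx; rewrite mulrC ler_pM2l//; lra.
split => //.
pose F x := c * x.
have Fd x : is_derive x 1 F c.
  by have := is_deriveZf c (is_derive_id x 1); move/is_derive_eq; apply; rewrite mulr1.
have F1 : F^`()%classic = cst c.
  by apply/funext => x; rewrite derive1E; have := Fd x => H; exact: derive_val.
have cF := is_derive_continuous Fd.
have sub := @integration_by_substitution_increasing R F (fun x => f (x / c) * h x) (-2) 2.
have Fm : F (-2) = - (c * 2) by rewrite /F mulrN.
have Fp : F 2 = c * 2 by [].
rewrite Fm Fp in sub; rewrite [LHS]/Rintegral sub.
- rewrite -RintegralZl//; last first.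
    apply: continuous_itv_integrable; apply: continuousMf.
      exact: smooth_bump_continuous.
    by move=> x; apply: continuous_comp (cF x) (ch _).
  rewrite /Rintegral; congr fine; apply: eq_integral => x _.
  congr EFin; rewrite F1.
  change (f (c * x / c) * h (c * x) * c = c * (f x * h (c * x))).
  have -> : c * x / c = x by rewrite mulrAC divff ?gt_eqF// mul1r.
  by ring.
- by lra.
- by move=> x y _ _ xy; rewrite /F ltr_pM2l.
- by rewrite -/F F1 => x _; exact: cvg_cst.
- by rewrite -/F F1; exact: is_cvg_cst.
- by rewrite -/F F1; exact: is_cvg_cst.
- split; first by move=> x _; have := Fd x => H; exact: ex_derive.
    by apply: cvg_at_right_filter; exact: cF.
  by apply: cvg_at_left_filter; exact: cF.
- by apply: continuous_subspaceT.
Qed.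

End scaled.

Lemma good_kernel_lin (a c : R) (k k1 l l1 : R -> R) (Ck Cl : R) :
  good_kernel k k1 Ck -> good_kernel l l1 Cl ->
  good_kernel (fun u => a * k u + c * l u) (fun u => a * k1 u + c * l1 u)
    (`|a| * Ck + `|c| * Cl).
Proof.
move=> [kd k0 k1b] [ld l0 l1b]; split => u.
- exact: is_deriveDf (is_deriveZf a (kd u)) (is_deriveZf c (ld u)).
- rewrite (le_trans (ler_normD _ _))// !normrM mulrDl -!mulrA.
  by apply: lerD; apply: ler_wpM2l.
- rewrite (le_trans (ler_normD _ _))// !normrM mulrDl -!mulrA.
  by apply: lerD; apply: ler_wpM2l.
Qed.

Lemma good_kernel_le (k k1 : R -> R) (C C' : R) : C <= C' ->
  good_kernel k k1 C -> good_kernel k k1 C'.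
Proof.
move=> CC [kd k0 k1b]; split => // u.
- by rewrite (le_trans (k0 u))// ler_wpM2r// exprn_ge0// ltW// lorentz_gt0.
- by rewrite (le_trans (k1b u))// ler_wpM2r// ltW// lorentz_gt0.
Qed.

(* The kernel of phi_k rescaled by 2^k, when g is the kernel of phi_0. *)
Definition bandpass (k : nat) (g : R -> R) (u : R) : R :=
  if k is 0%N then g u else g u - g (u / 2) / 2.

(** For k > 0, phi_k is a difference of two dilates of phi_0, and replacing phi(x) by phi(x / c)
    replaces the kernel K(u) by c K(c u). One pair of real kernels, for the real and the imaginary
    part, therefore serves all k. *)
Lemma cutoff_kernel phi0 : dyadic_cutoff phi0 ->
  exists kre kre1 kim kim1 C,
    [/\ good_kernel kre kre1 C, good_kernel kim kim1 C &
     forall k, cintegrable mu (phi1 phi0 k) /\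
       forall u, kern (phi1 phi0 k) u =
         (2 ^+ k * bandpass k kre (2 ^+ k * u)) +i* (2 ^+ k * bandpass k kim (2 ^+ k * u))].
Proof.
move=> /cutoff_bump [fb1 fb2].
set f1 := (fun x => complex.Re (phi0 x)) in fb1; set f2 := (fun x => complex.Im (phi0 x)) in fb2.
have [[c1 [C1 g1]] [s1 [D1 h1]]] := osc_good fb1.
have [[c2 [C2 g2]] [s2 [D2 h2]]] := osc_good fb2.
pose a : R := (2 * pi)^-1.
(* Signs as in the product of f1 + i f2 with cos + i sin: the real part is f1 cos - f2 sin, the
   imaginary part f1 sin + f2 cos. *)
have gre := good_kernel_lin a (- a) g1 h2.
have gim := good_kernel_lin a a h1 g2.
do 4 eexists; exists (Num.max (`|a| * C1 + `|- a| * D2) (`|a| * D1 + `|a| * C2)).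
split.
- by apply: good_kernel_le gre; rewrite le_max lexx.
- by apply: good_kernel_le gim; rewrite le_max lexx orbT.
have dil c u : 0 < c -> cintegrable mu (fun x => phi0 (x / c)) /\
    kern (fun x => phi0 (x / c)) u =
    (c * (a * cosI f1 (c * u) + - a * sinI f2 (c * u))) +i*
    (c * (a * sinI f1 (c * u) + a * cosI f2 (c * u))).
  move=> c0.
  have [i11 e11] := scaled_osc fb1 c0 (@continuous_cosM R u).
  have [i12 e12] := scaled_osc fb1 c0 (@continuous_sinM R u).
  have [i21 e21] := scaled_osc fb2 c0 (@continuous_cosM R u).
  have [i22 e22] := scaled_osc fb2 c0 (@continuous_sinM R u).
  have cst1 : continuous (fun _ : R => 1 : R) by move=> x; exact: cvg_cst.
  split.
    have [j1 _] := scaled_osc fb1 c0 cst1; have [j2 _] := scaled_osc fb2 c0 cst1.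
    split; [apply: eq_integrable j1 => // x _|apply: eq_integrable j2 => // x _];
      by rewrite /= mulr1.
  have oscE (g : R -> R) (h : R -> R) : \int[mu]_(x in `[-2, 2]) (g x * h (u * (c * x))) =
     \int[mu]_(x in `[-2, 2]) (g x * h (c * u * x)).
    by apply: eq_Rintegral => x _; rewrite mulrA [u * c]mulrC.
  rewrite oscE in e11; rewrite oscE in e12; rewrite oscE in e21; rewrite oscE in e22.
  rewrite -/(cosI f1 (c * u)) in e11; rewrite -/(sinI f1 (c * u)) in e12.
  rewrite -/(cosI f2 (c * u)) in e21; rewrite -/(sinI f2 (c * u)) in e22.
  rewrite /kern -/a; apply: complex_eq; rewrite ?ReM ?ImM /= !mul0r ?subr0 ?addr0.
    transitivity (a * (\int[mu]_x (f1 (x / c) * cos (u * x)) - \int[mu]_x (f2 (x / c) * sin (u * x)))).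
      congr (_ * _); rewrite -RintegralB//; apply: eq_Rintegral => x _.
      by rewrite ReM.
    by rewrite e11 e22; ring.
  transitivity (a * (\int[mu]_x (f1 (x / c) * sin (u * x)) + \int[mu]_x (f2 (x / c) * cos (u * x)))).
    congr (_ * _); rewrite -RintegralD//; apply: eq_Rintegral => x _.
    by rewrite ImM.
  by rewrite e12 e21; ring.
move=> [|k].
  have phiE : phi1 phi0 0 = fun x => phi0 (x / 1) by apply/funext => x /=; rewrite divr1.
  rewrite phiE; split=> [|u]; first exact: (dil 1 0 ltr01).1.
  by rewrite (dil 1 u ltr01).2 expr0 !mul1r.
have p1 : (0 : R) < 2 ^+ k.+1 by rewrite exprn_gt0.
have p0 : (0 : R) < 2 ^+ k by rewrite exprn_gt0.
have [i1 _] := dil _ 0 p1; have [i0 _] := dil _ 0 p0.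
have phiE : phi1 phi0 k.+1 = fun x => phi0 (x / 2 ^+ k.+1) + (-1) * phi0 (x / 2 ^+ k).
  by apply/funext => x; rewrite mulN1r.
rewrite phiE; split=> [|u].
  by apply: cintegrableD => //; exact: cintegrableZ.
have -> : kern (fun x => phi0 (x / 2 ^+ k.+1) + -1 * phi0 (x / 2 ^+ k)) u =
    kern (fun x => phi0 (x / 2 ^+ k.+1)) u - kern (fun x => phi0 (x / 2 ^+ k)) u.
  have m1 := cintegrable_modulated u i1; have m0 := cintegrable_modulated u i0.
  rewrite /kern -mulrBr -[- cint _ _]mulN1r -(cintZ _ m0) -(cintD m1 (cintegrableZ _ m0)).
  by congr (_ * _); apply: eq_cint => x; rewrite mulrDl mulrA.
rewrite (dil _ u p1).2 (dil _ u p0).2 /bandpass.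
have -> : 2 ^+ k.+1 * u / 2 = 2 ^+ k * u by rewrite exprS; field.
by apply: complex_eq => /=; rewrite exprS; field.
Qed.

End kernel_of_cutoff.

(** * Faber expansion *)

Section faber.
Variables (R : realType) (b : nat).
Hypothesis b_gt0 : (0 < b)%N.
Variable f : R -> R[i].
Implicit Types (x z l r : R) (a c p : nat).

Definition node a c : R := c%:R / b%:R ^+ a.

Definition chord (l r x : R) : R[i] := f l + (f r - f l) * ((x - l) / (r - l))%:C.

(** The index is shifted: [faber_rest a] measures the deviation from the chord over an interval of
    level a - 1. It is what is left after the levels 0, ..., a - 1 have been removed. *)
Definition faber_rest a p x : R[i] := f x - chord (node a.-1 p) (node a.-1 p.+1) x.

(* Values of the level-a Faber component of f at the two endpoints of the
   b-adic interval number c of level a *)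
Definition faberL a c : R[i] :=
  if a is 0%N then f 0 else faber_rest a (c %/ b) (node a c).
Definition faberR a c : R[i] :=
  if a is 0%N then f 1 else faber_rest a (c %/ b) (node a c.+1).

Let bR0 : b%:R != 0 :> R.
Proof. by rewrite pnatr_eq0 -lt0n. Qed.

Let bX0 a : b%:R ^+ a != 0 :> R.
Proof. exact: expf_neq0. Qed.

Lemma node_diff a p : node a p.+1 - node a p = (b%:R ^+ a)^-1.
Proof. by rewrite /node -natr1; field; exact: bX0. Qed.

Lemma chord_node a p x : chord (node a p) (node a p.+1) x =
  f (node a p) + (f (node a p.+1) - f (node a p)) * (b%:R ^+ a * x - p%:R)%:C.
Proof.
by rewrite /chord node_diff; congr (_ + _ * _%:C); rewrite /node; field; rewrite bX0.
Qed.

(** The level a + 1 component is the linear interpolant of the rest on the cell [c]. The coarse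
    chord is affine on that cell, so it equals its own interpolant and only the interpolant of f
    changes. *)
Lemma faber_step a z : let c := cell b a.+1 z in
  cell b a z = (c %/ b)%N ->
  faber_rest a.+1 (cell b a z) z =
  faberL a.+1 c + (faberR a.+1 c - faberL a.+1 c) * (b%:R ^+ a.+1 * z - c%:R)%:C +
  faber_rest a.+2 c z.
Proof.
move=> c cE; rewrite /faberL /faberR cE /faber_rest /= !chord_node.
set p := (c %/ b)%N; set A := f (node a p); set B := f (node a p.+1).
set X := f (node a.+1 c); set Y := f (node a.+1 c.+1).
have -> : (b%:R ^+ a * z - p%:R)%:C = (b%:R ^+ a * node a.+1 c - p%:R)%:C +
    ((b%:R ^+ a * node a.+1 c.+1 - p%:R) - (b%:R ^+ a * node a.+1 c - p%:R))%:C *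
    (b%:R ^+ a.+1 * z - c%:R)%:C :> R[i].
  rewrite -rmorphM -rmorphD; congr (_%:C); rewrite /node -natr1 exprS; field.
  by rewrite bX0 bR0.
rewrite [in X in X * _%:C](rmorphB (real_complex R)); ring.
Qed.

Lemma faber_decomposition J z : 0 <= z < 1 ->
  (forall a, cell b a z = (cell b a.+1 z %/ b)%N) ->
  f z = \sum_(a < J.+1) (faberL a (cell b a z) +
    (faberR a (cell b a z) - faberL a (cell b a z)) *
    (b%:R ^+ a * z - (cell b a z)%:R)%:C) + faber_rest J.+1 (cell b J z) z.
Proof.
move=> z01 cE; elim: J => [|J IH].
  rewrite big_ord_recl big_ord0 addr0 /=.
  have -> : cell b 0 z = 0%N by apply: truncn_def; rewrite expr0 mul1r.
  rewrite /faber_rest chord_node /node expr0 !divr1 !mul1r subr0.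
  by ring.
by rewrite {1}IH [in RHS]big_ord_recr /= -[RHS]addrA; congr (_ + _); exact: faber_step (cE J).
Qed.

Definition faber_mean a : R[i] :=
  (b ^ a)%:R^-1 * \sum_(0 <= c < b ^ a) (faberL a c + (faberR a c - faberL a c) / 2).

Definition trapezoid a : R[i] :=
  (b ^ a)%:R^-1 * \sum_(0 <= c < b ^ a) ((f (node a c) + f (node a c.+1)) / 2).

(** A Faber component is the difference of two consecutive piecewise linear interpolants of f, and
    the mean of an interpolant is the trapezoidal sum. The work lies in rewriting the coarse sum on
    the b children of each interval. *)
Lemma faber_mean_trapezoid a : faber_mean a.+1 = trapezoid a.+1 - trapezoid a.
Proof.
have bC0 : b%:R != 0 :> R[i] by rewrite pnatr_eq0 -lt0n.
have bCa : (b ^ a)%:R != 0 :> R[i] by rewrite natrX expf_neq0.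
rewrite /faber_mean /trapezoid.
have -> : (b ^ a)%:R^-1 * \sum_(0 <= c < b ^ a) ((f (node a c) + f (node a c.+1)) / 2) =
    (b ^ a.+1)%:R^-1 * \sum_(0 <= c < b ^ a.+1)
     ((chord (node a (c %/ b)) (node a (c %/ b).+1) (node a.+1 c) +
      chord (node a (c %/ b)) (node a (c %/ b).+1) (node a.+1 c.+1)) / 2).
  rewrite expnS sum_nat_mul natrM invfM [b%:R^-1 * _]mulrC -mulrA; congr (_ * _).
  apply: (mulfI bC0); rewrite mulVKf// mulr_sumr; apply: eq_bigr => p _.
  set A := f (node a p); set B := f (node a p.+1).
  transitivity (\sum_(0 <= k < b) (A + (B - A) * ((k%:R + k.+1%:R) / (2 * b%:R)))); last first.
    rewrite big_nat [RHS]big_nat; apply: eq_bigr => k /andP[_ kb].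
    rewrite mulnC divnMDl// (divn_small kb) addn0 !chord_node -/A -/B.
    have nE (m : nat) : (b%:R ^+ a * node a.+1 (p * b + m) - p%:R)%:C = m%:R / b%:R :> R[i].
      rewrite /node natrD natrM exprS.
      have -> : b%:R ^+ a * ((p%:R * b%:R + m%:R) / (b%:R * b%:R ^+ a)) - p%:R = m%:R / b%:R :> R.
        by field; rewrite bX0 bR0.
      by rewrite rmorphM fmorphV !rmorph_nat.
    by rewrite -addnS !nE; field; rewrite bC0.
  rewrite big_split /= sumr_const_nat subn0 -mulr_sumr -mulr_suml.
  (* The first b odd numbers add up to b^2, so the mean of the coarse chord over the children is the
     mean of its end values. *)
  have -> : \sum_(0 <= k < b) (k%:R + k.+1%:R) = b%:R * b%:R :> R[i].
    elim: (b) => [|k IH]; first by rewrite big_geq// mul0r.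
    by rewrite big_nat_recr//= IH -!natr1; ring.
  by rewrite -mulr_natl; field.
rewrite -mulrBr -sumrB; congr (_ * _); apply: eq_bigr => c _.
by rewrite /faberL /faberR /faber_rest /=; field.
Qed.

Lemma sum_faber_mean J : \sum_(a < J.+1) faber_mean a = trapezoid J.
Proof.
elim: J => [|J IH].
  rewrite big_ord_recl big_ord0 addr0 /faber_mean /trapezoid expn0 !big_nat1 /=.
  by rewrite /node expr0 !divr1; congr (_ * _); field.
by rewrite big_ord_recr /= IH faber_mean_trapezoid addrC subrK.
Qed.

End faber.

(** * Errors of linear interpolation and of the trapezoidal rule *)

Section real_interpolation.
Context {R : realType}.
Implicit Types (g : R -> R) (l r x M : R).

(** The error is x - l times the difference of two values of g', both taken in [l, r]; a second
    application of the mean value theorem bounds that difference by M (r - l). The constant 1 is not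
    sharp. *)
Lemma interpolation_error g (g1 g2 : R -> R) l r M : l < r ->
  (forall x, is_derive x 1 g (g1 x)) -> (forall x, is_derive x 1 g1 (g2 x)) ->
  (forall x, l <= x <= r -> `|g2 x| <= M) ->
  forall x, l <= x <= r ->
  `|g x - (g l + (g r - g l) * ((x - l) / (r - l)))| <= M * (r - l) ^+ 2.
Proof.
move=> lr gd g1d g2M x /andP[lx xr].
have [xi1 /andP[a1 a2] e1] := MVT_total lx gd.
have [xi2 /andP[c1 c2] e2] := MVT_total (ltW lr) gd.
have rl0 : r - l != 0 by rewrite subr_eq0 gt_eqF.
have -> : g x - (g l + (g r - g l) * ((x - l) / (r - l))) = (g1 xi1 - g1 xi2) * (x - l).
  by rewrite e2 opprD addrA e1; field.
have M0 : 0 <= M by apply: le_trans (g2M l _); rewrite ?lexx ?(ltW lr).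
have g1L (u w : R) : l <= u -> u <= w -> w <= r -> `|g1 w - g1 u| <= M * (r - l).
  move=> lu uw wr; have [xi /andP[d1 d2] ->] := MVT_total uw g1d.
  rewrite normrM; apply: ler_pM => //; first by apply: g2M; lra.
  by rewrite ger0_norm; lra.
rewrite normrM expr2 mulrA; apply: ler_pM => //; last by rewrite ger0_norm; lra.
case: (leP xi1 xi2) => [h|/ltW h]; first by rewrite distrC; apply: g1L => //; lra.
by apply: g1L => //; lra.
Qed.

(** [Q] is a primitive of the chord, whose increment over [l, r] is the trapezoidal value; the mean
    value theorem is applied to [Phi - Q]. *)
Lemma trapezoid_error (Phi g : R -> R) l r eps : l < r ->
  (forall x, is_derive x 1 Phi (g x)) ->
  (forall x, l <= x <= r ->
    `|g x - (g l + (g r - g l) * ((x - l) / (r - l)))| <= eps) ->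
  `|Phi r - Phi l - (r - l) * ((g l + g r) / 2)| <= (r - l) * eps.
Proof.
move=> lr Pd ge; have rl0 : r - l != 0 by rewrite subr_eq0 gt_eqF.
pose Q x := g l * x + (g r - g l) / (r - l) * ((x - l) * (x - l) / 2).
have id1 (x : R) : is_derive x 1 (fun x : R => x - l) 1.
  by have := is_deriveBf (is_derive_id x 1) (is_derive_cst l x 1); rewrite subr0.
have Qd x : is_derive x 1 Q (g l + (g r - g l) * ((x - l) / (r - l))).
  have H := is_deriveDf (is_deriveZf (g l) (is_derive_id x 1))
    (is_deriveZf ((g r - g l) / (r - l) / 2) (is_deriveMf (id1 x) (id1 x))).
  have -> : Q = fun x => g l * x + (g r - g l) / (r - l) / 2 * ((x - l) * (x - l)).
    by apply/funext => z; rewrite /Q; field.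
  by move/is_derive_eq: H; apply; field.
have [xi xi_lr E] := MVT_total (ltW lr) (fun x => is_deriveBf (Pd x) (Qd x)).
have -> : Phi r - Phi l - (r - l) * ((g l + g r) / 2) = (Phi r - Q r) - (Phi l - Q l).
  by rewrite /Q; field.
rewrite E normrM mulrC [X in X * _]ger0_norm; last by rewrite subr_ge0 ltW.
by apply: ler_wpM2l; [rewrite subr_ge0 ltW|exact: ge].
Qed.

End real_interpolation.

Section profiles.
Context {R : realType}.
Implicit Types (u y z : R) (F G H Om : R -> R).

(** A Peetre-type inequality, from u'^2 <= 2 u^2 + 2 D^2. *)
Lemma lorentz_shift (D u u' : R) : `|u - u'| <= D ->
  lorentz u <= (2 + 2 * D ^+ 2) * lorentz u'.
Proof.
move=> uD; have p := lorentz_den_gt0 u; have p' := lorentz_den_gt0 u'.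
rewrite /lorentz ler_pdivlMr// mulrC ler_pdivrMr//.
have h : (u - u') ^+ 2 <= D ^+ 2.
  by rewrite -[leLHS]real_normK ?num_real// ler_pXn2r// nnegrE (le_trans _ uD).
have := sqr_ge0 (2 * u - u'); have := sqr_ge0 D; have := sqr_ge0 u; nra.
Qed.

Lemma lorentz_half u : lorentz (u / 2) <= 4 * lorentz u.
Proof.
have p := lorentz_den_gt0 u; have p' := lorentz_den_gt0 (u / 2).
rewrite /lorentz ler_pdivlMr// mulrC ler_pdivrMr//; nra.
Qed.

(* F is a primitive of the kernel G, H its derivative, and Om a primitive of F.
   For k = 0 the kernel has a non-zero integral, so that F does not decay; its
   increments over unit intervals do. *)
Definition profile (k : nat) F G H Om (C : R) :=
  [/\ forall u, is_derive u 1 F (G u), forall u, is_derive u 1 G (H u),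
      forall u, is_derive u 1 Om (F u), forall u, `|H u| <= C * lorentz u &
      if k is 0%N then forall u, `|F u - F (u - 1)| <= C * lorentz u
      else forall u, `|F u| <= C * lorentz u].

Lemma good_kernel_ge0 (g g1 : R -> R) C : good_kernel g g1 C -> 0 <= C.
Proof.
move=> [_ _ /(_ 0)]; move/(le_trans (normr_ge0 _)).
by rewrite pmulr_lge0// lorentz_gt0.
Qed.

Lemma is_derive_halve F G u : (forall u, is_derive u 1 F (G u)) ->
  is_derive u 1 (fun u => F (u / 2)) (G (u / 2) / 2).
Proof.
move=> Fd; have := is_derive_scale 2^-1 0 u Fd.
have -> : (fun x => F (2^-1 * x + 0)) = fun x => F (x / 2).
  by apply/funext => x; rewrite addr0 mulrC.
by move/is_derive_eq; apply; rewrite addr0 mulrC [2^-1 * u]mulrC.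
Qed.

(** For k > 0 the primitive is Psi(u) - Psi(u/2), with Psi a primitive of g, so that the limits of
    Psi at infinity cancel. By the mean value theorem it is |g(xi)| |u/2| for some xi beyond u/2,
    and one of the two Lorentz factors of g absorbs |u/2|. For k = 0 only increments over unit
    intervals are estimated. *)
Lemma band_profile (g g1 : R -> R) C (k : nat) : good_kernel g g1 C ->
  exists F H Om, profile k F (bandpass k g) H Om (4 * C).
Proof.
move=> gk; have C0 := good_kernel_ge0 gk; have [gd g0 g1b] := gk.
have [Psi Psid] := antiderivative (is_derive_continuous gd).
have gle u : `|g u| <= C * lorentz u.
  rewrite (le_trans (g0 u))// ler_wpM2l// expr2.
  by apply: ler_piMr; [exact/ltW/lorentz_gt0|exact: lorentz_le1].
have l0 u := ltW (@lorentz_gt0 R u).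
case: k => [|k].
  have [Om Omd] := antiderivative (is_derive_continuous Psid).
  exists Psi, g1, Om; split => // u.
    by rewrite (le_trans (g1b u))// ler_wpM2r// ler_peMl//; lra.
  have [xi /andP[x1 x2]] := @MVT_total R Psi g (u - 1) u (ltac:(lra)) Psid.
  rewrite [u - (u - 1)](_ : _ = 1) ?mulr1 => [->|]; last by ring.
  rewrite (le_trans (gle xi))// [4 * C]mulrC -mulrA ler_wpM2l//.
  apply: le_trans (@lorentz_shift 1 xi u _) _; first by rewrite ler_norml; apply/andP; split; lra.
  by rewrite expr1n; apply: ler_wpM2r => //; lra.
pose F u := Psi u - Psi (u / 2); pose H u := g1 u - g1 (u / 2) / 2 / 2.
have Fd u : is_derive u 1 F (bandpass k.+1 g u).
  exact: is_deriveBf (Psid u) (is_derive_halve u Psid).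
have Gd u : is_derive u 1 (bandpass k.+1 g) (H u).
  have := is_deriveBf (gd u) (is_deriveZf 2^-1 (is_derive_halve u gd)).
  have -> : (fun x => g x - 2^-1 * g (x / 2)) = bandpass k.+1 g.
    by apply/funext => x; rewrite /= mulrC.
  by move/is_derive_eq; apply; rewrite /H; field.
have [Om Omd] := antiderivative (is_derive_continuous Fd).
exists F, H, Om; split => // u.
  rewrite /H (le_trans (ler_normB _ _))//.
  have h1 := g1b u; have h2 := g1b (u / 2); have h3 := lorentz_half u.
  rewrite -mulrA normrM [X in _ * X]ger0_norm//.
  have h4 : C * lorentz (u / 2) <= C * (4 * lorentz u) by rewrite ler_wpM2l.
  have h5 : 0 <= C * lorentz u by rewrite mulr_ge0.
  nra.
have mid : exists2 xi, `|u / 2| <= `|xi| & `|F u| = `|g xi| * `|u / 2|.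
  case: (leP 0 u) => u0.
    have [xi /andP[x1 x2] e] := @MVT_total R Psi g (u / 2) u (ltac:(lra)) Psid.
    exists xi; first by rewrite !ger0_norm; lra.
    by rewrite /F e normrM; have -> : u - u / 2 = u / 2 by field.
  have [xi /andP[x1 x2] e] := @MVT_total R Psi g u (u / 2) (ltac:(lra)) Psid.
  exists xi; first by rewrite !ler0_norm; lra.
  have uE : u / 2 - u = - (u / 2) by field.
  by rewrite /F distrC e normrM uE normrN.
have [xi xil ->] := mid.
have lxi : lorentz xi <= lorentz (u / 2).
  rewrite /lorentz lef_pV2 ?posrE ?lorentz_den_gt0// lerD2l.
  by rewrite -[leLHS]real_normK ?num_real// -[leRHS]real_normK ?num_real// ler_pXn2r// nnegrE.
have gx : `|g xi| <= C * lorentz (u / 2) ^+ 2.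
  by rewrite (le_trans (g0 xi))// ler_wpM2l// ler_pXn2r// nnegrE.
have le1 : lorentz (u / 2) * `|u / 2| <= 1.
  have p := lorentz_den_gt0 (u / 2).
  rewrite /lorentz mulrC ler_pdivrMr// mul1r -[X in 1 + X]real_normK ?num_real//.
  have := sqr_ge0 (`|u / 2| - 1); nra.
apply: (@le_trans _ _ (C * lorentz (u / 2) ^+ 2 * `|u / 2|)); first by rewrite ler_wpM2r.
rewrite expr2 -!mulrA [4 * _]mulrCA ler_wpM2l//.
rewrite (le_trans (ler_wpM2l (l0 _) le1))// mulr1.
exact: lorentz_half.
Qed.

End profiles.

(** * Faber coefficients of the responses *)

Section faber_estimates.
Variables (R : realType) (b k : nat).
Hypothesis b_gt1 : (1 < b)%N.
Variables (Fr Gr Hr Or Fi Gi Hi Oi : R -> R) (C : R).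
Hypothesis C_ge0 : 0 <= C.
Hypothesis profr : profile k Fr Gr Hr Or C.
Hypothesis profi : profile k Fi Gi Hi Oi C.
Variable y : R.
Local Notation s := (2 ^+ k : R).
Let b_gt0 := ltnW b_gt1.

(** The integral over [z, 1] of the kernel 2^k G(2^k (y - t)), written through the primitive F of G;
    it vanishes at z = 1. *)
Definition step_response (z : R) : R[i] :=
  (Fr (s * (y - z)) - Fr (s * (y - 1))) +i* (Fi (s * (y - z)) - Fi (s * (y - 1))).

(** [lorentz_shift] with D = b gives 2 + 2 b^2; comparing the parent length b^-a with b^-(a+1) in
    the squared interpolation error gives b^2; the real and the imaginary part give another 2. *)
Definition weight_constant : R := 4 * C * (1 + b%:R ^+ 2) * b%:R ^+ 2.

Definition fine_level a := (0 < a)%N && (2 ^ k <= b ^ a)%N.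

(* When 2^k <= b^a the response is smooth at the scale of the interval and the
   weight is that of the second order interpolation error; otherwise only the
   decay of the response at the nodes is used. *)
Definition faber_weight (a c : nat) : R := weight_constant *
  (if fine_level a then
    (s / b%:R ^+ a) ^+ 2 * lorentz (s * (y - node R b a c))
   else lorentz (s * (y - node R b a c)) + lorentz (s * (y - node R b a c.+1)) +
     (lorentz (s * (y - node R b a.-1 (c %/ b))) +
      lorentz (s * (y - node R b a.-1 (c %/ b).+1)))).

Let s_gt0 : 0 < s. Proof. by rewrite exprn_gt0. Qed.
Let bR_ge1 : 1 <= b%:R :> R. Proof. by rewrite ler1n. Qed.
Let bX_gt0 a : 0 < b%:R ^+ a :> R.
Proof. by rewrite exprn_gt0// ltr0n. Qed.
Let l0 (u : R) : 0 <= lorentz u := ltW (lorentz_gt0 u).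

Lemma weight_constant_ge : 8 * C <= weight_constant.
Proof.
have b2 : 1 <= b%:R ^+ 2 :> R by rewrite exprn_ege1.
rewrite /weight_constant; set B := b%:R ^+ 2 in b2 *.
have : 0 <= C * (B - 1) by rewrite mulr_ge0// subr_ge0.
have : 0 <= C * (B - 1) * (B - 1) by rewrite !mulr_ge0// subr_ge0.
nra.
Qed.

Lemma weight_constant_ge0 : 0 <= weight_constant.
Proof. by apply: le_trans weight_constant_ge; rewrite mulr_ge0. Qed.

Lemma faber_weight_ge0 a c : 0 <= faber_weight a c.
Proof.
have W0 := weight_constant_ge0; rewrite /faber_weight; apply: mulr_ge0 => //; case: ifP => _.
  by apply: mulr_ge0; [exact: sqr_ge0|exact: l0].
by apply: addr_ge0; apply: addr_ge0; exact: l0.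
Qed.

Lemma node_le a c : node R b a c <= node R b a c.+1.
Proof. by rewrite /node ler_pM2r ?invr_gt0// ler_nat. Qed.

Lemma node_parent a c : node R b a (c %/ b) <= node R b a.+1 c /\
  node R b a.+1 c.+1 <= node R b a (c %/ b).+1.
Proof.
rewrite /node exprS invfM !mulrA; split.
  rewrite ler_pM2r ?invr_gt0// ler_pdivlMr ?ltr0n// -natrM ler_nat.
  exact: leq_trunc_div.
rewrite ler_pM2r ?invr_gt0// ler_pdivrMr ?ltr0n// -natrM ler_nat.
by rewrite ltn_ceil.
Qed.

Definition fine_eps (a c : nat) : R :=
  weight_constant / 2 * ((s / b%:R ^+ a) ^+ 2 * lorentz (s * (y - node R b a c))).

(** The second derivative of the response is s^2 H(s(y - x)). On a fine level the parent interval
    has length at most b in the variable s x, so the Lorentz value at one node of the child [c]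
    represents the whole parent up to a constant. *)
Lemma fine_real F G H Om a c (F' := fun z => F (s * (y - z)) - F (s * (y - 1))) :
  profile k F G H Om C -> (2 ^ k <= b ^ a.+1)%N ->
  forall x, node R b a (c %/ b) <= x <= node R b a (c %/ b).+1 ->
  `|F' x - (F' (node R b a (c %/ b)) + (F' (node R b a (c %/ b).+1) - F' (node R b a (c %/ b))) *
     ((x - node R b a (c %/ b)) / (node R b a (c %/ b).+1 - node R b a (c %/ b))))| <= fine_eps a.+1 c.
Proof.
move=> [Fd Gd _ Hb _] fine; set l := node _ _ _ _; set r := node _ _ _ _.
have lr : l < r by rewrite /l /r /node ltr_pM2r ?invr_gt0// ltr_nat.
have F'd (x : R) : is_derive x 1 F' (- s * G (s * (y - x))).
  have := is_deriveBf (is_derive_scale (- s) (s * y) x Fd) (is_derive_cst (F (s * (y - 1))) x 1).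
  have -> : (fun x => F (- s * x + s * y) - cst (F (s * (y - 1))) x) = F'.
    by apply/funext => z; rewrite /F' /cst; congr (F _ - _); ring.
  by move/is_derive_eq; apply; rewrite subr0; congr (_ * G _); ring.
have F'dd (x : R) : is_derive x 1 (fun x => - s * G (s * (y - x))) (s ^+ 2 * H (s * (y - x))).
  have := is_deriveZf (- s) (is_derive_scale (- s) (s * y) x Gd).
  have -> : (fun x => - s * G (- s * x + s * y)) = (fun x => - s * G (s * (y - x))).
    by apply/funext => z; congr (_ * G _); ring.
  have -> : - s * x + s * y = s * (y - x) by ring.
  by move/is_derive_eq; apply; ring.
have rlE : r - l = (b%:R ^+ a)^-1 by rewrite /r /l node_diff.
have [pl pr] := node_parent a c; rewrite -/l -/r in pl pr.
have sb : s * (r - l) <= b%:R.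
  rewrite rlE ler_pdivrMr// -exprS.
  by move: fine; rewrite -(ler_nat R) !natrX.
have M2 (x : R) : l <= x <= r -> `|s ^+ 2 * H (s * (y - x))| <=
    s ^+ 2 * (C * ((2 + 2 * b%:R ^+ 2) * lorentz (s * (y - node R b a.+1 c)))).
  move=> /andP[lx xr]; rewrite normrM ger0_norm; last exact: sqr_ge0.
  apply: ler_wpM2l; first exact: sqr_ge0.
  apply: le_trans (Hb _) _; apply: ler_wpM2l => //; apply: lorentz_shift.
  have -> : s * (y - x) - s * (y - node R b a.+1 c) = s * (node R b a.+1 c - x) by ring.
  rewrite normrM ger0_norm ?(ltW s_gt0)//; apply: le_trans sb; apply: ler_wpM2l; first exact: ltW.
  have := node_le a.+1 c; rewrite ler_norml => h; apply/andP; split; lra.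
move=> x xlr; apply: le_trans (interpolation_error lr F'd F'dd M2 xlr) _.
rewrite rlE /fine_eps /weight_constant le_eqVlt; apply/orP; left; apply/eqP.
rewrite [b%:R ^+ a.+1]exprS; field.
by rewrite !gt_eqF// ltr0n.
Qed.

Lemma rest_ReIm a p x : let t := (x - node R b a p) / (node R b a p.+1 - node R b a p) in
  complex.Re (faber_rest b step_response a.+1 p x) =
   complex.Re (step_response x) - (complex.Re (step_response (node R b a p)) +
    (complex.Re (step_response (node R b a p.+1)) - complex.Re (step_response (node R b a p))) * t) /\
  complex.Im (faber_rest b step_response a.+1 p x) =
   complex.Im (step_response x) - (complex.Im (step_response (node R b a p)) +
    (complex.Im (step_response (node R b a p.+1)) - complex.Im (step_response (node R b a p))) * t).
Proof.
rewrite /faber_rest /chord /=; set t := _ / _.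
by split; rewrite /= ?mulr0 ?subr0 ?add0r ?addr0.
Qed.

Lemma rest_fine a c x : fine_level a.+1 ->
  node R b a (c %/ b) <= x <= node R b a (c %/ b).+1 ->
  normc (faber_rest b step_response a.+1 (c %/ b) x) <= faber_weight a.+1 c.
Proof.
move=> fl xlr; have /andP[_ fine] := fl.
rewrite (le_trans (normc_le_ReIm _))//.
have [-> ->] := rest_ReIm a (c %/ b) x.
have -> : faber_weight a.+1 c = fine_eps a.+1 c + fine_eps a.+1 c.
  by rewrite /faber_weight fl /fine_eps; field; rewrite gt_eqF.
by apply: lerD; [exact: (fine_real profr fine)|exact: (fine_real profi fine)].
Qed.

(** The deviation from a chord does not see constants: [K] stands for the value at the end point 1
    that is subtracted in the response, and it drops out. *)
Lemma chord_bound (X L Q t K : R) : 0 <= t <= 1 ->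
  `|X - K - (L - K + (Q - K - (L - K)) * t)| <= `|X| + `|L| + `|Q|.
Proof.
move=> /andP[t0 t1].
have -> : X - K - (L - K + (Q - K - (L - K)) * t) = X - (1 - t) * L - t * Q by ring.
rewrite (le_trans (ler_normB _ _))// lerD//; last first.
  by rewrite normrM ger0_norm// ler_piMl.
rewrite (le_trans (ler_normB _ _))// lerD// normrM ger0_norm ?subr_ge0// ler_piMl//.
by rewrite gerBl.
Qed.

Lemma rest_coarse a p x : (0 < k)%N ->
  node R b a p <= x <= node R b a p.+1 ->
  normc (faber_rest b step_response a.+1 p x) <=
  weight_constant * (lorentz (s * (y - x)) + (lorentz (s * (y - node R b a p)) +
      lorentz (s * (y - node R b a p.+1)))).
Proof.
move=> k0 /andP[lx xr].
have FB F G H Om : profile k F G H Om C -> forall u, `|F u| <= C * lorentz u.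
  by case: k k0 => // k' _ [].
have lr : node R b a p < node R b a p.+1.
  by rewrite /node ltr_pM2r ?invr_gt0// ltr_nat.
have t01 : 0 <= (x - node R b a p) / (node R b a p.+1 - node R b a p) <= 1.
  by rewrite divr_ge0 ?subr_ge0 ?(ltW lr)//= ler_pdivrMr ?subr_gt0// mul1r lerD2r.
rewrite (le_trans (normc_le_ReIm _))//.
have [-> ->] := rest_ReIm a p x; rewrite /step_response /=.
set S := (_ + (_ + _)).
have S0 : 0 <= S by rewrite !addr_ge0.
have half F G H Om : profile k F G H Om C ->
  `|F (s * (y - x))| + `|F (s * (y - node R b a p))| + `|F (s * (y - node R b a p.+1))| <= C * S.
  by move=> /FB fb; rewrite /S !mulrDr addrA; apply: lerD => //; apply: lerD.
apply: (@le_trans _ _ (C * S + C * S)).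
  apply: lerD.
    by apply: le_trans (chord_bound _ _ _ _ t01) (half _ _ _ _ profr).
  by apply: le_trans (chord_bound _ _ _ _ t01) (half _ _ _ _ profi).
rewrite -mulrDl; apply: ler_wpM2r => //.
by move: weight_constant_ge C_ge0; move: weight_constant => W; lra.
Qed.

Lemma faber_ends a c : (c < b ^ a)%N ->
  normc (faberL b step_response a c) <= faber_weight a c /\
  normc (faberR b step_response a c) <= faber_weight a c.
Proof.
have WC := weight_constant_ge.
have W0 := weight_constant_ge0.
case: a => [|a] cb.
  have -> : c = 0%N by apply/eqP; rewrite -leqn0 -ltnS -(expn0 b).
  have w0 := faber_weight_ge0 0 0.
  change (normc (step_response 0) <= faber_weight 0 0 /\ normc (step_response 1) <= faber_weight 0 0).
  split; last first.
    by rewrite /step_response !subrr /normc/= expr0n /= addr0 sqrtr0.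
  apply: le_trans (normc_le_ReIm _) _.
  rewrite /faber_weight /fine_level /= div0n /node expr0 !divr1 !subr0.
  set A := lorentz (s * y); set B := lorentz (s * (y - 1)).
  have A0 : 0 <= A by exact: l0. have B0 : 0 <= B by exact: l0.
  have half F G H Om : profile k F G H Om C -> `|F (s * y) - F (s * (y - 1))| <= C * (A + B).
    rewrite /A /B; case: k => [|k'] [_ _ _ _ FB].
      rewrite expr0 !mul1r (le_trans (FB _))// ler_wpM2l// lerDl; exact: l0.
    by apply: le_trans (ler_normB _ _) _; rewrite [leRHS]mulrDr; apply: lerD; exact: FB.
  apply: (@le_trans _ _ (C * (A + B) + C * (A + B))).
    by apply: lerD; [exact: half profr|exact: half profi].
  have : 0 <= weight_constant * (A + B) by rewrite mulr_ge0// addr_ge0.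
  have : 8 * C * (A + B) <= weight_constant * (A + B) by rewrite ler_wpM2r// addr_ge0.
  have : 0 <= C * (A + B) by rewrite mulr_ge0// addr_ge0.
  by lra.
have [pl pr] := node_parent a c; have nn := node_le a.+1 c.
have lE : node R b a (c %/ b) <= node R b a.+1 c <= node R b a (c %/ b).+1.
  by apply/andP; split => //; exact: le_trans nn pr.
have rE : node R b a (c %/ b) <= node R b a.+1 c.+1 <= node R b a (c %/ b).+1.
  by apply/andP; split => //; exact: le_trans pl nn.
rewrite /=; case fl: (fine_level a.+1); first by split; apply: rest_fine.
(* For k = 0 every level a >= 1 is fine, as 2^0 <= b^a. Thus the primitive that does not decay is
   met coarsely only at level 0, where it enters through an increment over a unit interval. *)
have k0 : (0 < k)%N.
  move: fl; rewrite /fine_level /=; case: k => // .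
  by rewrite expn0 expn_gt0 b_gt0.
split.
  apply: le_trans (rest_coarse k0 lE) _; rewrite /faber_weight fl ler_wpM2l// lerD2r.
  by rewrite lerDl; exact: l0.
apply: le_trans (rest_coarse k0 rE) _; rewrite /faber_weight fl ler_wpM2l// lerD2r.
by rewrite lerDr; exact: l0.
Qed.

Definition response_primitive (z : R) : R[i] :=
  (- s^-1 * Or (s * (y - z)) - Fr (s * (y - 1)) * z) +i*
  (- s^-1 * Oi (s * (y - z)) - Fi (s * (y - 1)) * z).

Definition response_mean : R[i] := response_primitive 1 - response_primitive 0.

Lemma is_derive_primitive F G H Om (z : R) : profile k F G H Om C ->
  is_derive z (1 : R) (fun z => - s^-1 * Om (s * (y - z)) - F (s * (y - 1)) * z)
    (F (s * (y - z)) - F (s * (y - 1))).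
Proof.
move=> [_ _ Od _ _].
have := is_deriveBf (is_deriveZf (- s^-1) (is_derive_scale (- s) (s * y) z Od))
  (is_deriveZf (F (s * (y - 1))) (is_derive_id z (1 : R))).
have -> : (fun x => - s^-1 * Om (- s * x + s * y) - F (s * (y - 1)) * x) =
    (fun z => - s^-1 * Om (s * (y - z)) - F (s * (y - 1)) * z).
  by apply/funext => x; congr (_ * Om _ - _); ring.
have -> : - s * z + s * y = s * (y - z) by ring.
by move/is_derive_eq; apply; field; rewrite gt_eqF.
Qed.

Lemma trapezoid_ReIm (A B L Q : R[i]) (h c : R) :
  complex.Re (A - B - h%:C * ((L + Q) * c%:C)) =
    complex.Re A - complex.Re B - h * ((complex.Re L + complex.Re Q) * c) /\
  complex.Im (A - B - h%:C * ((L + Q) * c%:C)) =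
    complex.Im A - complex.Im B - h * ((complex.Im L + complex.Im Q) * c).
Proof. by case: A B L Q => [? ?] [? ?] [? ?] [? ?]; split => /=; ring. Qed.

(** This is the error of the composite trapezoidal rule. Each interval of level a is charged to the
    weight of its first child only, and its length is b times that of the child, whence the factor
    b. *)
Lemma response_mean_bound a : fine_level a.+1 ->
  normc (response_mean - trapezoid b step_response a) <=
  b%:R * ((b ^ a.+1)%:R^-1 * \sum_(0 <= c < b ^ a.+1) faber_weight a.+1 c).
Proof.
move=> fl; have /andP[_ fine] := fl.
pose h : R := (b%:R ^+ a)^-1.
have hE p : node R b a p.+1 - node R b a p = h by rewrite node_diff.
have -> : response_mean - trapezoid b step_response a =
    \sum_(0 <= p < b ^ a) (response_primitive (node R b a p.+1) - response_primitive (node R b a p) -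
      h%:C * ((step_response (node R b a p) + step_response (node R b a p.+1)) / 2)).
  rewrite sumrB telescope_sumr// -mulr_sumr /trapezoid /response_mean.
  have -> : node R b a (b ^ a) = 1 by rewrite /node natrX divff// gt_eqF.
  have -> : node R b a 0 = 0 by rewrite /node mul0r.
  by have -> : h%:C = (b ^ a)%:R^-1; rewrite // /h -natrX fmorphV (rmorph_nat (real_complex R)).
rewrite (le_trans (normc_sum _ _ _))//.
have term p : normc (response_primitive (node R b a p.+1) - response_primitive (node R b a p) -
      h%:C * ((step_response (node R b a p) + step_response (node R b a p.+1)) / 2)) <=
    h * faber_weight a.+1 (b * p).
  have pE : (b * p %/ b)%N = p by rewrite mulKn.
  have -> : faber_weight a.+1 (b * p) = fine_eps a.+1 (b * p) + fine_eps a.+1 (b * p).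
    by rewrite /faber_weight fl /fine_eps; field; rewrite gt_eqF.
  have lr : node R b a p < node R b a p.+1.
    by rewrite /node ltr_pM2r ?invr_gt0// ltr_nat.
  have C2 : (2 : R[i])^-1 = (2^-1 : R)%:C by rewrite fmorphV (rmorph_nat (real_complex R)).
  rewrite (le_trans (normc_le_ReIm _))// mulrDr; apply: lerD.
    have := trapezoid_error lr (fun z => is_derive_primitive z profr).
    have := fine_real (c := b * p) profr fine; rewrite pE => H1 /(_ _ H1).
    by rewrite hE; apply: le_trans; rewrite C2 (trapezoid_ReIm _ _ _ _ _ _).1.
  have := trapezoid_error lr (fun z => is_derive_primitive z profi).
  have := fine_real (c := b * p) profi fine; rewrite pE => H1 /(_ _ H1).
  by rewrite hE; apply: le_trans; rewrite C2 (trapezoid_ReIm _ _ _ _ _ _).2.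
apply: (le_trans (ler_sum _ (fun p _ => term p))).
rewrite -mulr_sumr natrX exprS invfM mulrA mulrA mulfV; last by rewrite gt_eqF// ltr0n.
rewrite mul1r ler_wpM2l ?invr_ge0 ?(ltW (bX_gt0 a))//.
rewrite expnS sum_nat_mul; apply: ler_sum => p _.
rewrite big_ltn// addn0 lerDl; apply: sumr_ge0 => q _; exact: faber_weight_ge0.
Qed.

End faber_estimates.

(** * Integral formulas for the responses *)

Section response_integrals.
Variables (R : realType) (k : nat) (F G H Om : R -> R) (C y : R).
Hypothesis prof : profile k F G H Om C.
Local Notation mu := (@lebesgue_measure R).
Local Notation s := (2 ^+ k : R).

(** The characteristic function of [0, t) at the point z, read as a function of the corner t in the
    unit interval; for z >= 0 the condition 0 <= t is implied. *)
Definition after (z t : R) : R := if z < t < 1 then 1 else 0.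

Lemma continuous_bandpass : continuous (fun t => s * G (s * (y - t))).
Proof.
have [_ Gd _ _ _] := prof.
have H0 t := is_deriveZf s (is_derive_scale (- s) (s * y) t Gd).
have := is_derive_continuous H0.
have -> : (fun x => s * G (- s * x + s * y)) = (fun t => s * G (s * (y - t))).
  by apply/funext => z; congr (_ * G _); ring.
by [].
Qed.

Lemma Rintegral_after (g : R -> R) z : z < 1 -> continuous g ->
  \int[mu]_t (after z t * g t) = \int[mu]_(t in `[z, 1]) g t.
Proof.
move=> z1 cg; have iz := continuous_itv_integrable z 1 cg.
rewrite -Rintegral_itv_obnd_cbnd; last first.
  by apply: integrableS iz => // x; exact: subset_itv_oc_cc.
rewrite -Rintegral_itv_bndo_bndc; last first.
  by apply: integrableS iz => // x; exact: subset_itv_oo_cc.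
rewrite [RHS]Rintegral_mkcond; apply: eq_Rintegral => t _.
rewrite patchE /after mem_setE in_itv/=.
by case: ifP => _; rewrite ?mul1r ?mul0r.
Qed.

Lemma response_integral z : z < 1 ->
  \int[mu]_t (after z t * (s * G (s * (y - t)))) = F (s * (y - z)) - F (s * (y - 1)).
Proof.
move=> z1; rewrite (Rintegral_after z1 continuous_bandpass).
have [Fd _ _ _ _] := prof.
have Pd (t : R) : is_derive t (1 : R) (fun t => - F (s * (y - t))) (s * G (s * (y - t))).
  have := is_deriveZf (-1) (is_derive_scale (- s) (s * y) t Fd).
  have -> : (fun x => -1 * F (- s * x + s * y)) = (fun t => - F (s * (y - t))).
    by apply/funext => x; rewrite mulN1r; congr (- F _); ring.
  have -> : - s * t + s * y = s * (y - t) by ring.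
  by move/is_derive_eq; apply; ring.
by rewrite (FTC2_total z1 continuous_bandpass Pd) opprK addrC.
Qed.

Lemma mul_ind01_after (t x : R) : t * ind01 t * x = after 0 t * (t * x).
Proof.
rewrite /after /ind01; case: (ltgtP 0 t) => [t0|t0|<-]; rewrite ?mulr0 ?mul0r//=.
by rewrite -mulrA; ring.
Qed.

Lemma integrable_after (g : R -> R) z : continuous g ->
  mu.-integrable setT (EFin \o (fun t => after z t * g t)).
Proof.
move=> cg; have mI : measurable (`]z, 1[%classic : set (measurableTypeR R)) by exact: measurable_itv.
have : mu.-integrable `]z, 1[ (EFin \o g).
  have iz := continuous_itv_integrable z 1 cg.
  by apply: integrableS iz => // x; exact: subset_itv_oo_cc.
move/(integrable_mkcond _ mI); apply: eq_integrable => // t _.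
rewrite patchE /after mem_setE in_itv/=.
by case: ifP => _ /=; rewrite ?mul1r ?mul0r.
Qed.

(** Integration by parts: the volume term t, paired with the kernel, gives the integral of the
    response over [0, 1], whose primitive is expressed through [Om]. *)
Lemma mean_integral :
  \int[mu]_t (t * ind01 t * (s * G (s * (y - t)))) =
  (- s^-1 * Om (s * (y - 1)) - F (s * (y - 1)) * 1) -
  (- s^-1 * Om (s * (y - 0)) - F (s * (y - 1)) * 0).
Proof.
have cg := continuousMf (@continuous_idf R) continuous_bandpass.
have s0 : s != 0 by rewrite gt_eqF// exprn_gt0.
under eq_Rintegral do rewrite mul_ind01_after.
rewrite (Rintegral_after ltr01 cg).
have [Fd _ Od _ _] := prof.
have Pd (t : R) : is_derive t (1 : R) (fun t => - (t * F (s * (y - t))) - s^-1 * Om (s * (y - t)))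
    (t * (s * G (s * (y - t)))).
  have := is_deriveBf (is_deriveZf (-1) (is_deriveMf (is_derive_id t (1 : R)) (is_derive_scale (- s) (s * y) t Fd)))
    (is_deriveZf s^-1 (is_derive_scale (- s) (s * y) t Od)).
  have -> : (fun x => -1 * (x * F (- s * x + s * y)) - s^-1 * Om (- s * x + s * y)) =
     (fun t => - (t * F (s * (y - t))) - s^-1 * Om (s * (y - t))).
    by apply/funext => x; rewrite mulN1r; congr (- (_ * F _) - _ * Om _); ring.
  have -> : - s * t + s * y = s * (y - t) by ring.
  by move/is_derive_eq; apply; field.
by rewrite (FTC2_total ltr01 cg Pd); ring.
Qed.

End response_integrals.

Lemma Rintegral_sum d (T : measurableType d) (R : realType) (mu : {measure set T -> \bar R})
    I (r : seq I) (F : I -> T -> R) :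
  (forall i, mu.-integrable setT (fun x => (F i x)%:E)) ->
  mu.-integrable setT (fun x => (\sum_(i <- r) F i x)%:E) /\
  \int[mu]_x (\sum_(i <- r) F i x) = \sum_(i <- r) \int[mu]_x F i x.
Proof.
move=> Fi; split.
  have := @integrable_sum _ _ R mu setT measurableT _ r xpredT (fun i x => (F i x)%:E) (fun i _ => Fi i).
  by apply: eq_integrable => // x _; rewrite /= sumEFin.
rewrite /Rintegral; under eq_integral do rewrite -sumEFin.
rewrite integral_sum//.
by apply/esym/sum_fine => i _; apply: integrable_fin_num => //; exact: Fi.
Qed.

(** * Sums and integrals of the weights *)

Section weight_sums.
Variables (R : realType) (b k : nat).
Hypothesis b_gt1 : (1 < b)%N.
Variable C : R.
Hypothesis C_ge0 : 0 <= C.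
Local Notation mu := (@lebesgue_measure R).
Local Notation s := (2 ^+ k : R).
Local Notation W := (weight_constant b C).
Local Notation w y := (faber_weight b k C y).
Let b_gt0 := ltnW b_gt1.
Let s_gt0 : 0 < s. Proof. by rewrite exprn_gt0. Qed.
Let bX_gt0 a : 0 < b%:R ^+ a :> R.
Proof. by rewrite exprn_gt0// ltr0n. Qed.
Let l0 (u : R) : 0 <= lorentz u := ltW (lorentz_gt0 u).

Lemma atan_diff (u v : R) : atan u - atan v <= pi.
Proof.
have := atan_gtNpi2 v; have := atan_ltpi2 u; set P := pi; lra.
Qed.

(* The sum telescopes once [x * lorentz (x * u)] is compared with an increment
   of [atan] over [x * u, x * (u + 1)]. *)
Lemma sum_lorentz_small (x z : R) T : 0 < x -> x <= 1 ->
  \sum_(0 <= c < T) lorentz (x * (z - c%:R)) <= 4 * pi / x.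
Proof.
move=> x0 x1; rewrite ler_pdivlMr//.
have step (u : R) : lorentz (x * u) * x <= 4 * (atan (x * (u + 1)) - atan (x * u)).
  have at' (t : R) : is_derive t 1 (@atan R) (lorentz t) by exact: is_derive1_atan.
  have [|xi /andP[h1 h2] ->] := @MVT_total R (@atan R) (@lorentz R) (x * u) (x * (u + 1)) _ at'.
    by rewrite ler_pM2l// lerDl.
  have -> : x * (u + 1) - x * u = x by ring.
  rewrite mulrA ler_wpM2r ?(ltW x0)//.
  have := @lorentz_shift R 1 (x * u) xi; rewrite expr1n mulr1 -[2 + 2]/(1 + 1 + (1 + 1)).
  have -> : (1 + 1 + (1 + 1) : R) = 4 by ring.
  apply; rewrite ler_norml; apply/andP; split; lra.
rewrite mulr_suml.
apply: (@le_trans _ _ (\sum_(0 <= c < T) 4 *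
    (atan (x * (z - c%:R + 1)) - atan (x * (z - c%:R))))).
  by apply: ler_sum => c _; exact: step.
rewrite -mulr_sumr ler_wpM2l//.
rewrite (eq_bigr (fun c => - atan (x * (z + 1 - c.+1%:R)) - - atan (x * (z + 1 - c%:R)))); last first.
  move=> c _; rewrite opprK [RHS]addrC -natr1.
  by congr (atan (x * _) - atan (x * _)); ring.
by rewrite telescope_sumr// opprK addrC; exact: atan_diff.
Qed.

Lemma lorentz_contract (x u : R) : 1 <= x -> lorentz (x * u) <= lorentz u.
Proof.
move=> x1; rewrite /lorentz lef_pV2 ?posrE ?lorentz_den_gt0// lerD2l exprMn ler_peMl ?sqr_ge0//.
by rewrite exprn_ege1.
Qed.

Lemma sum_lorentz_large (x z : R) T : 1 <= x ->
  \sum_(0 <= c < T) lorentz (x * (z - c%:R)) <= 4 * pi.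
Proof.
move=> x1; have := sum_lorentz_small z T ltr01 (lexx _); rewrite divr1; apply: le_trans.
by apply: ler_sum => c _; rewrite mul1r; exact: lorentz_contract.
Qed.

Lemma node_scale a c (y : R) :
  s * (y - node R b a c) = s / b%:R ^+ a * (b%:R ^+ a * y - c%:R).
Proof. by rewrite /node; field; rewrite gt_eqF. Qed.

Lemma node_scale_shift a c e (y : R) :
  s * (y - node R b a (c + e)%N) = s / b%:R ^+ a * (b%:R ^+ a * y - e%:R - c%:R).
Proof. by rewrite node_scale natrD opprD addrA addrAC. Qed.

Let W_ge0 : 0 <= W. Proof. exact: weight_constant_ge0. Qed.
Let pi0 : 0 <= pi :> R. Proof. exact: pi_ge0. Qed.

Lemma weight_bound_ge0 : 0 <= 16 * pi * b%:R * W.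
Proof. by apply: mulr_ge0 => //; apply: mulr_ge0 => //; apply: mulr_ge0. Qed.

Lemma fine_ratio a : fine_level b k a -> s / b%:R ^+ a <= 1.
Proof.
move=> /andP[_ h]; rewrite ler_pdivrMr// mul1r.
by move: h; rewrite -(ler_nat R) !natrX.
Qed.

Lemma coarse_ratio a : fine_level b k a = false -> 1 <= s / b%:R ^+ a.
Proof.
rewrite /fine_level; case: a => [_|a /=]; first by rewrite expr0 divr1 exprn_ege1 ?ler1n.
move/negbT; rewrite -ltnNge => /ltnW h; rewrite ler_pdivlMr// mul1r.
by move: h; rewrite -(ler_nat R) !natrX.
Qed.

Lemma sum_faber_weight y a :
  \sum_(0 <= c < b ^ a) w y a c <=
  16 * pi * b%:R * W * Num.min 1 (s / b%:R ^+ a).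
Proof.
have bR1 : 1 <= b%:R :> R by rewrite ler1n.
have x0 : 0 < s / b%:R ^+ a by rewrite divr_gt0.
rewrite /faber_weight -mulr_sumr [16 * _ * _ * _]mulrC -[leRHS]mulrA ler_wpM2l//.
case fl: (fine_level b k a).
  have x1 := fine_ratio fl; rewrite (min_idPr x1) -mulr_sumr.
  under eq_bigr do rewrite node_scale.
  have h := sum_lorentz_small (b%:R ^+ a * y) (b ^ a) x0 x1.
  rewrite (le_trans (ler_wpM2l (sqr_ge0 _) h))//.
  have -> : (s / b%:R ^+ a) ^+ 2 * (4 * pi / (s / b%:R ^+ a)) = 4 * pi * (s / b%:R ^+ a).
    by field; rewrite !gt_eqF.
  rewrite ler_wpM2r ?(ltW x0)//.
  have : 0 <= pi * (b%:R - 1) :> R by rewrite mulr_ge0// subr_ge0.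
  move: pi0; move: pi => P; lra.
have x1 := coarse_ratio fl; rewrite (min_idPl x1) mulr1 !big_split /=.
have S1 : \sum_(0 <= c < b ^ a) lorentz (s * (y - node R b a c)) <= 4 * pi.
  by under eq_bigr do rewrite node_scale; exact: sum_lorentz_large.
have S2 : \sum_(0 <= c < b ^ a) lorentz (s * (y - node R b a c.+1)) <= 4 * pi.
  under eq_bigr => c _ do rewrite -[c.+1]addn1 node_scale_shift.
  exact: sum_lorentz_large.
(* Each parent node is counted once for each of its b children, which is the origin of [b%:R] in the
   bound: two sums of 4 pi and two of 4 pi b. *)
have parent e (g : nat -> nat) : (forall c, g c = c %/ b + e)%N ->
    \sum_(0 <= c < b ^ a) lorentz (s * (y - node R b a.-1 (g c))) <= 4 * pi * b%:R.
  move=> gE; under eq_bigr do rewrite gE.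
  case: a x0 fl x1 S1 S2 => [|a] x0 fl x1 _ _.
    rewrite expn0 big_nat1; have p1 : 1 <= pi :> R by have := @pi_ge2 R; move: pi => P; lra.
    rewrite (le_trans (lorentz_le1 _))//.
    have : 0 <= (pi - 1) * b%:R :> R by rewrite mulr_ge0// subr_ge0.
    move: pi p1 => P; lra.
  rewrite expnS sum_nat_mul /=.
  have x1' : 1 <= s / b%:R ^+ a.
    rewrite (le_trans x1)// exprS invfM mulrA ler_wpM2r ?invr_ge0 ?(ltW (bX_gt0 _))//.
    by rewrite ler_pdivrMr ?ltr0n// ler_peMr// ltW.
  apply: (@le_trans _ _ (\sum_(0 <= p < b ^ a) b%:R * lorentz (s * (y - node R b a (p + e)%N)))).
    apply: ler_sum => p _; rewrite big_nat_cond (eq_bigr (fun=> lorentz (s * (y - node R b a (p + e)%N)))).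
      by rewrite -big_nat_cond sumr_const_nat subn0 mulr_natl.
    by move=> q /andP[/andP[_ qb] _]; rewrite [(b * p)%N]mulnC divnMDl// divn_small// addn0.
  rewrite -mulr_sumr mulrC ler_wpM2r//.
  under eq_bigr do rewrite node_scale_shift.
  exact: sum_lorentz_large.
have := parent _ _ (fun c => esym (addn1 (c %/ b)%N)).
have := parent _ _ (fun c => esym (addn0 (c %/ b)%N)).
have : 0 <= pi * (b%:R - 1) :> R by rewrite mulr_ge0// subr_ge0.
move: S1 S2; set X1 := \sum_(_ <= _ < _) _; set X2 := \sum_(_ <= _ < _) _.
set X3 := \sum_(_ <= _ < _) _; set X4 := \sum_(_ <= _ < _) _; move: pi => P; lra.
Qed.

(** With x = 2^k / b^a, each Lorentz term has integral pi / 2^k = pi b^-a x^-1. The factor x^2 of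
    the fine levels turns x^-1 into x; the coarse levels have four terms and keep x^-1. *)
Lemma integrable_faber_weight a c :
  mu.-integrable setT (EFin \o (fun y => w y a c)) /\
  \int[mu]_y w y a c <=
  16 * pi * b%:R * W * ((b%:R ^+ a)^-1 * Num.min (s / b%:R ^+ a) (s / b%:R ^+ a)^-1).
Proof.
have bR1 : 1 <= b%:R :> R by rewrite ler1n.
have x0 : 0 < s / b%:R ^+ a by rewrite divr_gt0.
have P0 : 0 <= pi * (b%:R - 1) :> R by rewrite mulr_ge0// subr_ge0.
pose L n (y : R) := lorentz (s * (y - n)).
have il n : mu.-integrable setT (fun y => (L n y)%:E) by exact: integrable_lorentz_scale.
rewrite [16 * _ * _ * _]mulrC -[leRHS]mulrA.
case fl: (fine_level b k a).
  pose K := W * (s / b%:R ^+ a) ^+ 2.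
  have wE y : w y a c = K * L (node R b a c) y by rewrite /faber_weight fl /K mulrA.
  have -> : (fun y => w y a c) = (fun y => K * L (node R b a c) y) by apply/funext.
  split; first by apply: (integrableZl measurableT K (il _)).
  rewrite RintegralZl//; last exact: il.
  rewrite Rintegral_lorentz_scale//.
  have x1 := fine_ratio fl; rewrite (min_idPl _); last first.
    by rewrite (le_trans x1)// invf_ge1.
  rewrite /K -mulrA ler_wpM2l//.
  have -> : (s / b%:R ^+ a) ^+ 2 * (pi / s) = pi * ((b%:R ^+ a)^-1 * (s / b%:R ^+ a)).
    by field; rewrite !gt_eqF.
  rewrite ler_wpM2r ?mulr_ge0 ?invr_ge0 ?(ltW x0) ?(ltW (bX_gt0 _))//.
  move: pi pi0 P0 => P; lra.
pose N (j : 'I_4) := nth 0 [:: node R b a c; node R b a c.+1;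
   node R b a.-1 (c %/ b); node R b a.-1 (c %/ b).+1] j.
have wE : (fun y => w y a c) = (fun y => W * (\sum_j L (N j) y)).
  apply/funext => y; rewrite /faber_weight fl !big_ord_recl big_ord0 addr0 /N /L /=.
  by rewrite !addrA.
have [isum Isum] := Rintegral_sum (index_enum 'I_4) (fun j => il (N j)).
rewrite wE; split; first exact: (integrableZl measurableT W isum).
rewrite RintegralZl// ler_wpM2l//.
rewrite Isum.
under eq_bigr do rewrite Rintegral_lorentz_scale//.
have x1 := coarse_ratio fl; rewrite (min_idPr _); last first.
  by rewrite (le_trans _ x1)// invf_le1.
have -> : (b%:R ^+ a)^-1 * (s / b%:R ^+ a)^-1 = s^-1 by field; rewrite !gt_eqF.
rewrite sumr_const card_ord -[leLHS]mulr_natl mulrA ler_wpM2r ?invr_ge0 ?(ltW s_gt0)//.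
move: pi pi0 P0 => P; lra.
Qed.

End weight_sums.

(** * Multilevel decomposition of the quadrature error *)

Section multilevel.
Variables (R : realType) (b d s n v : nat) (M : 'I_d -> 'M['F_b]_(s, n)).
Hypothesis b_prime : prime b.
Hypothesis netM : order_digital_net 2 v M.
Local Notation pt nu i := (digital_net R M nu 0 i).
Variables (f : 'I_d -> R -> R[i]) (m : 'I_d -> R[i]) (w : 'I_d -> nat -> nat -> R) (J : nat).
Hypothesis nJ : (n <= J)%N.
Hypothesis w0 : forall i a c, 0 <= w i a c.
Hypothesis ends : forall i a c, (c < b ^ a)%N ->
  normc (faberL b (f i) a c) <= w i a c /\ normc (faberR b (f i) a c) <= w i a c.
Hypothesis rest : forall i c x,
  node R b J (c %/ b) <= x <= node R b J (c %/ b).+1 ->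
  normc (faber_rest b (f i) J.+1 (c %/ b) x) <= w i J.+1 c.
Hypothesis mean_rest : forall i, normc (m i - trapezoid b (f i) J) <=
  b%:R * ((b ^ J.+1)%:R^-1 * \sum_(0 <= c < b ^ J.+1) w i J.+1 c).
Local Notation y := (quarter_base R b).
Let b_gt0 := prime_gt0 b_prime.

(** The single index [J.+1] carries the entire rest. It then has the same shape as a Faber
    component, and the tensor product expands over a finite set of multi-levels. *)
Definition level_term (i : 'I_d) (a : nat) (nu : 'I_(b ^ n)) : R[i] :=
  if (a <= J)%N then
    piecewise_linear b (fun=> a) (fun i => faberL b (f i) a)
      (fun i c => faberR b (f i) a c - faberL b (f i) a c) i (pt nu i)
  else faber_rest b (f i) J.+1 (cell b J (pt nu i)) (pt nu i).

Definition level_term_mean (i : 'I_d) (a : nat) : R[i] :=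
  if (a <= J)%N then faber_mean b (f i) a else m i - trapezoid b (f i) J.

Lemma net_point_01 nu i : 0 <= pt nu i < 1.
Proof.
have := cell_frac R M b_prime 0 nu i; have := cell_lt R M b_prime 0 nu i.
by rewrite expn0 ltnS leqn0 => /eqP ->; rewrite expr0 mul1r add0r.
Qed.

Lemma cell_parent a nu i : cell b a (pt nu i) = (cell b a.+1 (pt nu i) %/ b)%N.
Proof.
rewrite !(cell_digital_net _ M b_prime).
have := @digit_value_divn b b_gt0 _ a 1 (@digit_lt b s b_prime (net_digits M (digit_vector b n nu) i)).
by rewrite addn1 expn1 => <-.
Qed.

Lemma sum_level_term i nu : f i (pt nu i) = \sum_(a < J.+2) level_term i a nu.
Proof.
rewrite (@faber_decomposition R b b_gt0 (f i) J (pt nu i) (net_point_01 nu i)); last first.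
  by move=> a; exact: cell_parent.
rewrite [RHS]big_ord_recr /= /level_term ltnn; congr (_ + _).
by apply: eq_bigr => a _; rewrite -ltnS ltn_ord.
Qed.

Lemma sum_level_term_mean i : m i = \sum_(a < J.+2) level_term_mean i a.
Proof.
rewrite big_ord_recr /= {2}/level_term_mean ltnn.
rewrite (eq_bigr (fun a : 'I_J.+1 => faber_mean b (f i) a)); last first.
  by move=> a _; rewrite /level_term_mean -ltnS ltn_ord.
by rewrite sum_faber_mean// addrC subrK.
Qed.

Lemma convex_combinationE (L Q : R[i]) (t : R) :
  L + (Q - L) * t%:C = (1 - t)%:C * L + t%:C * Q.
Proof.
by case: L Q => [? ?] [? ?]; apply/eqP; rewrite eq_complex /=; apply/andP; split; apply/eqP; ring.
Qed.

Lemma level_term_bound i a nu : (a <= J.+1)%N ->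
  normc (level_term i a nu) <= w i a (cell b a (pt nu i)).
Proof.
rewrite /level_term; case: (leqP a J) => [aJ _|aJ aJ1].
  have [h1 h2] := ends i (cell_lt R M b_prime a nu i).
  have /andP[c1 c2] := cell_frac R M b_prime a nu i.
  rewrite /piecewise_linear.
  set t := b%:R ^+ a * _ - _; set L := faberL _ _ _ _ in h1 *; set Q := faberR _ _ _ _ in h2 *.
  have t0 : 0 <= t by rewrite /t subr_ge0.
  have t1 : t <= 1 by rewrite /t lerBlDl addrC ltW// addrC.
  have -> : L + (Q - L) * t%:C = (1 - t)%:C * L + t%:C * Q.
    exact: convex_combinationE.
  rewrite (le_trans (normcD _ _))// !normcM !normc_real !ger0_norm ?subr_ge0//.
  have h3 : (1 - t) * normc L <= (1 - t) * w i a (cell b a (pt nu i)).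
    by rewrite ler_wpM2l ?subr_ge0.
  have h4 : t * normc Q <= t * w i a (cell b a (pt nu i)) by rewrite ler_wpM2l.
  by apply: le_trans (lerD h3 h4) _; rewrite -mulrDl subrK mul1r.
have -> : a = J.+1 by apply/eqP; rewrite eqn_leq aJ1.
rewrite cell_parent; apply: rest; rewrite -cell_parent /node.
have bX : 0 < b%:R ^+ J :> R by rewrite exprn_gt0// ltr0n.
have /andP[c1 c2] := cell_frac R M b_prime J nu i.
rewrite ler_pdivrMr// [X in _ <= X]mulrC c1 /= ler_pdivlMr// mulrC -natr1.
exact: ltW.
Qed.

Lemma level_term_mean_bound i a : (a <= J.+1)%N ->
  normc (level_term_mean i a) <= b%:R * ((b ^ a)%:R^-1 * \sum_(0 <= c < b ^ a) w i a c).
Proof.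
rewrite /level_term_mean; case: (leqP a J) => [aJ _|aJ aJ1]; last first.
  by have -> : a = J.+1 by apply/eqP; rewrite eqn_leq aJ1.
set S := (X in b%:R * X).
have S0 : 0 <= S by rewrite mulr_ge0 ?invr_ge0// sumr_ge0.
apply: (@le_trans _ _ S); last by rewrite ler_peMl// ler1n.
have := @mean_linear_bound R b d (fun=> a) (fun i => faberL b (f i) a)
  (fun i c => faberR b (f i) a c - faberL b (f i) a c) (fun i => w i a).
apply => j c cb; first by have [] := ends j cb.
by rewrite addrC subrK; have [] := ends j cb.
Qed.

(** 2b per coordinate bounds the digit parts, y^(-3v) accounts for the defect v in the exactness
    condition, and (1 - y)^-1 per coordinate is the geometric sum over the digit positions m_i. *)
Definition net_constant : R :=
  (2 * b%:R) ^+ d * y^-1 ^+ (3 * v) * ((1 - y)^-1) ^+ d.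

Definition multilevel_constant : R := net_constant + b%:R ^+ d.

Lemma net_constant_ge0 : 0 <= net_constant.
Proof.
have y0 := quarter_base_gt0 R b_prime; have y1 := quarter_base_lt1 R b_prime.
apply: mulr_ge0; first apply: mulr_ge0.
- by apply: exprn_ge0; rewrite mulr_ge0.
- by apply: exprn_ge0; rewrite invr_ge0 ltW.
- by apply: exprn_ge0; rewrite invr_ge0 subr_ge0 ltW.
Qed.

Lemma multilevel_constant_ge0 : 0 <= multilevel_constant.
Proof. by apply: addr_ge0; [exact: net_constant_ge0|exact: exprn_ge0]. Qed.

Definition multilevel_decay (S : nat) : R := if (S <= n)%N then y ^+ (6 * (n - S)) else 1.

(** If |a| <= n, then all a_i <= n <= J, so only Faber components occur and the net quadrature bound
    applies. The rest appears only for |a| > n, where the average and the mean are bounded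
    separately. *)
Lemma level_term_error (a : {ffun 'I_d -> 'I_J.+2}) :
  normc ((b ^ n)%:R^-1 * (\sum_nu \prod_i level_term i (a i) nu) -
    \prod_i level_term_mean i (a i)) <=
  multilevel_constant * multilevel_decay (\sum_i a i) *
  weight_average M (fun i => a i : nat) (fun i => w i (a i)).
Proof.
have y0 := quarter_base_gt0 R b_prime.
have Av0 : 0 <= weight_average M (fun i => a i : nat) (fun i => w i (a i)).
  by apply: weight_average_ge0 => i c; exact: w0.
have c1 := net_constant_ge0.
have c2 : 0 <= b%:R ^+ d :> R by rewrite exprn_ge0.
rewrite /multilevel_decay /multilevel_constant; case: leqP => [an|an].
  have aJ i : (a i <= J)%N.
    by apply: leq_trans nJ; apply: leq_trans an; rewrite (bigD1 i)//= leq_addr.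
  have := net_quadrature_bound (a := fun i => a i : nat) b_prime netM (U := fun i => faberL b (f i) (a i))
    (V := fun i c => faberR b (f i) (a i) c - faberL b (f i) (a i) c)
    (w := fun i => w i (a i)) (fun i c => w0 _ _ _).
  move=> /(_ (fun i c cb => (ends i cb).1)) H.
  have {H} := H _ an.
  have UV i c : (c < b ^ a i)%N -> normc (faberL b (f i) (a i) c +
     (faberR b (f i) (a i) c - faberL b (f i) (a i) c)) <= w i (a i) c.
    by move=> cb; rewrite addrC subrK; have [] := ends i cb.
  move=> /(_ UV) H.
  rewrite (eq_bigr (fun nu => \prod_i piecewise_linear b (fun i => a i : nat)
     (fun i => faberL b (f i) (a i))
    (fun i c => faberR b (f i) (a i) c - faberL b (f i) (a i) c) i (pt nu i))); last first.
    by move=> nu _; apply: eq_bigr => i _; rewrite /level_term aJ.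
  rewrite (eq_bigr (fun i => faber_mean b (f i) (a i))); last first.
    by move=> i _; rewrite /level_term_mean aJ.
  apply: le_trans H _; rewrite ler_wpM2r// ler_wpM2r ?exprn_ge0 ?(ltW y0)//.
  by rewrite lerDl.
rewrite mulr1; have := tensor_error (a := fun i => a i : nat) (w := fun i => w i (a i)) (C := M)
   (G := fun i nu => level_term i (a i) nu) (mu := fun i => level_term_mean i (a i))
   (B := fun=> b%:R) (fun=> ler0n _ _).
rewrite prodr_const card_ord => H; apply: (le_trans (H _ _)).
- move=> i nu; have h := @level_term_bound i (a i) nu (ltn_ord (a i)).
  by rewrite (le_trans h)// ler_peMl// ler1n.
- by move=> i; exact: level_term_mean_bound (ltn_ord (a i)).
by rewrite ler_wpM2r// lerDr.
Qed.

Lemma multilevel_bound :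
  normc ((b ^ n)%:R^-1 * (\sum_nu \prod_i f i (pt nu i)) - \prod_i m i) <=
  \sum_(a : {ffun 'I_d -> 'I_J.+2}) multilevel_constant * multilevel_decay (\sum_i a i) *
  weight_average M (fun i => a i : nat) (fun i => w i (a i)).
Proof.
rewrite (eq_bigr _ (fun i _ => sum_level_term_mean i)) bigA_distr_bigA /=.
rewrite (eq_bigr (fun nu => \sum_(a : {ffun 'I_d -> 'I_J.+2}) \prod_i level_term i (a i) nu)); last first.
  by move=> nu _; rewrite (eq_bigr _ (fun i _ => sum_level_term i nu)) bigA_distr_bigA.
rewrite exchange_big mulr_sumr -sumrB (le_trans (normc_sum _ _ _))//.
by apply: ler_sum => a _; exact: level_term_error.
Qed.

End multilevel.

(** * Blocks of the discrepancy function *)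

Section discrepancy_response.
Variables (R : realType) (b d s n : nat) (M : 'I_d -> 'M['F_b]_(s, n)).
Hypothesis b_prime : prime b.
Variables (k : 'I_d -> nat) (Fr Gr Hr Or Fi Gi Hi Oi : 'I_d -> R -> R) (C : R).
Hypothesis profr : forall i, profile (k i) (Fr i) (Gr i) (Hr i) (Or i) C.
Hypothesis profi : forall i, profile (k i) (Fi i) (Gi i) (Hi i) (Oi i) C.
Local Notation pt nu i := (digital_net R M nu 0 i).
Local Notation mu1 := (@lebesgue_measure R).
Local Notation Rt := (d.-tuple (measurableTypeR R)).
Implicit Types y : 'rV[R]_d.

Definition band_kernel i (x : R) : R[i] :=
  (2 ^+ k i * Gr i (2 ^+ k i * x)) +i* (2 ^+ k i * Gi i (2 ^+ k i * x)).

Definition cube_discrepancy (t : Rt) : R :=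
  discrepancy (digital_net R M) (rv t) * \prod_i ind01 (tnth t i).

Definition net_response y i nu : R[i] :=
  step_response (k i) (Fr i) (Fi i) (y 0 i) (pt nu i).

Definition cube_response y i : R[i] :=
  response_mean (k i) (Fr i) (Or i) (Fi i) (Oi i) (y 0 i).

Lemma cube_discrepancyE t : cube_discrepancy t =
  (b ^ n)%:R^-1 * (\sum_nu \prod_i after (pt nu i) (tnth t i)) -
  \prod_i (tnth t i * ind01 (tnth t i)).
Proof.
rewrite /cube_discrepancy /discrepancy mulrBl -big_split /=.
congr (_ - _); last by apply: eq_bigr => i _; rewrite mxE.
rewrite -mulrA mulr_suml; congr (_ * _); apply: eq_bigr => nu _.
case: (boolP [forall i, 0 <= pt nu i < rv t 0 i]) => [/forallP H|].
  rewrite mul1r; apply: eq_bigr => i _; have := H i; rewrite [rv t 0 i]mxE /after /ind01.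
  by move=> /andP[p0 pz]; rewrite pz (le_trans p0 (ltW pz)).
rewrite negb_forall; case/existsP => i; rewrite [rv t 0 i]mxE => H.
rewrite mul0r (bigD1 i)/=; last by [].
have /andP[p0 _] := net_point_01 R M b_prime nu i.
by rewrite {1}/after; move: H; rewrite p0 /= => /negbTE ->; rewrite mul0r.
Qed.

Lemma measurable_after (z : R) : measurable_fun setT (after z : measurableTypeR R -> R).
Proof.
have : after z = \1_(`]z, 1[).
  by apply/funext => x; rewrite /after indicE mem_setE in_itv/=; case: ifP.
move=> ->; apply: measurable_indic; exact: measurable_itv.
Qed.

Lemma measurable_cube_discrepancy : measurable_fun setT cube_discrepancy.
Proof.
rewrite (_ : cube_discrepancy = fun t => (b ^ n)%:R^-1 * (\sum_nu \prod_i after (pt nu i) (tnth t i)) -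
  \prod_i (tnth t i * ind01 (tnth t i))); last by apply/funext => t; exact: cube_discrepancyE.
apply: measurable_funB.
  apply: measurable_funM; first exact: measurable_cst.
  apply: measurable_sum => nu.
  exact: (measurable_tensor (fun i => measurable_after (pt nu i))).
apply: (measurable_tensor (w := fun _ x => x * ind01 x)) => i.
by apply: measurable_funM; [exact: measurable_id|exact: measurable_ind01].
Qed.

Lemma prod_mul_ind01_le (t : Rt) :
  0 <= \prod_i (tnth t i * ind01 (tnth t i)) <= \prod_i ind01 (tnth t i).
Proof.
have H i : 0 <= tnth t i * ind01 (tnth t i) <= ind01 (tnth t i).
  rewrite /ind01; case: ifP => [/andP[t0 t1]|_]; last by rewrite mulr0 lexx.
  by rewrite mulr1 t0 ltW.
apply/andP; split; first by apply: prodr_ge0 => i _; have /andP[] := H i.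
by apply: ler_prod => i _; exact: H.
Qed.

Lemma cube_discrepancy_bound t : `|cube_discrepancy t| <= 1 * \prod_i ind01 (tnth t i).
Proof.
have P := prod_mul_ind01_le t; rewrite mul1r cube_discrepancyE.
set A := _^-1 * _; set Q := \prod_i _ in P *; set I := \prod_i _ in P *.
have N0 : (0 : R) < (b ^ n)%:R by rewrite ltr0n expn_gt0 prime_gt0.
have A01 : 0 <= A <= I.
  have H nu : 0 <= \prod_i after (pt nu i) (tnth t i) <= I.
    have H' i : 0 <= after (pt nu i) (tnth t i) <= ind01 (tnth t i).
      have /andP[p0 _] := net_point_01 R M b_prime nu i.
      rewrite /after /ind01; case: ifP => [/andP[zt ->]|_].
        by rewrite (le_trans p0 (ltW zt)) ler01 lexx.
      by case: ifP; rewrite ?lexx ?ler01.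
    apply/andP; split; first by apply: prodr_ge0 => i _; have /andP[] := H' i.
    by apply: ler_prod => i _; exact: H'.
  rewrite /A; apply/andP; split.
    by rewrite mulr_ge0 ?invr_ge0 ?(ltW N0)// sumr_ge0// => nu _; have /andP[] := H nu.
  rewrite mulrC ler_pdivrMr//; apply: (@le_trans _ _ (\sum_(nu < b ^ n) I)).
    by apply: ler_sum => nu _; have /andP[] := H nu.
  by rewrite sumr_const card_ord mulr_natr.
move: A01 P => /andP[a0 a1] /andP[q0 q1]; rewrite ler_norml; apply/andP; split; lra.
Qed.

Lemma cint_after i y z : z < 1 ->
  cintegrable mu1 (fun t => (after z t)%:C * band_kernel i (y 0 i - t)) /\
  cint mu1 (fun t => (after z t)%:C * band_kernel i (y 0 i - t)) =
  step_response (k i) (Fr i) (Fi i) (y 0 i) z.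
Proof.
move=> z1.
have E : (fun t => (after z t)%:C * band_kernel i (y 0 i - t)) =
  fun t => (after z t * (2 ^+ k i * Gr i (2 ^+ k i * (y 0 i - t)))) +i*
           (after z t * (2 ^+ k i * Gi i (2 ^+ k i * (y 0 i - t)))).
  by apply/funext => t; apply: complex_eq => /=; ring.
rewrite E; split.
  split => /=; apply: integrable_after.
    exact: (continuous_bandpass (y := y 0 i) (profr i)).
  exact: (continuous_bandpass (y := y 0 i) (profi i)).
by rewrite /cint /= (response_integral _ (profr i) z1) (response_integral _ (profi i) z1).
Qed.

Lemma cint_mean i y :
  cintegrable mu1 (fun t => (t * ind01 t)%:C * band_kernel i (y 0 i - t)) /\
  cint mu1 (fun t => (t * ind01 t)%:C * band_kernel i (y 0 i - t)) = cube_response y i.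
Proof.
have E : (fun t => (t * ind01 t)%:C * band_kernel i (y 0 i - t)) =
  fun t => (t * ind01 t * (2 ^+ k i * Gr i (2 ^+ k i * (y 0 i - t)))) +i*
           (t * ind01 t * (2 ^+ k i * Gi i (2 ^+ k i * (y 0 i - t)))).
  by apply/funext => t; apply: complex_eq => /=; ring.
rewrite E; split; last first.
  by rewrite /cint /= (mean_integral _ (profr i)) (mean_integral _ (profi i)).
have int F G H Om : profile (k i) F G H Om C -> mu1.-integrable setT
    (EFin \o (fun t => t * ind01 t * (2 ^+ k i * G (2 ^+ k i * (y 0 i - t))))).
  move=> pr; have := integrable_after 0 (continuousMf (@continuous_idf R) (continuous_bandpass (y := y 0 i) pr)).
  by apply: eq_integrable => // t _ /=; rewrite mul_ind01_after.
by split => /=; [exact: int (profr i)|exact: int (profi i)].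
Qed.

Lemma conv_kern_discrepancy y : conv_kern cube_discrepancy band_kernel y =
  (b ^ n)%:R^-1 * (\sum_nu \prod_i net_response y i nu) - \prod_i cube_response y i.
Proof.
have T1 nu := cint_tensor (fun i => (cint_after i y (proj2 (andP (net_point_01 R M b_prime nu i)))).1).
have T2 := cint_tensor (fun i => (cint_mean i y).1).
have c1 : cintegrable (lebesgue_Rd d) (fun t => (b ^ n)%:R^-1 *
   (\sum_nu \prod_i ((after (pt nu i) (tnth t i))%:C * band_kernel i (y 0 i - tnth t i)))).
  by apply: cintegrableZ; apply: cintegrable_sum => nu; exact: (T1 nu).1.
rewrite /conv_kern.
transitivity (cint (lebesgue_Rd d) (fun t => (b ^ n)%:R^-1 *
   (\sum_nu \prod_i ((after (pt nu i) (tnth t i))%:C * band_kernel i (y 0 i - tnth t i))) +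
   (-1) * \prod_i ((tnth t i * ind01 (tnth t i))%:C * band_kernel i (y 0 i - tnth t i)))).
  apply: eq_cint => t; rewrite cube_discrepancyE.
  have sp (al : 'I_d -> R) : \prod_i ((al i)%:C * band_kernel i (y 0 i - tnth t i)) =
      (\prod_i al i)%:C * \prod_i band_kernel i (y 0 i - tnth t i).
    by rewrite big_split /= (rmorph_prod (real_complex R)).
  rewrite (sp (fun i => tnth t i * ind01 (tnth t i))).
  rewrite [in RHS](eq_bigr _ (fun nu _ => sp (fun i => after (pt nu i) (tnth t i)))).
  rewrite -mulr_suml mulrA mulN1r -mulrBl; congr (_ * _).
  rewrite (rmorphB (real_complex R)) (rmorphM (real_complex R)) fmorphV (rmorph_nat (real_complex R)).
  by rewrite (rmorph_sum (real_complex R)).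
rewrite cintD//; last by apply: cintegrableZ; exact: T2.1.
rewrite cintZ; last by apply: cintegrable_sum => nu; exact: (T1 nu).1.
rewrite (cintZ (-1) T2.1) T2.2 mulN1r cint_sum; last by move=> nu; exact: (T1 nu).1.
congr (_ * _ - _); last by apply: eq_bigr => i _; exact: (cint_mean i y).2.
apply: eq_bigr => nu _; rewrite (T1 nu).2; apply: eq_bigr => i _.
by apply: (cint_after i y _).2; have /andP[] := net_point_01 R M b_prime nu i.
Qed.

End discrepancy_response.

(** * The level averages in L_infinity and L_1 *)

Section level_averages.
Variables (R : realType) (b d s n v : nat) (M : 'I_d -> 'M['F_b]_(s, n)).
Hypothesis b_prime : prime b.
Hypothesis netM : order_digital_net 2 v M.
Variables (k : 'I_d -> nat) (C : R).
Hypothesis C_ge0 : 0 <= C.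
Local Notation pt nu i := (digital_net R M nu 0 i).
Local Notation mu1 := (@lebesgue_measure R).
Local Notation Rt := (d.-tuple (measurableTypeR R)).
Local Notation A := (16 * pi * b%:R * weight_constant b C).
Implicit Types (y : 'rV[R]_d) (a : 'I_d -> nat).
Let b_gt0 := prime_gt0 b_prime.
Let b_gt1 := prime_gt1 b_prime.

Definition level_average a y : R :=
  weight_average M a (fun i => faber_weight b (k i) C (y 0 i) (a i)).

Definition scale_ratio (j l : nat) : R := 2 ^+ j / b%:R ^+ l.

Lemma scale_ratio_gt0 j l : 0 < scale_ratio j l.
Proof. by rewrite divr_gt0// exprn_gt0// ltr0n. Qed.

Let A_ge0 : 0 <= A. Proof. exact: (weight_bound_ge0 b_gt1 C_ge0). Qed.

Lemma level_average_ge0 a y : 0 <= level_average a y.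
Proof. by apply: weight_average_ge0 => i c; exact: faber_weight_ge0. Qed.

(** Box counting gives b^(v+1) / b^min(n, |a|) for the net average. The exact average has b^(-|a|),
    which is no larger than b^(-min(n, |a|)); hence the constant b^(v+1) + 1. *)
Lemma level_average_sup a y : level_average a y <=
  (b%:R ^+ v.+1 + 1) * A ^+ d * (b%:R ^+ minn n (\sum_i a i))^-1 *
  \prod_i Num.min 1 (scale_ratio (k i) (a i)).
Proof.
have w0 i c : 0 <= faber_weight b (k i) C (y 0 i) (a i) c by exact: faber_weight_ge0.
have bm : (0 : R) < b%:R ^+ minn n (\sum_i a i) by rewrite exprn_gt0// ltr0n.
have P : \prod_i (\sum_(0 <= c < b ^ a i) faber_weight b (k i) C (y 0 i) (a i) c) <=
    A ^+ d * \prod_i Num.min 1 (scale_ratio (k i) (a i)).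
  rewrite -[X in A ^+ X]card_ord -prodr_const -big_split /=; apply: ler_prod => i _.
  by rewrite sumr_ge0//= sum_faber_weight.
set Q := A ^+ d * _ in P.
have -> : (b%:R ^+ v.+1 + 1) * A ^+ d * (b%:R ^+ minn n (\sum_i a i))^-1 *
  \prod_i Num.min 1 (scale_ratio (k i) (a i)) =
  b%:R ^+ v.+1 / b%:R ^+ minn n (\sum_i a i) * Q + (b%:R ^+ minn n (\sum_i a i))^-1 * Q.
  by rewrite /Q; ring.
rewrite /level_average /weight_average; apply: lerD.
  apply: le_trans (net_box_sum (R := R) b_prime netM a w0) _.
  by rewrite ler_wpM2l// divr_ge0// ?exprn_ge0// ltW.
rewrite big_split /=; apply: ler_pM => //.
- by apply: prodr_ge0 => i _; rewrite invr_ge0.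
- by apply: prodr_ge0 => i _; rewrite sumr_ge0.
under eq_bigr do rewrite natrX.
rewrite prodfV -expr_sum lef_pV2 ?posrE ?exprn_gt0 ?ltr0n//.
by rewrite ler_weXn2l ?ler1n// geq_minr.
Qed.

(** The integral of a tensor of weights obeys the same bound for every choice of cells, so it passes
    to the mean over the net and to the mean over all cells; the factor 2 counts these two. *)
Lemma level_average_integral a :
  (lebesgue_Rd d).-integrable setT (EFin \o (fun t : Rt => level_average a (rv t))) /\
  \int[lebesgue_Rd d]_t level_average a (rv t) <=
  2 * A ^+ d * (b%:R ^+ (\sum_i a i))^-1 *
  \prod_i Num.min (scale_ratio (k i) (a i)) (scale_ratio (k i) (a i))^-1.
Proof.
pose w i c (x : R) := faber_weight b (k i) C x (a i) c.
have wI i c := integrable_faber_weight (k i) b_gt1 C_ge0 (a i) c.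
set E := (b%:R ^+ (\sum_i a i))^-1 * \prod_i Num.min (scale_ratio (k i) (a i)) (scale_ratio (k i) (a i))^-1.
have bound (W : 'I_d -> R -> R) : (forall i, mu1.-integrable setT (EFin \o W i)) ->
    (forall i x, 0 <= W i x) ->
    (forall i, \int[mu1]_x W i x <= A * ((b%:R ^+ a i)^-1 *
      Num.min (scale_ratio (k i) (a i)) (scale_ratio (k i) (a i))^-1)) ->
    \int[lebesgue_Rd d]_t (\prod_i W i (tnth t i)) <= A ^+ d * E.
  move=> WI W0 WA; rewrite /E (integrable_tensor WI).2 expr_sum -prodfV -big_split /=.
  rewrite -[X in A ^+ X]card_ord -prodr_const -big_split /=.
  apply: ler_prod => i _; rewrite WA andbT.
  by apply: Rintegral_ge0 => x _; exact: W0.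
pose V i x := (b ^ a i)%:R^-1 * \sum_(0 <= c < b ^ a i) w i c x.
have N0 m : (0 : R) < (b ^ m)%:R by rewrite ltr0n expn_gt0 b_gt0.
have VI i : mu1.-integrable setT (EFin \o V i) /\ \int[mu1]_x V i x <= A * ((b%:R ^+ a i)^-1 *
      Num.min (scale_ratio (k i) (a i)) (scale_ratio (k i) (a i))^-1).
  have [h1 h2] := Rintegral_sum (index_iota 0 (b ^ a i)) (fun c => (wI i c).1).
  split; first exact: (integrableZl measurableT _ h1).
  rewrite /V RintegralZl// h2 mulrC ler_pdivrMr//.
  apply: le_trans (ler_sum _ (fun c _ => (wI i c).2)) _.
  by rewrite sumr_const_nat subn0 -[leLHS]mulr_natr.
have T nu := integrable_tensor (fun i => (wI i (cell b (a i) (pt nu i))).1).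
have TV := integrable_tensor (fun i => (VI i).1).
have [S1 S2] := Rintegral_sum (index_enum 'I_(b ^ n)) (fun nu => (T nu).1).
have S1' := integrableZl measurableT (b ^ n)%:R^-1 S1.
have E1 : (fun t : Rt => level_average a (rv t)) = (fun t : Rt =>
   (b ^ n)%:R^-1 * (\sum_nu \prod_i w i (cell b (a i) (pt nu i)) (tnth t i)) +
   \prod_i V i (tnth t i)).
  apply/funext => t; rewrite /level_average /weight_average; congr (_ * _ + _).
    by apply: eq_bigr => nu _; apply: eq_bigr => i _; rewrite /w [rv t 0 i]mxE.
  by apply: eq_bigr => i _; congr (_ * _); apply: eq_bigr => c _; rewrite /w [rv t 0 i]mxE.
rewrite E1; split; first exact: (integrableD measurableT S1' TV.1).
rewrite RintegralD//; last exact: TV.1.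
rewrite RintegralZl// S2.
have -> : 2 * A ^+ d * (b%:R ^+ (\sum_i a i))^-1 *
  \prod_i Num.min (scale_ratio (k i) (a i)) (scale_ratio (k i) (a i))^-1 = A ^+ d * E + A ^+ d * E.
  by rewrite /E; ring.
apply: lerD.
  rewrite mulrC ler_pdivrMr//; apply: (@le_trans _ _ (\sum_(nu < b ^ n) (A ^+ d * E))).
    apply: ler_sum => nu _; apply: (bound (fun i => w i (cell b (a i) (pt nu i)))) => [i|i x|i]; first exact: (wI i _).1.
      exact: faber_weight_ge0.
    exact: (wI i _).2.
  by rewrite sumr_const card_ord -[leLHS]mulr_natr.
apply: (bound V) => [i|i x|i]; first exact: (VI i).1.
  by rewrite mulr_ge0 ?invr_ge0 ?(ltW (N0 _))// sumr_ge0// => c _; exact: faber_weight_ge0.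
exact: (VI i).2.
Qed.

End level_averages.

Section kernel_bound.
Variables (R : realType) (b d s n v : nat) (M : 'I_d -> 'M['F_b]_(s, n)).
Hypothesis b_prime : prime b.
Hypothesis netM : order_digital_net 2 v M.
Variables (k : 'I_d -> nat) (Fr Gr Hr Or Fi Gi Hi Oi : 'I_d -> R -> R) (C : R).
Hypothesis C_ge0 : 0 <= C.
Hypothesis profr : forall i, profile (k i) (Fr i) (Gr i) (Hr i) (Or i) C.
Hypothesis profi : forall i, profile (k i) (Fi i) (Gi i) (Hi i) (Oi i) C.

Lemma conv_kern_bound J (y : 'rV[R]_d) : (n <= J)%N -> (forall i, 2 ^ k i <= b ^ J.+1)%N ->
  normc (conv_kern (cube_discrepancy M) (band_kernel k Gr Gi) y) <=
  \sum_(a : {ffun 'I_d -> 'I_J.+2})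
    multilevel_constant R b d v * multilevel_decay R b n (\sum_i a i) *
    level_average M k C (fun i => a i : nat) y.
Proof.
move=> nJ kJ; have b_gt1 := prime_gt1 b_prime.
have fl i : fine_level b (k i) J.+1 by rewrite /fine_level /= kJ.
rewrite (conv_kern_discrepancy M b_prime profr profi).
apply: (multilevel_bound b_prime netM nJ
  (w := fun i a c => faber_weight b (k i) C (y 0 i) a c)
  (f := fun i => step_response (k i) (Fr i) (Fi i) (y 0 i))).
- by move=> i a c; exact: faber_weight_ge0.
- by move=> i a c cb; exact: (faber_ends b_gt1 C_ge0 (profr i) (profi i) (y 0 i) cb).
- by move=> i c x xI; exact: (rest_fine b_gt1 C_ge0 (profr i) (profi i) (y 0 i) (fl i) xI).
- by move=> i; exact: (response_mean_bound b_gt1 C_ge0 (profr i) (profi i) (y 0 i) (fl i)).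
Qed.

End kernel_bound.

(** * Monotonicity, interpolation and the triangle inequality in L_p *)

Section Lnorm_bounds.
Context d {T : measurableType d} {R : realType} (mu : {measure set T -> \bar R}) (p : R).
Hypothesis p_ge1 : 1 <= p.
Implicit Types f g : T -> R.
Let p0 : 0 < p. Proof. exact: lt_le_trans ltr01 p_ge1. Qed.
Let pn : p != 0. Proof. by rewrite gt_eqF. Qed.

Lemma Lnorm_le f g : measurable_fun setT f -> measurable_fun setT g ->
  (forall x, `|f x| <= g x) ->
  (Lnorm mu p%:E (EFin \o f) <= Lnorm mu p%:E (EFin \o g))%E.
Proof.
move=> mf mg fg; rewrite unlock.
have I h : (0 <= \int[mu]_x (`|(EFin \o h) x| `^ p))%E.
  by apply: integral_ge0 => x _; exact: poweR_ge0.
have mp (h : T -> R) : measurable_fun setT h -> measurable_fun setT (fun x => (`|(EFin \o h) x| `^ p)%E).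
  move=> mh; apply/measurable_EFinP; apply: (measurableT_comp (@measurable_powR R p)).
  exact: measurableT_comp.
apply: gt0_ler_poweR; rewrite ?in_itv/= ?invr_ge0 ?(ltW p0) ?leey ?I//.
apply: ge0_le_integral => //; try by move=> x _; exact: poweR_ge0.
- exact: mp.
- exact: mp.
- move=> x _ /=; rewrite lee_fin ge0_ler_powR ?(ltW p0) ?nnegrE//.
  exact: le_trans (fg x) (ler_norm _).
Qed.

(* [f ^ p <= S ^ (p - 1) * f]. *)
Lemma Lnorm_interpolation f S I : 0 <= S -> measurable_fun setT f ->
  (forall x, 0 <= f x <= S) -> mu.-integrable setT (EFin \o f) ->
  \int[mu]_x f x <= I ->
  (Lnorm mu p%:E (EFin \o f) <= (S `^ (1 - p^-1) * I `^ p^-1)%:E)%E.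
Proof.
move=> S0 mf fS fi fI; rewrite unlock.
have I0 : 0 <= I.
  by apply: le_trans fI; apply: Rintegral_ge0 => x _; have /andP[] := fS x.
have step x : ((`|(EFin \o f) x| `^ p) <= (S `^ (p - 1) * f x)%:E)%E.
  have /andP[f0 f1] := fS x; rewrite /= lee_fin ger0_norm//.
  case: (eqVneq (f x) 0) => [->|fx]; first by rewrite powR0// mulr0.
  have -> : p = (p - 1) + 1 by rewrite subrK.
  rewrite powRD; last by apply/implyP => _; exact: fx.
  rewrite powRr1// addrK ler_wpM2r// ge0_ler_powR ?subr_ge0 ?nnegrE//.
have h : (\int[mu]_x (`|(EFin \o f) x| `^ p) <= (S `^ (p - 1) * I)%:E)%E.
  apply: (@le_trans _ _ (\int[mu]_x (S `^ (p - 1) * f x)%:E)%E).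
    apply: ge0_le_integral => //.
    - by move=> x _; exact: poweR_ge0.
    - apply/measurable_EFinP; apply: (measurableT_comp (@measurable_powR R p)).
      exact: measurableT_comp.
    - by apply/measurable_EFinP; exact: measurable_funM.
  under eq_integral do rewrite EFinM.
  rewrite integralZl// -[X in (_ * X)%E]fineK ?integrable_fin_num//.
  by rewrite -EFinM lee_fin ler_wpM2l ?powR_ge0.
have E : (S `^ (1 - p^-1) * I `^ p^-1)%:E = (((S `^ (p - 1) * I)%:E) `^ p^-1)%E.
  rewrite poweR_EFin powRM ?powR_ge0// -powRrM; congr (_ `^ _ * _)%:E.
  by rewrite mulrBl mul1r divff.
rewrite E; apply: gt0_ler_poweR; rewrite ?in_itv/= ?invr_ge0 ?(ltW p0) ?leey ?andbT//.
  by apply: integral_ge0 => x _; rewrite lee_fin powR_ge0.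
by rewrite lee_fin mulr_ge0 ?powR_ge0.
Qed.

Lemma Lnorm_sum J (r : seq J) (f : J -> T -> R) (B : J -> R) :
  (forall j, measurable_fun setT (f j)) ->
  (forall j, (Lnorm mu p%:E (EFin \o f j) <= (B j)%:E)%E) ->
  (Lnorm mu p%:E (EFin \o (fun x => \sum_(j <- r) f j x)%R) <= (\sum_(j <- r) B j)%:E)%E.
Proof.
move=> mf fB; elim: r => [|j r IH].
  rewrite big_nil (_ : _ \o _ = cst 0%E); first by rewrite Lnorm0// eqe.
  by apply/funext => x /=; rewrite big_nil.
have mS : measurable_fun setT (fun x => \sum_(j <- r) f j x) by exact: measurable_sum.
have := minkowski_EFin mu (mf j) mS p_ge1.
rewrite big_cons EFinD => H.
rewrite (_ : EFin \o _ = EFin \o (f j \+ (fun x => \sum_(j <- r) f j x))); last first.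
  by apply/funext => x /=; rewrite big_cons.
by apply: le_trans H _; apply: leeD.
Qed.

Lemma Lnorm_scale f (c : R) B : 0 <= c -> measurable_fun setT f ->
  (Lnorm mu p%:E (EFin \o f) <= B%:E)%E ->
  (Lnorm mu p%:E (EFin \o (fun x => c * f x)%R) <= (c * B)%:E)%E.
Proof.
move=> c0 mf fB.
suff -> : Lnorm mu p%:E (EFin \o (fun x => c * f x)%R) = (c%:E * Lnorm mu p%:E (EFin \o f))%E.
  by rewrite EFinM lee_wpmul2l.
rewrite unlock.
have mp : measurable_fun setT (fun x => (`|(EFin \o f) x| `^ p)%E).
  apply/measurable_EFinP; apply: (measurableT_comp (@measurable_powR R p)).
  exact: measurableT_comp.
rewrite (_ : (fun x => _) = (fun x => (c `^ p)%:E * (`|(EFin \o f) x| `^ p))%E); last first.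
  by apply/funext => x /=; rewrite normrM powRM// ger0_norm.
rewrite ge0_integralZl//; last first.
- by rewrite lee_fin powR_ge0.
- by move=> x _; exact: poweR_ge0.
rewrite poweRM ?lee_fin ?powR_ge0//; last by apply: integral_ge0 => x _; exact: poweR_ge0.
by rewrite poweR_EFin -powRrM mulfV// powRr1.
Qed.

End Lnorm_bounds.

(** * Summation over levels and blocks *)

Section two_sided_geometric.
Variables (R : realType) (e : R).
Hypothesis e_gt0 : 0 < e.
Implicit Types x t : R.

Definition two_sided x : R := Num.min x x^-1 `^ e.

Lemma two_sidedV x : two_sided x^-1 = two_sided x.
Proof. by rewrite /two_sided invrK minC. Qed.

Lemma two_sided_ge0 x : 0 <= two_sided x.
Proof. exact: powR_ge0. Qed.

Lemma two_sided_small x : 0 < x -> x <= 1 -> two_sided x = x `^ e.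
Proof.
by move=> x0 x1; rewrite /two_sided (min_idPl _)// (le_trans x1)// invf_ge1.
Qed.

Lemma two_sided_large x : 1 <= x -> two_sided x = x `^ (- e).
Proof.
move=> x1; have x0 : 0 < x by exact: lt_le_trans ltr01 x1.
by rewrite -two_sidedV two_sided_small ?invr_gt0 ?invf_le1// -powR_inv1 ?(ltW x0)// -powRrM mulN1r.
Qed.

Lemma two_sided_le1 x : 0 < x -> two_sided x <= 1.
Proof.
move=> x0; have : two_sided x <= 1 `^ e; last by rewrite powR1.
apply: ge0_ler_powR; rewrite ?nnegrE ?(ltW e_gt0)//.
  by rewrite le_min (ltW x0) invr_ge0 (ltW x0).
by rewrite ge_min; case: (leP x 1) => //= /ltW x1; rewrite invf_le1.
Qed.

Lemma two_sided_sum beta K t : 1 < beta -> 0 < t ->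
  \sum_(0 <= j < K) two_sided (t * beta ^+ j) <= 2 / (1 - beta `^ (- e)).
Proof.
move=> b1; have b0 : 0 < beta by exact: lt_trans ltr01 b1.
have r1 : beta `^ (- e) < 1.
  rewrite powRN invf_lt1 ?powR_gt0//; have <- : 1 `^ e = 1 :> R by rewrite powR1.
  by apply: gt0_ltr_powR; rewrite ?nnegrE ?ler01// ltW.
have r0 : 0 < beta `^ (- e) by rewrite powR_gt0.
have rinv : beta `^ (- e) * beta `^ e = 1 by rewrite powRN mulVf// gt_eqF// powR_gt0.
set rho := beta `^ (- e) in r1 r0 rinv *.
pose D := (1 - rho)^-1; have D0 : 0 < D by rewrite invr_gt0 subr_gt0.
have DE : D = 1 + rho * D by rewrite /D; field; rewrite gt_eqF// subr_gt0.
(* A bound that lets the induction move t to t beta. For t >= 1 the terms form a decreasing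
   geometric series. For t < 1 the rising and the falling part contribute at most D each, and the
   subtracted term is the sum over the skipped points t beta^-j, j >= 1. *)
suff H : 0 < t -> \sum_(0 <= j < K) two_sided (t * beta ^+ j) <=
    if 1 <= t then two_sided t * D else 2 * D - rho * D * two_sided t.
  move=> t0; apply: (le_trans (H t0)); have h1 := two_sided_le1 t0; have h0 := two_sided_ge0 t.
  have : two_sided t * D <= D by rewrite ler_piMl// ltW.
  have : 0 <= rho * D * two_sided t by rewrite !mulr_ge0// ltW.
  by rewrite -/D; case: ifP => _; lra.
elim: K t => [|K IH] t t0.
  rewrite big_geq//; case: ifP => _; first by rewrite mulr_ge0 ?two_sided_ge0// ltW.
  have h1 := two_sided_le1 t0; have h0 := two_sided_ge0 t.
  have : rho * D * two_sided t <= D.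
    rewrite -mulrA mulrCA ler_piMr ?(ltW D0)//.
    by rewrite mulr_ile1// ltW.
  lra.
rewrite big_nat_recl// expr0 mulr1.
have tb0 : 0 < t * beta by rewrite mulr_gt0.
rewrite (eq_bigr (fun j => two_sided (t * beta * beta ^+ j))); last first.
  by move=> j _; rewrite exprS mulrA.
apply: le_trans (lerD (lexx _) (IH _ tb0)) _.
have h1 := two_sided_le1 t0; have h0 := two_sided_ge0 t.
have h1' := two_sided_le1 tb0.
have hD : two_sided t * D = two_sided t + rho * D * two_sided t by rewrite {1}DE; ring.
case: (leP 1 t) => [t1|t1].
  have tb1 : 1 <= t * beta by rewrite (le_trans t1)// ler_peMr// ltW.
  have E : two_sided (t * beta) = two_sided t * rho.
    by rewrite !two_sided_large// powRM ?(ltW t0) ?(ltW b0).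
  by rewrite tb1 hD E; lra.
case: (leP 1 (t * beta)) => [tb1|tb1].
  have : two_sided (t * beta) * D <= D by rewrite ler_piMl// ltW.
  have : two_sided t * D <= D by rewrite ler_piMl// ltW.
  lra.
have E : two_sided t = rho * two_sided (t * beta).
  rewrite !two_sided_small// ?(ltW t1) ?(ltW tb1)// powRM ?(ltW t0) ?(ltW b0)//.
  by rewrite mulrCA rinv mulr1.
have -> : rho * D * two_sided (t * beta) = D * two_sided t by rewrite E; ring.
lra.
Qed.

End two_sided_geometric.

Section level_sum.
Variables (R : realType) (rho : R).
Hypothesis rho_gt0 : 0 < rho.
Hypothesis rho_lt1 : rho < 1.

Definition dist_nat (m n : nat) : nat := ((m - n) + (n - m))%N.

Lemma dist_natDr m n : dist_nat m (m + n) = n.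
Proof. by rewrite /dist_nat addKn (eqP (leq_addr n m)). Qed.

Lemma dist_natDl m n : dist_nat (m + n) m = n.
Proof. by rewrite /dist_nat addKn (eqP (leq_addr n m)) addn0. Qed.

Lemma sum_ffun_cons d J (F : {ffun 'I_d.+1 -> 'I_J} -> R) :
  \sum_a F a = \sum_(x < J) \sum_(a : {ffun 'I_d -> 'I_J})
    F [ffun i => if unlift ord0 i is Some j then a j else x].
Proof.
rewrite pair_big /= (reindex (fun p : 'I_J * {ffun 'I_d -> 'I_J} =>
  [ffun i => if unlift ord0 i is Some j then p.2 j else p.1])) //=.
exists (fun a => (a ord0, [ffun j => a (lift ord0 j)])) => [[x a] _|a _] /=.
  congr (_, _); first by rewrite ffunE unlift_none.
  by apply/ffunP => j; rewrite !ffunE liftK.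
by apply/ffunP => i; rewrite ffunE; case: unliftP => [j ->|->]; rewrite ?ffunE.
Qed.

Lemma sum_rev_le (g : nat -> R) n J : (forall x, 0 <= g x) ->
  \sum_(x < J) (if (x <= n)%N then g (n - x)%N else 0) <= \sum_(x < n.+1) g x.
Proof.
move=> g0; pose h x := if (x <= n)%N then g (n - x)%N else 0.
have h0 x : 0 <= h x by rewrite /h; case: ifP.
have -> : \sum_(x < n.+1) g x = \sum_(0 <= x < n.+1) h x.
  rewrite big_mkord [LHS](reindex_inj rev_ord_inj) /=; apply: eq_bigr => x _.
  by rewrite /h -ltnS ltn_ord subSS.
rewrite -(big_mkord xpredT h); case: (leqP J n.+1) => Jn.
  by rewrite [leRHS](@big_cat_nat _ _ _ J)//= lerDl sumr_ge0.
rewrite (@big_cat_nat _ _ _ n.+1) ?(ltnW Jn)//= -[leRHS]addr0 lerD2l.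
rewrite big_nat big1// => x /andP[nx _]; by rewrite /h leqNgt nx.
Qed.

Lemma dist_nat_split (x S n : nat) : rho ^+ dist_nat (x + S) n =
  (if (x <= n)%N then rho ^+ dist_nat S (n - x) else 0) +
  (if (x < n.+1)%N then 0 else rho ^+ (x - n.+1)) * (rho * rho ^+ dist_nat S 0).
Proof.
rewrite ltnS; case: leqP => xn; rewrite ?mul0r ?addr0 ?add0r /dist_nat.
  by congr (_ ^+ _); lia.
rewrite -exprS -exprD; congr (_ ^+ _); lia.
Qed.

(** Induction over the coordinates: for a first coordinate x <= n the target n becomes n - x, which
    gives at most n + 1 sums of lower dimension; for x > n the terms are geometric in x. Each
    coordinate after the initial one costs a factor n + 1. *)
Lemma level_sum d : exists D : R, 0 < D /\ forall n J,
  \sum_(a : {ffun 'I_d.+1 -> 'I_J}) rho ^+ dist_nat (\sum_i a i) n <= D * n.+1%:R ^+ d.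
Proof.
have g0 : 0 < (1 - rho)^-1 by rewrite invr_gt0 subr_gt0.
have r0 := ltW rho_gt0.
have split_sum d' n J : \sum_(a : {ffun 'I_d'.+1 -> 'I_J}) rho ^+ dist_nat (\sum_i a i) n <=
   \sum_(x < J) (if (x <= n)%N then
      (\sum_(a : {ffun 'I_d' -> 'I_J}) rho ^+ dist_nat (\sum_i a i) (n - x)) else 0) +
   (1 - rho)^-1 * (\sum_(a : {ffun 'I_d' -> 'I_J}) rho ^+ dist_nat (\sum_i a i) 0).
  rewrite sum_ffun_cons.
  rewrite (eq_bigr (fun x : 'I_J => (if (x <= n)%N then
      (\sum_(a : {ffun 'I_d' -> 'I_J}) rho ^+ dist_nat (\sum_i a i) (n - x)) else 0) +
     (if (x < n.+1)%N then 0 else rho ^+ (x - n.+1)) *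
     (rho * (\sum_(a : {ffun 'I_d' -> 'I_J}) rho ^+ dist_nat (\sum_i a i) 0)))); last first.
    move=> x _; rewrite !mulr_sumr.
    rewrite (eq_bigr (fun a : {ffun 'I_d' -> 'I_J} =>
      (if (x <= n)%N then rho ^+ dist_nat (\sum_i a i) (n - x) else 0) +
      (if (x < n.+1)%N then 0 else rho ^+ (x - n.+1)) * (rho * rho ^+ dist_nat (\sum_i a i) 0))).
      by rewrite big_split /=; congr (_ + _); case: leqP => // _; rewrite big1.
    move=> a _; rewrite -dist_nat_split big_ord_recl ffunE unlift_none; congr (_ ^+ dist_nat (_ + _) _).
    by apply: eq_bigr => i _; rewrite ffunE liftK.
  rewrite big_split /= lerD2l -mulr_suml.
  set Q := \sum_(a : {ffun _}) _.
  have Q0 : 0 <= Q by apply: sumr_ge0 => a _; exact: exprn_ge0.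
  apply: ler_pM => //.
  - by apply: sumr_ge0 => x _; case: ifP => // _; exact: exprn_ge0.
  - exact: mulr_ge0.
  - by rewrite -(big_mkord xpredT (fun x => if (x < n.+1)%N then 0 else rho ^+ (x - n.+1))) geometric_shift_le.
  - by rewrite ler_piMl// ltW.
elim: d => [|d [D [D0 IH]]].
  exists (2 * (1 - rho)^-1); split; first by rewrite mulr_gt0.
  move=> n J; rewrite expr0 mulr1; apply: le_trans (split_sum _ _ _) _.
  have G0 m : \sum_(a : {ffun 'I_0 -> 'I_J}) rho ^+ dist_nat (\sum_i a i) m = rho ^+ m.
    rewrite (eq_bigr (fun=> rho ^+ m)); last first.
      by move=> a _; rewrite big_ord0 /dist_nat sub0n subn0.
    by rewrite sumr_const card_ffun !card_ord expn0.
  rewrite G0 expr0 mulr1 mulrDl mul1r lerD2r.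
  rewrite (eq_bigr (fun x : 'I_J => if (x <= n)%N then rho ^+ (n - x) else 0)); last first.
    by move=> x _; rewrite G0.
  apply: le_trans (sum_rev_le (g := fun x => rho ^+ x) _ _ _) _; first by move=> x; exact: exprn_ge0.
  apply: le_trans (geometric_shift_le 0 n.+1 r0 rho_lt1); rewrite big_mkord.
  by apply: ler_sum => x _; rewrite subn0.
exists (D * (1 + (1 - rho)^-1)); split; first by rewrite mulr_gt0// addr_gt0.
move=> n J; apply: le_trans (split_sum _ _ _) _.
have n1 : 1 <= n.+1%:R :> R by rewrite ler1n.
rewrite mulrDr mulrDl mulr1; apply: lerD.
  apply: (@le_trans _ _ (\sum_(x < J) (if (x <= n)%N then D * (n - x).+1%:R ^+ d else 0))).
    by apply: ler_sum => x _; case: ifP => // _; exact: IH.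
  apply: le_trans (sum_rev_le (g := fun x => D * x.+1%:R ^+ d) _ _ _) _.
    by move=> x; rewrite mulr_ge0 ?exprn_ge0// ltW.
  apply: (@le_trans _ _ (\sum_(x < n.+1) D * n.+1%:R ^+ d)).
    apply: ler_sum => x _; rewrite ler_wpM2l ?(ltW D0)// lerXn2r ?nnegrE// ler_nat.
    exact: ltn_ord.
  by rewrite sumr_const card_ord -[leLHS]mulr_natr -mulrA -exprSr.
rewrite mulrC -mulrA ler_pM ?(ltW g0)//.
- by apply: sumr_ge0 => a _; exact: exprn_ge0.
- by apply: le_trans (IH _ _) _; rewrite expr1n mulr1.
- by rewrite ler_peMr ?(ltW g0)// exprn_ege1.
Qed.

End level_sum.

(** * Bookkeeping of exponents *)

Section exponents.
Variables (R : realType) (b : nat) (p r : R).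
Hypothesis b_prime : prime b.
Hypothesis p_ge1 : 1 <= p.
Hypothesis r_ge0 : 0 <= r.
Hypothesis r_lt : r < p^-1.
Local Notation eps := (p^-1 - r).

(** 1/p - r is the decay per level for |a| > n; 1/2 is the surplus of the cancellation exponent 3/2
    over 1 for |a| < n. *)
Definition decay_rate : R := b%:R `^ (- Num.min eps 2^-1).

Let b_gt1 : 1 < b%:R :> R. Proof. by rewrite ltr1n prime_gt1. Qed.
Let b_gt0 : 0 < b%:R :> R. Proof. exact: lt_trans ltr01 b_gt1. Qed.
Let p_gt0 : 0 < p. Proof. exact: lt_le_trans ltr01 p_ge1. Qed.
Let pV_le1 : p^-1 <= 1. Proof. by rewrite invf_le1. Qed.
Let pV_ge0 : 0 <= p^-1. Proof. by rewrite invr_ge0 ltW. Qed.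
Let pV1_ge0 : 0 <= 1 - p^-1. Proof. by rewrite subr_ge0. Qed.
Let eps_gt0 : 0 < eps. Proof. by rewrite subr_gt0. Qed.

Lemma decay_rate_gt0 : 0 < decay_rate.
Proof. by rewrite powR_gt0. Qed.

Lemma decay_rate_lt1 : decay_rate < 1.
Proof.
rewrite /decay_rate powRN invf_lt1 ?powR_gt0//.
have dl0 : 0 < Num.min eps 2^-1 by rewrite lt_min eps_gt0 /= invr_gt0.
move: (Num.min _ _) dl0 => dl dl0; apply: (@le_lt_trans _ _ (1 `^ dl)); first by rewrite powR1.
by apply: gt0_ltr_powR; rewrite ?nnegrE ?ler01 ?(ltW b_gt0).
Qed.

Lemma prod_powR I (s : seq I) (F : I -> R) (e : R) : (forall i, 0 <= F i) ->
  \prod_(i <- s) (F i `^ e) = (\prod_(i <- s) F i) `^ e.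
Proof.
move=> F0; elim: s => [|i s IH]; first by rewrite !big_nil powR1.
by rewrite !big_cons IH -powRM// prodr_ge0.
Qed.

Lemma powR_add (c e f : R) : 0 < c -> c `^ e * c `^ f = c `^ (e + f).
Proof. by move=> c0; rewrite powRD//; apply/implyP => _; rewrite gt_eqF. Qed.

(** For x >= 1 the left side is exactly x^(r - 1/p). For x <= 1 it is x^(r + 1), which is better
    than needed because 1/p - r <= 1 + r. *)
Lemma ratio_estimate x : 0 < x ->
  x `^ r * Num.min 1 x `^ (1 - p^-1) * Num.min x x^-1 `^ p^-1 <= two_sided eps x.
Proof.
move=> x0; case: (leP x 1) => [x1|/ltW x1].
  rewrite two_sided_small//.
  rewrite (min_idPl _); last by rewrite (le_trans x1)// invf_ge1.
  rewrite !powR_add//; apply: ger_powR; rewrite ?x0//.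
  by move: pV_le1 r_ge0; lra.
rewrite powR1 mulr1 two_sided_large//.
rewrite (min_idPr _); last by rewrite (le_trans _ x1)// invf_le1.
have -> : x^-1 = x `^ (-1) by rewrite powR_inv1// ltW.
by rewrite -powRrM powR_add// mulN1r opprB.
Qed.

Lemma quarter_baseE : quarter_base R b = b%:R `^ (- 4^-1).
Proof.
rewrite /quarter_base; have -> : b%:R^-1 = b%:R `^ (-1) :> R by rewrite powR_inv1// ltW.
rewrite -powR12_sqrt ?powR_ge0// -powR12_sqrt ?powR_ge0// -!powRrM.
by congr (_ `^ _); field.
Qed.

Lemma invX_powR m : (b%:R ^+ m)^-1 = b%:R `^ (- m%:R) :> R.
Proof. by rewrite powRN powR_mulrn// ltW. Qed.

Lemma decay_estimate n S :
  multilevel_decay R b n S * b%:R `^ (r * S%:R) *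
    (b%:R ^+ minn n S)^-1 `^ (1 - p^-1) * (b%:R ^+ S)^-1 `^ p^-1 <=
  b%:R `^ (n%:R * (r - 1)) * decay_rate ^+ dist_nat S n.
Proof.
have d1 : Num.min eps 2^-1 <= eps by rewrite ge_min lexx.
have d2 : Num.min eps 2^-1 <= 2^-1 by rewrite ge_min lexx orbT.
rewrite /multilevel_decay /decay_rate -(powR_mulrn (dist_nat S n)) ?powR_ge0//.
move: d1 d2; set dl := Num.min _ _ => d1 d2.
rewrite !invX_powR -!powRrM powR_add//; case: leqP => Sn.
  have [m nE] : exists m, n = (S + m)%N by exists (n - S)%N; rewrite subnKC.
  rewrite quarter_baseE -powR_mulrn ?powR_ge0// -powRrM !powR_add//.
  apply: ler_powR; first exact: ltW.
  rewrite nE dist_natDr addKn natrD natrM.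
  have : 0 <= m%:R * (r + 2^-1 - dl) by rewrite mulr_ge0//; move: r_ge0; lra.
  lra.
have [m SE] : exists m, S = (n + m)%N by exists (S - n)%N; rewrite subnKC// ltnW.
rewrite mul1r !powR_add//.
apply: ler_powR; first exact: ltW.
rewrite SE dist_natDl natrD.
have : 0 <= m%:R * (eps - dl) by rewrite mulr_ge0//; lra.
lra.
Qed.

Lemma powR_le_add1 (c e : R) : 0 <= c -> 0 <= e -> e <= 1 -> c `^ e <= c + 1.
Proof.
move=> c0 e0 e1; apply: (@le_trans _ _ ((c + 1) `^ e)).
  by apply: ge0_ler_powR; rewrite ?nnegrE ?addr_ge0// lerDl.
by apply: ler1_powR; rewrite // lerDr.
Qed.

(** From 2^(k_i) = x_i b^(a_i) the weight 2^(r|k|) splits into b^(r|a|) and the x_i^r, after which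
    powers of b and of the x_i are estimated separately. The exponents of [S0] and [T0] lie in
    [0, 1], hence the bounds [S0 + 1] and [T0 + 1]. *)
Lemma level_estimate d n (k a : 'I_d -> nat) (S0 T0 : R) : 0 <= S0 -> 0 <= T0 ->
  2 `^ (r * (\sum_i k i)%N%:R) * (multilevel_decay R b n (\sum_i a i) *
   ((S0 * (b%:R ^+ minn n (\sum_i a i))^-1 * \prod_i Num.min 1 (scale_ratio R b (k i) (a i)))
      `^ (1 - p^-1) *
    (T0 * (b%:R ^+ (\sum_i a i))^-1 *
      \prod_i Num.min (scale_ratio R b (k i) (a i)) (scale_ratio R b (k i) (a i))^-1) `^ p^-1)) <=
  (S0 + 1) * (T0 + 1) * (b%:R `^ (n%:R * (r - 1)) * decay_rate ^+ dist_nat (\sum_i a i) n) *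
  \prod_i two_sided eps (scale_ratio R b (k i) (a i)).
Proof.
move=> S00 T00; have x0 i : 0 < scale_ratio R b (k i) (a i) by exact: scale_ratio_gt0.
set S := (\sum_i a i)%N.
have kE : 2 `^ (r * (\sum_i k i)%N%:R) =
    b%:R `^ (r * S%:R) * \prod_i (scale_ratio R b (k i) (a i) `^ r) :> R.
  rewrite prod_powR; last by move=> i; exact: ltW.
  have powE (c : R) m : 0 <= c -> c `^ (r * m%:R) = (c ^+ m) `^ r.
    by move=> c0; rewrite mulrC powRrM powR_mulrn.
  rewrite !powE ?(ltW b_gt0)//.
  rewrite -powRM; [|by rewrite exprn_ge0// ltW|by apply: prodr_ge0 => i _; exact: ltW].
  congr (_ `^ r).
  rewrite /scale_ratio big_split /= prodfV !expr_sum mulrCA divff ?mulr1//.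
  by rewrite -expr_sum gt_eqF// exprn_gt0.
have m1 i : 0 <= Num.min 1 (scale_ratio R b (k i) (a i)) by rewrite le_min ler01 ltW.
have m2 i : 0 <= Num.min (scale_ratio R b (k i) (a i)) (scale_ratio R b (k i) (a i))^-1.
  by rewrite le_min invr_ge0 !ltW.
have v0 m : 0 <= (b%:R ^+ m)^-1 :> R by rewrite invr_ge0 exprn_ge0.
rewrite kE !powRM ?prodr_ge0 ?mulr_ge0// -!prod_powR//.
set k1 := \prod_i (_ `^ r); set k2 := \prod_i _; set k3 := \prod_i _.
set D := multilevel_decay _ _ _ _; set E1 := _ `^ (1 - _); set E2 := _ `^ (1 - _).
set E3 := T0 `^ _; set E4 := _ `^ p^-1; set B := b%:R `^ _.
have -> : B * k1 * (D * (E1 * E2 * k2 * (E3 * E4 * k3))) =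
   E1 * E3 * (D * B * E2 * E4) * (k1 * k2 * k3) by ring.
have D0 : 0 <= D.
  by rewrite /D /multilevel_decay; case: ifP => // _; rewrite exprn_ge0// ltW// quarter_base_gt0.
apply: ler_pM.
- by rewrite !mulr_ge0 ?powR_ge0.
- by rewrite !mulr_ge0// prodr_ge0// => i _; exact: powR_ge0.
- apply: ler_pM; rewrite ?mulr_ge0 ?powR_ge0//; last exact: decay_estimate.
  by apply: ler_pM; rewrite ?powR_ge0//; apply: powR_le_add1 => //; move: pV_ge0; lra.
rewrite /k1 /k2 /k3 -!big_split /=; apply: ler_prod => i _.
by rewrite !mulr_ge0 ?powR_ge0//= ratio_estimate.
Qed.

End exponents.

(** * Summation of the level bounds *)

Section level_profile.
Variables (R : realType) (b d n : nat) (rho eps : R).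
Hypothesis b_gt1 : (1 < b)%N.
Hypothesis rho_gt0 : 0 < rho.
Hypothesis rho_lt1 : rho < 1.
Hypothesis eps_gt0 : 0 < eps.

(** The bound for block [k] up to constants and the power of b. Summation over [a] for fixed [k],
    with rho^(...) replaced by 1, bounds it uniformly; summation over [k] first reduces the l_1-sum
    to [level_sum]. A finite q combines both. *)
Definition level_profile J (k : 'I_d -> nat) : R :=
  \sum_(a : {ffun 'I_d -> 'I_J}) rho ^+ dist_nat (\sum_i a i) n *
    \prod_i two_sided eps (scale_ratio R b (k i) (a i)).

Definition sum_constant (beta : R) : R := 2 / (1 - beta `^ (- eps)).

Lemma level_profile_ge0 J k : 0 <= level_profile J k.
Proof.
apply: sumr_ge0 => a _; rewrite mulr_ge0 ?exprn_ge0 ?(ltW rho_gt0)//.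
by apply: prodr_ge0 => i _; exact: two_sided_ge0.
Qed.

Lemma level_profile_le J k : level_profile J k <= sum_constant b%:R ^+ d.
Proof.
have bR : 1 < b%:R :> R by rewrite ltr1n.
apply: (@le_trans _ _ (\sum_(a : {ffun 'I_d -> 'I_J})
    \prod_i two_sided eps (scale_ratio R b (k i) (a i)))).
  apply: ler_sum => a _; rewrite ler_piMl//.
    by apply: prodr_ge0 => i _; exact: two_sided_ge0.
  by rewrite exprn_ile1// ltW.
rewrite -(bigA_distr_bigA (fun i (a : 'I_J) => two_sided eps (scale_ratio R b (k i) a))).
rewrite -[X in _ ^+ X]card_ord -prodr_const; apply: ler_prod => i _.
rewrite sumr_ge0 /=; last by move=> a _; exact: two_sided_ge0.
rewrite -(big_mkord xpredT (fun a => two_sided eps (scale_ratio R b (k i) a))).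
rewrite (eq_bigr (fun a => two_sided eps ((2 ^+ k i)^-1 * b%:R ^+ a))).
  by apply: two_sided_sum => //; rewrite invr_gt0 exprn_gt0.
by move=> a _; rewrite -two_sidedV /scale_ratio invf_div mulrC.
Qed.

Lemma sum_level_profile J K :
  \sum_(k : {ffun 'I_d -> 'I_K}) level_profile J (fun i => k i) <=
  sum_constant 2 ^+ d * \sum_(a : {ffun 'I_d -> 'I_J}) rho ^+ dist_nat (\sum_i a i) n.
Proof.
rewrite exchange_big mulr_sumr /=; apply: ler_sum => a _.
rewrite -mulr_sumr mulrC ler_wpM2r ?exprn_ge0 ?(ltW rho_gt0)//.
rewrite -(bigA_distr_bigA (fun i (k : 'I_K) => two_sided eps (scale_ratio R b k (a i)))).
rewrite -[X in _ ^+ X]card_ord -prodr_const; apply: ler_prod => i _.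
rewrite sumr_ge0 /=; last by move=> k _; exact: two_sided_ge0.
rewrite -(big_mkord xpredT (fun k => two_sided eps (scale_ratio R b k (a i)))).
rewrite (eq_bigr (fun k => two_sided eps ((b%:R ^+ a i)^-1 * 2 ^+ k))).
  by apply: two_sided_sum; rewrite ?ltr1n// invr_gt0 exprn_gt0// ltr0n ltnW.
by move=> k _; rewrite /scale_ratio mulrC.
Qed.

End level_profile.

Section cutoff_profiles.
Context {R : realType}.
Local Notation mu1 := (@lebesgue_measure R).

Definition cutoff_profile (phi0 : R -> R[i]) (Fr Gr Hr Or Fi Gi Hi Oi : nat -> R -> R) (C : R) :=
  forall k, [/\ profile k (Fr k) (Gr k) (Hr k) (Or k) C,
    profile k (Fi k) (Gi k) (Hi k) (Oi k) C, cintegrable mu1 (phi1 phi0 k) &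
    forall u, kern (phi1 phi0 k) u =
      (2 ^+ k * Gr k (2 ^+ k * u)) +i* (2 ^+ k * Gi k (2 ^+ k * u))].

Lemma cutoff_profiles phi0 : dyadic_cutoff phi0 ->
  exists Fr Gr Hr Or Fi Gi Hi Oi C, 0 <= C /\ cutoff_profile phi0 Fr Gr Hr Or Fi Gi Hi Oi C.
Proof.
move=> /cutoff_kernel [kre [kre1 [kim [kim1 [C [gre gim kE]]]]]].
have C0 := good_kernel_ge0 gre.
have family (g g1 : R -> R) : good_kernel g g1 C -> exists X : nat -> (R -> R) * (R -> R) * (R -> R),
    forall k, profile k (X k).1.1 (bandpass k g) (X k).1.2 (X k).2 (4 * C).
  move=> gg; suff [X XP] : {X : nat -> (R -> R) * (R -> R) * (R -> R) &
      forall k, profile k (X k).1.1 (bandpass k g) (X k).1.2 (X k).2 (4 * C)} by exists X.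
  apply: (@choice _ _ (fun k X => profile k X.1.1 (bandpass k g) X.1.2 X.2 (4 * C))) => k.
  by have [F [H [Om P]]] := band_profile k gg; exists (F, H, Om).
have [X XP] := family _ _ gre; have [Y YP] := family _ _ gim.
exists (fun k => (X k).1.1), (fun k => bandpass k kre), (fun k => (X k).1.2), (fun k => (X k).2).
exists (fun k => (Y k).1.1), (fun k => bandpass k kim), (fun k => (Y k).1.2), (fun k => (Y k).2).
exists (4 * C); split; first by rewrite mulr_ge0.
by move=> k; have [h1 h2] := kE k; split.
Qed.

End cutoff_profiles.

(** * The L_p-norm of a single block *)

Section block_norm.
Variables (R : realType) (b d s n v : nat) (M : 'I_d -> 'M['F_b]_(s, n)).
Hypothesis b_prime : prime b.
Hypothesis netM : order_digital_net 2 v M.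
Variables (phi0 : R -> R[i]) (Fr Gr Hr Or Fi Gi Hi Oi : nat -> R -> R) (C : R).
Hypothesis C_ge0 : 0 <= C.
Hypothesis prof : cutoff_profile phi0 Fr Gr Hr Or Fi Gi Hi Oi C.
Variable k : {ffun 'I_d -> nat}.
Local Notation mu1 := (@lebesgue_measure R).
Local Notation Rt := (d.-tuple (measurableTypeR R)).
Local Notation K := (band_kernel k (fun i => Gr (k i)) (fun i => Gi (k i))).
Local Notation D := (discrepancy (digital_net R M)).

Lemma represents_block :
  represents (conv_kern (cube_discrepancy M) K) (block phi0 k (distr_of_cube D)).
Proof.
have kernE i x : kern (phi1 phi0 (k i)) x = K i x.
  by have [_ _ _ ->] := prof (k i).
have ci i : cintegrable mu1 (phi1 phi0 (k i)) by have [_ _] := prof (k i).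
apply: (represents_conv_kern (B := 1) (measurable_cube_discrepancy M b_prime)
  (cube_discrepancy_bound M b_prime)
  (Bk := fun i => (2 * pi)^-1 * (2 * \int[mu1]_x normc (phi1 phi0 (k i) x)))).
- move=> i; have [[_ pr _ _ _] [_ pi' _ _ _] _ _] := prof (k i).
  have cont (G H : R -> R) : (forall u, is_derive u (1 : R) G (H u)) ->
      measurable_fun setT (fun x : measurableTypeR R => 2 ^+ k i * G (2 ^+ k i * x)).
    move=> Gd; have := is_derive_continuous (fun u => is_deriveZf (2 ^+ k i) (is_derive_scale (2 ^+ k i) 0 u Gd)).
    have -> : (fun x => 2 ^+ k i * G (2 ^+ k i * x + 0)) = fun x => 2 ^+ k i * G (2 ^+ k i * x).
      by apply/funext => x; rewrite addr0.
    exact: continuous_measurable_fun.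
  by split => /=; [exact: cont pr|exact: cont pi'].
- by move=> i x; rewrite -kernE; exact: normc_kern.
move=> h sh; rewrite /block /inv_fourier_distr /mul_distr /fourier_distr distr_of_cubeE.
rewrite /tuple_functional; apply: eq_cint => t; congr (_ * _).
rewrite /phi (fourier_block ci sh); apply: eq_cint => x; congr (_ * _).
by apply: eq_bigr => i _; rewrite kernE.
Qed.

Local Notation A := (16 * pi * b%:R * weight_constant b C).

Definition sup_constant : R := (b%:R ^+ v.+1 + 1) * A ^+ d.
Definition mean_constant : R := 2 * A ^+ d.

Definition block_constant : R :=
  multilevel_constant R b d v * ((sup_constant + 1) * (mean_constant + 1)).

Let A_ge0 : 0 <= A. Proof. exact: (weight_bound_ge0 (prime_gt1 b_prime) C_ge0). Qed.

Lemma sup_constant_ge0 : 0 <= sup_constant.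
Proof. by apply: mulr_ge0; [rewrite addr_ge0 ?exprn_ge0|exact: exprn_ge0]. Qed.

Lemma mean_constant_ge0 : 0 <= mean_constant.
Proof. by apply: mulr_ge0; [|exact: exprn_ge0]. Qed.

Lemma block_constant_ge0 : 0 <= block_constant.
Proof.
apply: mulr_ge0; first exact: (multilevel_constant_ge0 R d v b_prime).
by rewrite mulr_ge0// addr_ge0// ?sup_constant_ge0 ?mean_constant_ge0.
Qed.

Variables (p r : R).
Hypothesis p_ge1 : 1 <= p.
Hypothesis r_ge0 : 0 <= r.
Local Notation rho := (decay_rate b p r).

(** [normLp_distr] is an infimum, so the convolution representative suffices. Minkowski's inequality
    reduces it to single levels, where L_p is interpolated between the bounds [Sa] in L_infinity and
    [Ta] in L_1. The condition on J makes level J + 1 fine in every coordinate. *)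
Lemma block_norm J : (n <= J)%N -> (forall i, 2 ^ k i <= b ^ J.+1)%N ->
  ((2 `^ (r * (\sum_i k i)%N%:R))%:E *
    normLp_distr p%:E (block phi0 k (distr_of_cube D)) <=
  (block_constant * b%:R `^ (n%:R * (r - 1)) *
    level_profile b n rho (p^-1 - r) J.+2 k)%:E)%E.
Proof.
move=> nJ kJ.
pose c (a : {ffun 'I_d -> 'I_J.+2}) := multilevel_constant R b d v * multilevel_decay R b n (\sum_i a i).
have c0 a : 0 <= c a.
  rewrite mulr_ge0 ?(multilevel_constant_ge0 R d v b_prime)// /multilevel_decay; case: ifP => // _.
  by rewrite exprn_ge0// ltW// quarter_base_gt0.
pose B (a : {ffun 'I_d -> 'I_J.+2}) (t : Rt) := level_average M k C (fun i => a i : nat) (rv t).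
have avI (a : {ffun 'I_d -> 'I_J.+2}) := level_average_integral M b_prime k C_ge0 (fun i => a i : nat).
have mB a : measurable_fun setT (B a).
  exact/measurable_EFinP/measurable_int/(avI a).1.
set Sa := fun a : {ffun 'I_d -> 'I_J.+2} => sup_constant * (b%:R ^+ minn n (\sum_i a i))^-1 *
  \prod_i Num.min 1 (scale_ratio R b (k i) (a i)).
set Ta := fun a : {ffun 'I_d -> 'I_J.+2} => mean_constant * (b%:R ^+ (\sum_i a i))^-1 *
  \prod_i Num.min (scale_ratio R b (k i) (a i)) (scale_ratio R b (k i) (a i))^-1.
have Sa0 a : 0 <= Sa a.
  apply: mulr_ge0; first by rewrite mulr_ge0 ?sup_constant_ge0// invr_ge0 exprn_ge0.
  by apply: prodr_ge0 => i _; rewrite le_min ler01 ltW// scale_ratio_gt0.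
have Bbound a : (Lnorm (lebesgue_Rd d) p%:E (EFin \o (fun t => c a * B a t)%R) <=
    (c a * (Sa a `^ (1 - p^-1) * Ta a `^ p^-1))%:E)%E.
  apply: Lnorm_scale => //; apply: Lnorm_interpolation => //.
  - move=> t; rewrite level_average_ge0//=.
    exact: (level_average_sup b_prime netM k C_ge0 (fun i => a i : nat) (rv t)).
  - exact: (avI a).1.
  - exact: (avI a).2.
have rep := represents_block; have [mg _] := rep.
have norm_le : (normLp p%:E (conv_kern (cube_discrepancy M) K) <=
    (\sum_a c a * (Sa a `^ (1 - p^-1) * Ta a `^ p^-1))%:E)%E.
  apply: le_trans (@Lnorm_sum _ _ _ (lebesgue_Rd d) p p_ge1 _ (index_enum _) (fun a t => c a * B a t)
    _ _ Bbound); last by move=> a; exact: measurable_funM.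
  apply: (Lnorm_le (lebesgue_Rd d) p_ge1).
  - exact: cmeas_normc.
  - by apply: measurable_sum => a; exact: measurable_funM.
  - move=> t; rewrite ger0_norm ?normc_ge0//.
    have pr i : profile (k i) (Fr (k i)) (Gr (k i)) (Hr (k i)) (Or (k i)) C by have [] := prof (k i).
    have pi' i : profile (k i) (Fi (k i)) (Gi (k i)) (Hi (k i)) (Oi (k i)) C by have [_] := prof (k i).
    exact: (conv_kern_bound b_prime netM C_ge0 pr pi' (rv t) nJ kJ).
apply: (@le_trans _ _ ((2 `^ (r * (\sum_i k i)%N%:R))%:E *
   (\sum_a c a * (Sa a `^ (1 - p^-1) * Ta a `^ p^-1))%:E)%E).
  rewrite lee_wpmul2l ?lee_fin ?powR_ge0//.
  by apply: le_trans norm_le; apply: ereal_inf_lbound; exists (conv_kern (cube_discrepancy M) K).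
rewrite -EFinM lee_fin /level_profile !mulr_sumr; apply: ler_sum => a _.
have := level_estimate b_prime p_ge1 r_ge0 n k (fun i => a i : nat) sup_constant_ge0 mean_constant_ge0.
move=> /(ler_wpM2l (multilevel_constant_ge0 R d v b_prime)) H.
rewrite /block_constant /c /Sa /Ta.
by apply: le_trans (le_trans _ H) _; rewrite le_eqVlt; apply/orP; left; apply/eqP; ring.
Qed.

End block_norm.

Section esum_box.
Variables (R : realType) (d : nat).

Definition widen_index K (k : {ffun 'I_d -> 'I_K}) : {ffun 'I_d -> nat} := [ffun i => k i : nat].

(** The sum is a supremum over finite sets, each of which lies in a box. The majorant [g] may depend
    on the box, as it must: the truncation level of the expansions grows with the indices k_i. *)
Lemma esum_le_box (f : {ffun 'I_d -> nat} -> \bar R) (X : R) :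
  (forall K, exists g : {ffun 'I_d -> nat} -> R,
    [/\ forall k, 0 <= g k, forall k : {ffun 'I_d -> nat}, (forall i, k i < K)%N -> (f k <= (g k)%:E)%E &
      \sum_(k : {ffun 'I_d -> 'I_K}) g (widen_index k) <= X]) ->
  (\esum_(k in [set: {ffun 'I_d -> nat}]) f k <= X%:E)%E.
Proof.
move=> H; apply: ge_ereal_sup => _ [A [finA _] <-].
rewrite fsbig_finite//; have su : uniq (finmap.enum_fset (fset_set A)) by exact: finmap.fset_uniq.
set s : seq {ffun 'I_d -> nat} := finmap.enum_fset _ in su *.
pose K := (\max_(k <- s) \max_i k i).+1.
have sK (k : {ffun 'I_d -> nat}) : k \in s -> forall i, (k i < K)%N.
  move=> ks i; rewrite ltnS; apply: (@leq_trans (\max_i k i)).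
    exact: (leq_bigmax (F := fun i => k i)).
  exact: (leq_bigmax_seq (F := fun k : {ffun 'I_d -> nat} => \max_i k i)).
have [g [g0 fg gX]] := H K.
apply: (@le_trans _ _ (\sum_(k <- s) (g k)%:E)%E).
  rewrite big_seq [leRHS]big_seq; apply: lee_sum => k ks; apply: fg; exact: sK.
rewrite sumEFin lee_fin; apply: le_trans gX.
pose L := [seq widen_index k | k : {ffun 'I_d -> 'I_K}].
have Lu : uniq L.
  rewrite map_inj_uniq ?enum_uniq//.
  move=> k1 k2 /ffunP E; apply/ffunP => i; apply: val_inj.
  by have := E i; rewrite !ffunE.
have sL : {subset s <= L}.
  move=> k ks; apply/mapP; exists [ffun i => Ordinal (sK k ks i)]; first by rewrite mem_enum.
  by apply/ffunP => i; rewrite !ffunE.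
have -> : \sum_(k : {ffun 'I_d -> 'I_K}) g (widen_index k) = \sum_(k <- L) g k.
  by rewrite /L big_map big_enum.
rewrite [leRHS](bigID (fun k => k \in s)) /= -[X in _ <= X + _]big_filter.
rewrite (perm_big [seq k <- L | k \in s]) /=; last first.
  apply: uniq_perm; [exact: su|exact: filter_uniq|].
  by move=> k; rewrite mem_filter; case ks: (k \in s) => //=; rewrite sL.
by rewrite lerDl sumr_ge0.
Qed.

End esum_box.

(** * The Besov norm on the whole space *)

Section besov_bound.
Variables (R : realType) (b d v : nat) (phi0 : R -> R[i]) (p r : R).
Hypothesis b_prime : prime b.
Hypothesis p_ge1 : 1 <= p.
Hypothesis r_ge0 : 0 <= r.
Hypothesis r_lt : r < p^-1.
Hypothesis phi0_cutoff : dyadic_cutoff phi0.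
Local Notation eps := (p^-1 - r).
Local Notation rho := (decay_rate b p r).
Local Notation G := (sum_constant eps b%:R ^+ d.+1).
Local Notation T M := (distr_of_cube (discrepancy (digital_net R M))).
Let b_gt1 := prime_gt1 b_prime.
Let eps_gt0 : 0 < eps. Proof. by rewrite subr_gt0. Qed.
Let rho_gt0 := decay_rate_gt0 p r b_prime.
Let rho_lt1 : rho < 1. Proof. exact: decay_rate_lt1. Qed.

Lemma normLp_distr_ge0 (q : \bar R) (f : @functional R d.+1) : (0 <= normLp_distr q f)%E.
Proof. by apply: le_ereal_inf_tmp => _ [g _ <-]; exact: Lnorm_ge0. Qed.

Lemma besov_norm_discrepancy_fin (q : R) : 1 <= q -> exists C : R, 0 < C /\
  forall (n s : nat) (M : 'I_d.+1 -> 'M['F_b]_(s, n)), (0 < n)%N -> order_digital_net 2 v M ->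
  (besov_norm_Rd p%:E q%:E r phi0 (T M) <=
    (C * b%:R `^ (n%:R * (r - 1)) * n%:R `^ (d%:R / q))%:E)%E.
Proof.
move=> q1; have q0 : 0 < q by exact: lt_le_trans ltr01 q1.
have [Fr [Gr [Hr [Or [Fi [Gi [Hi [Oi [C [C0 prof]]]]]]]]]] := cutoff_profiles phi0_cutoff.
have [D [D0 lD]] := level_sum rho_gt0 rho_lt1 d.
pose BC := block_constant b d.+1 v C.
have BC0 : 0 <= BC by exact: block_constant_ge0.
have G0 : 0 <= G.
  have := @level_profile_le R b d.+1 0 rho eps b_gt1 rho_gt0 rho_lt1 eps_gt0 0 (fun=> 0%N).
  by apply: le_trans; exact: level_profile_ge0.
(* The sign of the constant for base 2 is read off from the uniform bound with 2 in place of b and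
   an empty sum. *)
have G20 : 0 <= sum_constant eps 2 ^+ d.+1.
  have := @level_profile_le R 2 d.+1 0 rho eps isT rho_gt0 rho_lt1 eps_gt0 0 (fun=> 0%N).
  by apply: le_trans; exact: level_profile_ge0.
(* The sum of the q-th powers of the profiles is at most the (q - 1)-th power of their supremum,
   bounded by G, times their sum; this is where q >= 1 enters. The factor 2^d comes from n + 1 <=
   2n. *)
pose X := G `^ (q - 1) * (sum_constant eps 2 ^+ d.+1 * (D * 2 ^+ d)).
have X0 : 0 <= X.
  apply: mulr_ge0; first exact: powR_ge0.
  by apply: mulr_ge0 => //; apply: mulr_ge0; [exact: ltW|exact: exprn_ge0].
exists (BC * X `^ q^-1 + 1); split.
  by rewrite ltr_wpDl//; exact: mulr_ge0 BC0 (powR_ge0 _ _).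
move=> n s M n0 netM; pose B := BC * b%:R `^ (n%:R * (r - 1)).
have B0 : 0 <= B by exact: mulr_ge0 BC0 (powR_ge0 _ _).
have key : (\esum_(k in [set: {ffun 'I_d.+1 -> nat}])
   ((2 `^ (r * (\sum_i k i)%N%:R * q))%:E * normLp_distr p%:E (block phi0 k (T M)) `^ q)
   <= (B `^ q * (X * n%:R ^+ d))%:E)%E.
  (* This level suits all k in the box: J >= n, and 2^(k_i) <= 2^(J+1) <= b^(J+1) because b >= 2. *)
  apply: esum_le_box => K; pose J := (n + K)%N.
  pose Z (k : {ffun 'I_d.+1 -> nat}) := level_profile b n rho eps J.+2 k.
  have Z0 k : 0 <= Z k by exact: level_profile_ge0.
  exists (fun k => B `^ q * Z k `^ q); split.
  - by move=> k; rewrite mulr_ge0 ?powR_ge0.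
  - move=> k kK.
    have := block_norm b_prime netM C0 prof p_ge1 r_ge0 (leq_addr K n : (n <= J)%N) (k := k).
    have kJ i : (2 ^ k i <= b ^ J.+1)%N.
      apply: (@leq_trans (2 ^ J.+1)); last by rewrite leq_exp2r.
      by rewrite leq_exp2l// ltnW// ltnS (leq_trans (ltnW (kK i)))// leq_addl.
    move=> /(_ kJ) H.
    have -> : (B `^ q * Z k `^ q)%:E = ((B * Z k)%:E `^ q)%E by rewrite poweR_EFin powRM.
    have -> : (2 `^ (r * (\sum_i k i)%N%:R * q))%:E = ((2 `^ (r * (\sum_i k i)%N%:R))%:E `^ q)%E.
      by rewrite poweR_EFin -powRrM.
    rewrite -poweRM ?lee_fin ?powR_ge0 ?normLp_distr_ge0//.
    apply: gt0_ler_poweR; rewrite ?in_itv/= ?leey ?andbT ?(ltW q0)//.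
    + by rewrite mule_ge0 ?lee_fin ?powR_ge0 ?normLp_distr_ge0.
    + by rewrite lee_fin mulr_ge0.
  rewrite -mulr_sumr ler_wpM2l ?powR_ge0//.
  apply: (@le_trans _ _ (\sum_(k : {ffun 'I_d.+1 -> 'I_K}) G `^ (q - 1) * level_profile b n rho eps J.+2 (fun i => k i))).
    apply: ler_sum => k _.
    have <- : level_profile b n rho eps J.+2 (widen_index k) = level_profile b n rho eps J.+2 (fun i => k i).
      by congr level_profile; apply/funext => i; rewrite ffunE.
    rewrite -/(Z _) -mulr_powRB1// mulrC ler_wpM2r// ge0_ler_powR ?nnegrE ?subr_ge0//.
    exact: level_profile_le.
  rewrite -mulr_sumr /X -!mulrA ler_wpM2l ?powR_ge0//.
  apply: le_trans (sum_level_profile _ _ b_gt1 rho_gt0 eps_gt0 _ _) _.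
  rewrite ler_wpM2l//; apply: le_trans (lD _ _) _.
  rewrite ler_wpM2l ?(ltW D0)// -exprMn lerXn2r ?nnegrE ?mulr_ge0//.
  by rewrite -natrM ler_nat mul2n -addnn -addn1 leq_add2l.
rewrite /besov_norm_Rd.
apply: (@le_trans _ _ ((B `^ q * (X * n%:R ^+ d))%:E `^ q^-1)%E).
  apply: gt0_ler_poweR; rewrite ?in_itv/= ?leey ?andbT ?invr_ge0 ?(ltW q0)//.
  - by apply: esum_ge0 => k _; rewrite mule_ge0 ?lee_fin ?powR_ge0 ?poweR_ge0.
  - by rewrite lee_fin; apply: mulr_ge0 (powR_ge0 _ _) _; apply: mulr_ge0 X0 _; exact: exprn_ge0.
have Xn0 : 0 <= X * n%:R ^+ d by apply: mulr_ge0 X0 _; exact: exprn_ge0.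
rewrite poweR_EFin lee_fin powRM ?powR_ge0// powRM ?exprn_ge0//.
rewrite -powRrM mulfV ?gt_eqF// powRr1//.
have -> : (n%:R ^+ d) `^ q^-1 = n%:R `^ (d%:R / q) :> R by rewrite powRrM powR_mulrn.
rewrite mulrA ler_wpM2r ?powR_ge0// /B mulrAC ler_wpM2r ?powR_ge0//.
by rewrite lerDl.
Qed.

(** Each block is bounded on its own, with J chosen from its index k. The uniform bound for the
    level profile applies, so no power of n arises. *)
Lemma besov_norm_discrepancy_oo : exists C : R, 0 < C /\
  forall (n s : nat) (M : 'I_d.+1 -> 'M['F_b]_(s, n)), (0 < n)%N -> order_digital_net 2 v M ->
  (besov_norm_Rd p%:E +oo r phi0 (T M) <= (C * b%:R `^ (n%:R * (r - 1)))%:E)%E.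
Proof.
have [Fr [Gr [Hr [Or [Fi [Gi [Hi [Oi [C [C0 prof]]]]]]]]]] := cutoff_profiles phi0_cutoff.
have BC0 := block_constant_ge0 d.+1 v b_prime C0.
have G0 : 0 <= G.
  have := @level_profile_le R b d.+1 0 rho eps b_gt1 rho_gt0 rho_lt1 eps_gt0 0 (fun=> 0%N).
  by apply: le_trans; exact: level_profile_ge0.
exists (block_constant b d.+1 v C * G + 1); split; first by rewrite ltr_wpDl//; exact: mulr_ge0 BC0 G0.
move=> n s M n0 netM; apply: ge_ereal_sup => _ [k _ <-].
pose J := (n + \sum_i k i)%N.
have kJ i : (2 ^ k i <= b ^ J.+1)%N.
  apply: (@leq_trans (2 ^ J.+1)); last by rewrite leq_exp2r.
  rewrite leq_exp2l// ltnW// ltnS; apply: (@leq_trans (\sum_i k i)%N); last exact: leq_addl.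
  by rewrite (bigD1 i)//= leq_addr.
have := block_norm b_prime netM C0 prof p_ge1 r_ge0 (leq_addr _ n : (n <= J)%N) kJ.
move/le_trans; apply; rewrite lee_fin mulrAC ler_wpM2r ?powR_ge0//.
apply: (@le_trans _ _ (block_constant b d.+1 v C * G)); last by rewrite lerDl.
by rewrite ler_wpM2l//; exact: level_profile_le.
Qed.

End besov_bound.

(** * Restriction to the cube and conclusion *)

Lemma besov_norm_cube_le (R : realType) (b d s n : nat) (M : 'I_d -> 'M['F_b]_(s, n))
    (p q : \bar R) (r : R) (phi0 : R -> R[i]) (X : R)
    (f := distr_of_cube (discrepancy (digital_net R M))) : prime b ->
  (besov_norm_Rd p q r phi0 f <= X%:E)%E -> (besov_norm_cube p q r phi0 f <= X%:E)%E.
Proof.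
move=> b_prime fX; apply: (le_trans _ fX); apply: ereal_inf_lbound; exists f => //; split => //; split.
  rewrite /f distr_of_cubeE.
  exact: tempered_tuple_functional (measurable_cube_discrepancy M b_prime) (cube_discrepancy_bound M b_prime).
exact: le_lt_trans fX (ltry _).
Qed.

Theorem theorem1p3 (R : realType) (d b v : nat) (p q : \bar R) (r : R)
    (phi0 : R -> R[i])
    (d_ge1 : (1 <= d)%N) (b_prime : prime b)
    (p_ge1 : (1 <= p)%E) (q_ge1 : (1 <= q)%E)
    (q_gt1 : p = +oo%E -> (1 < q)%E)
    (r_ge0 : 0 <= r) (r_lt : (r%:E < p^-1)%E)
    (phi0_cutoff : dyadic_cutoff phi0) :
  exists C : R, 0 < C /\
    forall (n s : nat) (M : 'I_d -> 'M['F_b]_(s, n)),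
      (0 < n)%N ->
      order_digital_net 2 v M ->
      (besov_norm_cube p q r phi0
         (distr_of_cube (discrepancy (digital_net R M)))
       <= (C * b%:R `^ (n%:R * (r - 1))
             * n%:R `^ ((d%:R - 1) * fine q^-1))%:E)%E.
Proof.
case: p p_ge1 q_gt1 r_lt => [p p1 _|_ _|//]; last first.
  (* For p = oo the condition r < 1/p reads r < 0 and contradicts r >= 0, so p is finite from here
     on. *)
  by rewrite invey lte_fin ltNge r_ge0.
rewrite lee_fin in p1; rewrite inver gt_eqF ?(lt_le_trans ltr01 p1)// lte_fin => r_lt.
case: d d_ge1 => // d _; have -> : d.+1%:R - 1 = d%:R :> R by rewrite -natr1 addrK.
case: q q_ge1 => [q q1|_|//].
  rewrite lee_fin in q1; rewrite inver gt_eqF ?(lt_le_trans ltr01 q1)//=.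
  have [C [C0 HC]] := besov_norm_discrepancy_fin d v b_prime p1 r_ge0 r_lt phi0_cutoff q1.
  by exists C; split => // n s M n0 netM; apply: besov_norm_cube_le => //; exact: HC.
have [C [C0 HC]] := besov_norm_discrepancy_oo d v b_prime p1 r_ge0 r_lt phi0_cutoff.
exists C; split => // n s M n0 netM; apply: besov_norm_cube_le => //.
(* The inverse of q = oo is 0, so the power of n is n^0 = 1. *)
by rewrite invey /= mulr0 powRr0 mulr1; exact: HC.
Qed.
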